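(* Let $G$ be a compact Lie group and let $n \geq 1$ be an integer. Let $\alpha$ be the canonical action of $G$ on $C(G^{\star(n+1)})$, where $G^{\star(n+1)}$ is the $(n+1)$-fold join of $G$ with itself. Then $\dim_{\mathrm{Rok}}^{\mathrm{c}}(\alpha) = n$.
   Context: Lie groups are not required to be connected; in particular finite groups are compact Lie groups. The join of compact Hausdorff spaces $X, Y$ is $X \star Y = (X \times Y \times [0,1])/{\sim}$ with $(x,y,0) \sim (x',y,0)$ and $(x,y,1) \sim (x,y',1)$, and if $G$ acts on $X$ and $Y$ then $G$ acts on $X \star Y$ by $g \cdot (x,y,t) = (g\cdot x, g \cdot y, t)$. $G^{\star k} = G \star \cdots \star G$ ($k$ copies) carries the $G$-action induced from left translation of $G$ on itself, and the canonical action on $C(G^{\star k})$ is $\alpha_g(f)(x) = f(g^{-1}\cdot x)$. Rokhlin dimension with commuting towers. Let $\alpha \colon G \to \operatorname{Aut}(A)$ be a (point-norm continuous) action of a compact group $G$ on a separable $C^*$-algebra $A$. Put $A_\infty = \ell^\infty(A)/c_0(A)$, with $A \subseteq A_\infty$ as (classes of) constant sequences; let $\mathrm{Ann}(A) = \{x \in A_\infty \cap A' : xa = 0 \text{ for all } a \in A\}$ and $F_\infty(A) = (A_\infty \cap A')/\mathrm{Ann}(A)$, a unital $C^*$-algebra (if $A$ is unital, $\mathrm{Ann}(A) = 0$ and $F_\infty(A) = A_\infty \cap A'$). The action $\alpha$ induces an action on $F_\infty(A)$, and $F_\infty^{(\alpha)}(A)$ denotes the subalgebra of elements on which $G$ acts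 continuously. $\dim_{\mathrm{Rok}}^{\mathrm{c}}(\alpha)$ is the least integer $d \geq 0$ for which there exist $G$-equivariant completely positive contractive order zero maps $\varphi_0, \ldots, \varphi_d \colon C(G) \to F_\infty^{(\alpha)}(A)$ with pairwise commuting ranges and $\sum_{j=0}^d \varphi_j(1) = 1$, where $G$ acts on $C(G)$ by left translation; it is $\infty$ if no such $d$ exists. Equivalently, $\dim_{\mathrm{Rok}}^{\mathrm{c}}(\alpha) \leq d$ if and only if there is a unital $G$-equivariant homomorphism $C(G^{\star(d+1)}) \to F_\infty^{(\alpha)}(A)$.
   Formalization: The group G is assumed nontrivial: for the trivial group, C(G) is the complex numbers, c ↦ c·1 is a single Rokhlin tower, and the Rokhlin dimension is 0 rather than n ≥ 1. *)

(* Defs.v *)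
From HB Require Import structures.
From mathcomp Require Import all_boot all_order all_algebra.
From mathcomp Require Import complex.
From mathcomp Require Import boolp classical_sets functions reals ereal.
From mathcomp Require Import topology normedtype derive sequences.

Set Implicit Arguments.
Unset Strict Implicit.
Unset Printing Implicit Defensive.

Import Order.TTheory GRing.Theory Num.Theory.
Import numFieldNormedType.Exports.

Local Open Scope classical_set_scope.
Local Open Scope ring_scope.
Local Open Scope complex_scope.
Local Open Scope quotient_scope.

Declare Scope star_scope.
Delimit Scope star_scope with star.
Local Open Scope star_scope.

(* Complex *-algebras, not necessarily unital. *)
HB.mixin Record isStarAlgebra (R : realType) A of GRing.Lmodule R[i] A := {
  smul : A -> A -> A;
  star : A -> A;
  smulA : associative smul;
  smulDl : left_distributive smul +%R;
  smulDr : right_distributive smul +%R;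
  scale_smull : forall (c : R[i]) (a b : A), smul (c *: a) b = c *: smul a b;
  scale_smulr : forall (c : R[i]) (a b : A), smul a (c *: b) = c *: smul a b;
  starK : involutive star;
  starD : {morph star : a b / a + b};
  starZ : forall (c : R[i]) (a : A), star (c *: a) = c^* *: star a;
  starM : forall a b : A, star (smul a b) = smul (star b) (star a)
}.

#[short(type="starAlgType")]
HB.structure Definition StarAlgebra (R : realType) :=
  {A of GRing.Lmodule R[i] A & isStarAlgebra R A}.

Notation "a ** b" := (smul a b) (at level 40, left associativity) : star_scope.

HB.mixin Record StarAlgebra_isCStar (R : realType) A
    of StarAlgebra R A & CompleteNormedModule R[i] A := {
  norm_smul_le : forall a b : A, `|a ** b| <= `|a| * `|b|;
  norm_starM : forall a : A, `|star a ** a| = `|a| ^+ 2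
}.

#[short(type="cstarAlgType")]
HB.structure Definition CStarAlgebra (R : realType) :=
  {A of StarAlgebra R A & CompleteNormedModule R[i] A & StarAlgebra_isCStar R A}.

(* Norms over R[i] take values in R[i]; they are real, and [rnorm] is the same
   norm as an element of R. *)
Definition rnorm (R : realType) (A : normedModType R[i]) (a : A) : R :=
  complex.Re `|a|.

(* Positivity in matrix algebras over [B]; it is only used when [B] is a
   C*-algebra, or F_oo(A) below, where an element of M_k(B) is positive
   if and only if it is of the form Y^* Y. *)
Definition positive_mx (R : realType) (B : starAlgType R) k (X : 'M[B]_k) :=
  exists Y : 'M[B]_k, forall i j, X i j = \sum_l star (Y l i) ** Y l j.

Definition positive_elt (R : realType) (B : starAlgType R) (x : B) :=
  exists y : B, x = star y ** y.

Definition completely_positive (R : realType) (B D : starAlgType R)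
    (phi : B -> D) :=
  forall k (X : 'M[B]_k), positive_mx X -> positive_mx (map_mx phi X).

Definition order_zero (R : realType) (B D : starAlgType R) (phi : B -> D) :=
  forall a b : B, positive_elt a -> positive_elt b ->
    a ** b = 0 -> phi a ** phi b = 0.

Section star_theory.
Context {R : realType} {E : starAlgType R}.
Implicit Types x y : E.

Lemma smul0l x : 0 ** x = 0.
Proof. by rewrite -[X in X ** _](scale0r (0 : E)) scale_smull scale0r. Qed.
Lemma smul0r x : x ** 0 = 0.
Proof. by rewrite -[X in _ ** X](scale0r (0 : E)) scale_smulr scale0r. Qed.
Lemma smulNl x y : (- x) ** y = - (x ** y).
Proof. by rewrite -scaleN1r scale_smull scaleN1r. Qed.
Lemma smulNr x y : x ** (- y) = - (x ** y).
Proof. by rewrite -scaleN1r scale_smulr scaleN1r. Qed.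
Lemma star0 : star 0 = 0 :> E.
Proof. by apply: (@addrI _ (star (0 : E))); rewrite -starD !addr0. Qed.
Lemma starN x : star (- x) = - star x.
Proof.
by apply/eqP; rewrite -addr_eq0 -starD addNr star0.
Qed.
Lemma starB x y : star (x - y) = star x - star y.
Proof. by rewrite starD starN. Qed.
Lemma smulBl x y z : (x - y) ** z = x ** z - y ** z :> E.
Proof. by rewrite smulDl smulNl. Qed.
Lemma smulBr x y z : z ** (x - y) = z ** x - z ** y :> E.
Proof. by rewrite smulDr smulNr. Qed.
End star_theory.

(* A *-subalgebra [sq_dom] of [E] and a *-ideal [sq_ker] of [sq_dom]; the
   *-algebra sq_dom / sq_ker is [subquot] below. *)
Record star_subquotient (R : realType) (E : starAlgType R) := StarSubquotient {
  sq_dom : set E;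
  sq_ker : set E;
  sq_ker_sub : sq_ker `<=` sq_dom;
  sq_dom_lin : forall (c : R[i]) x y,
    sq_dom x -> sq_dom y -> sq_dom (c *: x + y);
  sq_domM : forall x y, sq_dom x -> sq_dom y -> sq_dom (x ** y);
  sq_dom_star : forall x, sq_dom x -> sq_dom (star x);
  sq_ker0 : sq_ker 0;
  sq_ker_lin : forall (c : R[i]) x y,
    sq_ker x -> sq_ker y -> sq_ker (c *: x + y);
  sq_kerMl : forall x y, sq_dom x -> sq_ker y -> sq_ker (x ** y);
  sq_kerMr : forall x y, sq_ker x -> sq_dom y -> sq_ker (x ** y);
  sq_ker_star : forall x, sq_ker x -> sq_ker (star x)
}.

Section subquotient.
Context {R : realType} {E : starAlgType R} (S : star_subquotient E).
Local Notation D := (sq_dom S).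
Local Notation N := (sq_ker S).

Definition sq_equiv (x y : D) : bool := `[< N (set_val x - set_val y) >].

Let kerN x : N x -> N (- x).
Proof.
by move=> nx; rewrite -scaleN1r -[_ *: _]addr0; apply: sq_ker_lin => //; exact: sq_ker0.
Qed.

Let kerD x y : N x -> N y -> N (x + y).
Proof. by move=> nx ny; rewrite -[x]scale1r; exact: sq_ker_lin. Qed.

Lemma sq_equivP : equiv_class_of sq_equiv.
Proof.
split=> [x|x y|y x z]; rewrite /sq_equiv.
- by apply/asboolP; rewrite subrr; exact: sq_ker0.
- by apply/asboolP/asboolP => /kerN; rewrite opprB.
- move=> /asboolP xy /asboolP yz; apply/asboolP.
  by have := kerD xy yz; rewrite addrA subrK.
Qed.

Canonical sq_equiv_rel := EquivRelPack sq_equivP.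

Definition subquot : Type := {eq_quot sq_equiv_rel}.
HB.instance Definition _ := Choice.on subquot.
HB.instance Definition _ := Quotient.on subquot.

Definition sq_class (x : E) (Dx : D x) : subquot :=
  \pi_subquot (exist _ x (mem_set Dx) : D).

Definition sq_repr (q : subquot) : E := set_val (repr q : D).

Lemma sq_reprP q : D (sq_repr q).
Proof. exact: set_valP. Qed.

Lemma sq_class_eq x y (Dx : D x) (Dy : D y) :
  N (x - y) -> sq_class Dx = sq_class Dy.
Proof. by move=> h; apply/eqmodP; rewrite /= /sq_equiv; exact/asboolP. Qed.

Lemma sq_reprK q : sq_class (sq_reprP q) = q.
Proof.
by rewrite -[RHS]reprK /sq_class; congr (\pi _); apply: val_inj.
Qed.

Lemma sq_class_repr x (Dx : D x) : N (sq_repr (sq_class Dx) - x).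
Proof.
rewrite /sq_repr /sq_class; case: piP => y /eqmodP /= /asboolP /kerN.
by rewrite opprB.
Qed.

Lemma sq_dom0 : D 0.
Proof. exact/sq_ker_sub/sq_ker0. Qed.
Lemma sq_domD x y : D x -> D y -> D (x + y).
Proof. by move=> ? ?; rewrite -[x]scale1r; exact: sq_dom_lin. Qed.
Lemma sq_domZ c x : D x -> D (c *: x).
Proof. by move=> ?; rewrite -[_ *: _]addr0; apply: sq_dom_lin => //; exact: sq_dom0. Qed.
Lemma sq_domN x : D x -> D (- x).
Proof. by move=> ?; rewrite -scaleN1r; exact: sq_domZ. Qed.

Definition sq_zero : subquot := sq_class sq_dom0.
Definition sq_add (p q : subquot) : subquot :=
  sq_class (sq_domD (sq_reprP p) (sq_reprP q)).
Definition sq_opp (p : subquot) : subquot := sq_class (sq_domN (sq_reprP p)).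
Definition sq_scale (c : R[i]) (p : subquot) : subquot :=
  sq_class (sq_domZ c (sq_reprP p)).
Definition sq_mul (p q : subquot) : subquot :=
  sq_class (sq_domM (sq_reprP p) (sq_reprP q)).
Definition sq_star (p : subquot) : subquot :=
  sq_class (sq_dom_star (sq_reprP p)).

Lemma sq_addE x y (Dx : D x) (Dy : D y) :
  sq_add (sq_class Dx) (sq_class Dy) = sq_class (sq_domD Dx Dy).
Proof.
apply: sq_class_eq; rewrite opprD addrACA.
by apply: kerD; exact: sq_class_repr.
Qed.

Lemma sq_scaleE c x (Dx : D x) :
  sq_scale c (sq_class Dx) = sq_class (sq_domZ c Dx).
Proof.
apply: sq_class_eq; rewrite -scalerBr -[_ *: _]addr0.
by apply: sq_ker_lin; [exact: sq_class_repr|exact: sq_ker0].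
Qed.

Lemma sq_oppE x (Dx : D x) :
  sq_opp (sq_class Dx) = sq_class (sq_domN Dx).
Proof.
by apply: sq_class_eq; rewrite -opprD; apply: kerN; exact: sq_class_repr.
Qed.

Lemma sq_mulE x y (Dx : D x) (Dy : D y) :
  sq_mul (sq_class Dx) (sq_class Dy) = sq_class (sq_domM Dx Dy).
Proof.
apply: sq_class_eq.
rewrite -[X in N X](subrKA (x ** sq_repr (sq_class Dy))).
rewrite -smulBl -smulBr; apply: kerD.
  by apply: sq_kerMr; [exact: sq_class_repr|exact: sq_reprP].
by apply: sq_kerMl => //; exact: sq_class_repr.
Qed.

Lemma sq_starE x (Dx : D x) :
  sq_star (sq_class Dx) = sq_class (sq_dom_star Dx).
Proof.
by apply: sq_class_eq; rewrite -starB; apply: sq_ker_star; exact: sq_class_repr.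
Qed.

Lemma sq_classP (q : subquot) : exists x (Dx : D x), q = sq_class Dx.
Proof. by exists (sq_repr q), (sq_reprP q); rewrite sq_reprK. Qed.

Lemma sq_class_congr x y (Dx : D x) (Dy : D y) :
  x = y -> sq_class Dx = sq_class Dy.
Proof. by move=> xy; apply: sq_class_eq; rewrite xy subrr; exact: sq_ker0. Qed.

Let addA : associative sq_add.
Proof.
move=> p q r; have [x [Dx ->]] := sq_classP p; have [y [Dy ->]] := sq_classP q.
have [z [Dz ->]] := sq_classP r; rewrite !sq_addE.
by apply: sq_class_congr; rewrite addrA.
Qed.
Let addC : commutative sq_add.
Proof. by move=> p q; apply: sq_class_congr; rewrite addrC. Qed.
Let add0 : left_id sq_zero sq_add.
Proof.
move=> p; have [x [Dx ->]] := sq_classP p; rewrite sq_addE.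
by apply: sq_class_congr; rewrite add0r.
Qed.
Let addN : left_inverse sq_zero sq_opp sq_add.
Proof.
move=> p; have [x [Dx ->]] := sq_classP p; rewrite sq_oppE sq_addE.
by apply: sq_class_congr; rewrite addNr.
Qed.

HB.instance Definition _ := GRing.isZmodule.Build subquot addA addC add0 addN.

Let scaleA (a b : R[i]) p : sq_scale a (sq_scale b p) = sq_scale (a * b) p.
Proof.
have [x [Dx ->]] := sq_classP p; rewrite !sq_scaleE.
by apply: sq_class_congr; rewrite scalerA.
Qed.
Let scale1 : left_id 1 sq_scale.
Proof.
move=> p; have [x [Dx ->]] := sq_classP p; rewrite !sq_scaleE.
by apply: sq_class_congr; rewrite scale1r.
Qed.
Let scaleDr : right_distributive sq_scale +%R.
Proof.
move=> c p q; have [x [Dx ->]] := sq_classP p; have [y [Dy ->]] := sq_classP q.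
rewrite /GRing.add /= !(sq_scaleE, sq_addE).
by apply: sq_class_congr; rewrite scalerDr.
Qed.
Let scaleDl p : {morph sq_scale^~ p : a b / a + b}.
Proof.
move=> a b; have [x [Dx ->]] := sq_classP p.
rewrite [RHS]/GRing.add /= !sq_scaleE sq_addE.
by apply: sq_class_congr; rewrite scalerDl.
Qed.

HB.instance Definition _ :=
  GRing.Zmodule_isLmodule.Build R[i] subquot scaleA scale1 scaleDr scaleDl.

Let mulA : associative sq_mul.
Proof.
move=> p q r; have [x [Dx ->]] := sq_classP p; have [y [Dy ->]] := sq_classP q.
have [z [Dz ->]] := sq_classP r; rewrite !sq_mulE.
by apply: sq_class_congr; rewrite smulA.
Qed.
Let mulDl : left_distributive sq_mul +%R.
Proof.
move=> p q r; have [x [Dx ->]] := sq_classP p; have [y [Dy ->]] := sq_classP q.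
have [z [Dz ->]] := sq_classP r; rewrite /GRing.add /= !(sq_addE, sq_mulE).
by apply: sq_class_congr; rewrite smulDl.
Qed.
Let mulDr : right_distributive sq_mul +%R.
Proof.
move=> p q r; have [x [Dx ->]] := sq_classP p; have [y [Dy ->]] := sq_classP q.
have [z [Dz ->]] := sq_classP r; rewrite /GRing.add /= !(sq_addE, sq_mulE).
by apply: sq_class_congr; rewrite smulDr.
Qed.
Let scaleMl (c : R[i]) (p q : subquot) : sq_mul (c *: p) q = c *: sq_mul p q.
Proof.
have [x [Dx ->]] := sq_classP p; have [y [Dy ->]] := sq_classP q.
rewrite /GRing.scale /= !(sq_scaleE, sq_mulE).
by apply: sq_class_congr; rewrite scale_smull.
Qed.
Let scaleMr (c : R[i]) (p q : subquot) : sq_mul p (c *: q) = c *: sq_mul p q.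
Proof.
have [x [Dx ->]] := sq_classP p; have [y [Dy ->]] := sq_classP q.
rewrite /GRing.scale /= !(sq_scaleE, sq_mulE).
by apply: sq_class_congr; rewrite scale_smulr.
Qed.
Let starK' : involutive sq_star.
Proof.
move=> p; have [x [Dx ->]] := sq_classP p; rewrite !sq_starE.
by apply: sq_class_congr; rewrite starK.
Qed.
Let starD' : {morph sq_star : p q / p + q}.
Proof.
move=> p q; have [x [Dx ->]] := sq_classP p; have [y [Dy ->]] := sq_classP q.
rewrite /GRing.add /= !(sq_addE, sq_starE).
by apply: sq_class_congr; rewrite starD.
Qed.
Let starZ' (c : R[i]) p : sq_star (c *: p) = c^* *: sq_star p.
Proof.
have [x [Dx ->]] := sq_classP p; rewrite /GRing.scale /= !(sq_scaleE, sq_starE).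
by apply: sq_class_congr; rewrite starZ.
Qed.
Let starM' p q : sq_star (sq_mul p q) = sq_mul (sq_star q) (sq_star p).
Proof.
have [x [Dx ->]] := sq_classP p; have [y [Dy ->]] := sq_classP q.
rewrite !(sq_mulE, sq_starE).
by apply: sq_class_congr; rewrite starM.
Qed.

HB.instance Definition _ := isStarAlgebra.Build R subquot
  mulA mulDl mulDr scaleMl scaleMr starK' starD' starZ' starM'.

(* The norm induced on the quotient by a norm [p] on the representatives. *)
Definition quotient_norm (p : E -> R) (q : subquot) : R :=
  inf [set p x | x in [set x | exists Dx : D x, sq_class Dx = q]].

End subquotient.


Section function_star_algebra.
Context {R : realType} (T : Type) (A : starAlgType R).
Implicit Types u v w : T -> A.

Let fmul u v := fun t => u t ** v t.
Let fstar u := fun t => star (u t).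

Let fmulA : associative fmul.
Proof. by move=> u v w; apply/funext => t; exact: smulA. Qed.
Let fmulDl : left_distributive fmul +%R.
Proof. by move=> u v w; apply/funext => t; exact: smulDl. Qed.
Let fmulDr : right_distributive fmul +%R.
Proof. by move=> u v w; apply/funext => t; exact: smulDr. Qed.
Let fscalel (c : R[i]) u v : fmul (c *: u) v = c *: fmul u v.
Proof. by apply/funext => t; exact: scale_smull. Qed.
Let fscaler (c : R[i]) u v : fmul u (c *: v) = c *: fmul u v.
Proof. by apply/funext => t; exact: scale_smulr. Qed.
Let fstarK : involutive fstar.
Proof. by move=> u; apply/funext => t; exact: starK. Qed.
Let fstarD : {morph fstar : u v / u + v}.
Proof. by move=> u v; apply/funext => t; exact: starD. Qed.
Let fstarZ (c : R[i]) u : fstar (c *: u) = c^* *: fstar u.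
Proof. by apply/funext => t; exact: starZ. Qed.
Let fstarM u v : fstar (fmul u v) = fmul (fstar v) (fstar u).
Proof. by apply/funext => t; exact: starM. Qed.

HB.instance Definition _ := isStarAlgebra.Build R (T -> A)
  fmulA fmulDl fmulDr fscalel fscaler fstarK fstarD fstarZ fstarM.
End function_star_algebra.

Section rnorm_theory.
Context {R : realType} {A : normedModType R[i]}.
Implicit Types a b : A.

Lemma rnormE a : (rnorm a)%:C = `|a|.
Proof.
by have := normr_ge0 a; rewrite lecE /rnorm; case: `|a| => x y /= /andP[/eqP->].
Qed.

Lemma rnorm_ge0 a : 0 <= rnorm a.
Proof. by rewrite -ler0c rnormE. Qed.

Lemma rnorm0 : rnorm (0 : A) = 0.
Proof. by rewrite /rnorm normr0. Qed.

Lemma rnormD a b : rnorm (a + b) <= rnorm a + rnorm b.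
Proof. by rewrite -lecR rmorphD /= !rnormE ler_normD. Qed.

Lemma rnormZ (c : R[i]) a : rnorm (c *: a) = complex.Re `|c| * rnorm a.
Proof.
by apply: (@complexI R); rewrite rmorphM /= !rnormE normrZ.
Qed.

Lemma rnorm_eq0 a : rnorm a = 0 -> a = 0.
Proof. by move=> a0; apply/normr0_eq0; rewrite -rnormE a0. Qed.
End rnorm_theory.

Section cstar_theory.
Context {R : realType} {A : cstarAlgType R}.
Implicit Types a b : A.

Lemma rnormM a b : rnorm (a ** b) <= rnorm a * rnorm b.
Proof. by rewrite -lecR rmorphM /= !rnormE norm_smul_le. Qed.

Lemma rnorm_star a : rnorm (star a) = rnorm a.
Proof.
have key (b : A) : rnorm b <= rnorm (star b).
  have h : rnorm b ^+ 2 <= rnorm (star b) * rnorm b.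
    rewrite (le_trans _ (rnormM _ _))// -lecR rmorphXn /= !rnormE.
    by rewrite norm_starM.
  have [b0|b0] := eqVneq (rnorm b) 0; first by rewrite b0 rnorm_ge0.
  by move: h; rewrite expr2 ler_pM2r// lt_def b0 rnorm_ge0.
apply/eqP; rewrite eq_le key andbT.
by have := key (star a); rewrite starK.
Qed.
End cstar_theory.

Section sequence_algebra.
Context {R : realType} (A : cstarAlgType R).
Implicit Types (a b : A) (u v : nat -> A).

Definition linf : set (nat -> A) :=
  [set u | exists M : R, forall n, rnorm (u n) <= M].

Definition c0 : set (nat -> A) :=
  [set u | rnorm (u n) @[n --> \oo] --> (0 : R)].

Definition sup_norm u : R := sup [set rnorm (u n) | n in [set: nat]].

Let c0_linf : c0 `<=` linf.
Proof.
move=> u u0; have /cvg_seq_bounded[M [_ hM]] : cvgn (fun n => rnorm (u n)).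
  by apply/cvg_ex; exists 0.
exists (M + 1) => n; have := hM (M + 1); rewrite ltrDl ltr01 => /(_ erefl n I).
by rewrite /= ger0_norm ?rnorm_ge0.
Qed.

Let linf_lin (c : R[i]) u v : linf u -> linf v -> linf (c *: u + v).
Proof.
move=> [M uM] [K vK]; exists (complex.Re `|c| * M + K) => n.
rewrite (le_trans (rnormD _ _))// lerD// rnormZ ler_wpM2l//.
exact: (rnorm_ge0 (c : R[i]^o)).
Qed.

Let linfM u v : linf u -> linf v -> linf (u ** v).
Proof.
move=> [M uM] [K vK]; exists (M * K) => n.
by rewrite (le_trans (rnormM _ _))// ler_pM// rnorm_ge0.
Qed.

Let linf_star u : linf u -> linf (star u).
Proof. by move=> [M uM]; exists M => n; rewrite rnorm_star. Qed.

Let c0_0 : c0 0.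
Proof.
rewrite /c0 /= (_ : (fun _ => _) = cst 0); first exact: cvg_cst.
by apply/funext => n; rewrite rnorm0.
Qed.

Let c0_squeeze u (f : nat -> R) :
  (forall n, rnorm (u n) <= f n) -> f n @[n --> \oo] --> (0 : R) -> c0 u.
Proof.
move=> uf f0; rewrite /c0 /=; apply: (squeeze_cvgr _ (cvg_cst (0 : R)) f0).
by apply: nearW => n; rewrite rnorm_ge0 uf.
Qed.

Let c0_lin (c : R[i]) u v : c0 u -> c0 v -> c0 (c *: u + v).
Proof.
move=> u0 v0; pose h n := complex.Re `|c| * rnorm (u n) + rnorm (v n).
apply: (@c0_squeeze _ h).
  by move=> n; rewrite /h -rnormZ rnormD.
rewrite -[X in _ --> X](addr0 0) -[X in _ --> X + _](mulr0 (complex.Re `|c|)).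
by apply: cvgD => //; apply: cvgMr.
Qed.

Let c0Mr u v : c0 u -> linf v -> c0 (u ** v).
Proof.
move=> u0 [M vM]; apply: (@c0_squeeze _ (fun n => rnorm (u n) * M)).
  by move=> n; rewrite (le_trans (rnormM _ _))// ler_wpM2l// rnorm_ge0.
by rewrite -[X in _ --> X](mul0r M); apply: cvgMl.
Qed.

Let c0Ml u v : linf u -> c0 v -> c0 (u ** v).
Proof.
move=> [M uM] v0; apply: (@c0_squeeze _ (fun n => M * rnorm (v n))).
  by move=> n; rewrite (le_trans (rnormM _ _))// ler_wpM2r// rnorm_ge0.
by rewrite -[X in _ --> X](mulr0 M); apply: cvgMr.
Qed.

Let c0_star u : c0 u -> c0 (star u).
Proof.
by move=> u0; apply: (@c0_squeeze _ (fun n => rnorm (u n))) => // n; rewrite rnorm_star.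
Qed.

Definition seq_quotient : star_subquotient (nat -> A) :=
  @StarSubquotient R (nat -> A) linf c0 c0_linf linf_lin linfM linf_star
    c0_0 c0_lin c0Ml c0Mr c0_star.

(* A_oo = l^oo(A) / c_0(A) *)
Definition seq_alg : Type := subquot seq_quotient.
HB.instance Definition _ := StarAlgebra.on seq_alg.

(* The norm of A_oo, i.e. limsup_n |u n| on the class of [u]. *)
Definition seq_norm : seq_alg -> R := @quotient_norm R _ seq_quotient sup_norm.

Lemma linf_cst a : linf (fun=> a).
Proof. by exists (rnorm a). Qed.

Definition seq_cst a : seq_alg := @sq_class R _ seq_quotient _ (linf_cst a).

(* A_oo \cap A', with A embedded in A_oo as constant sequences *)
Definition seq_commutant : set seq_alg :=
  [set x | forall a, x ** seq_cst a = seq_cst a ** x].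

Definition seq_annihilator : set seq_alg :=
  [set x | seq_commutant x /\ forall a, x ** seq_cst a = 0].

Lemma star_seq_cst a : star (seq_cst a) = seq_cst (star a).
Proof. by rewrite /star /= /seq_cst sq_starE; exact: sq_class_congr. Qed.

Let comm_lin (c : R[i]) x y :
  seq_commutant x -> seq_commutant y -> seq_commutant (c *: x + y).
Proof.
by move=> hx hy a; rewrite smulDl smulDr scale_smull scale_smulr hx hy.
Qed.

Let commM x y : seq_commutant x -> seq_commutant y -> seq_commutant (x ** y).
Proof. by move=> hx hy a; rewrite -smulA hy smulA hx smulA. Qed.

Let comm_star x : seq_commutant x -> seq_commutant (star x).
Proof.
by move=> hx a; rewrite -[a]starK -star_seq_cst -!starM hx.
Qed.

Let ann_sub : seq_annihilator `<=` seq_commutant.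
Proof. by move=> x []. Qed.

Let ann0 : seq_annihilator 0.
Proof. by split=> a; rewrite !(smul0l, smul0r). Qed.

Let ann_lin (c : R[i]) x y :
  seq_annihilator x -> seq_annihilator y -> seq_annihilator (c *: x + y).
Proof.
move=> [hx x0] [hy y0]; split=> [|a]; first exact: comm_lin.
by rewrite smulDl scale_smull x0 y0 scaler0 addr0.
Qed.

Let annMl x y : seq_commutant x -> seq_annihilator y -> seq_annihilator (x ** y).
Proof.
move=> hx [hy y0]; split=> [|a]; first exact: commM.
by rewrite -smulA y0 smul0r.
Qed.

Let annMr x y : seq_annihilator x -> seq_commutant y -> seq_annihilator (x ** y).
Proof.
move=> [hx x0] hy; split=> [|a]; first exact: commM.
by rewrite -smulA hy smulA x0 smul0l.
Qed.

Let ann_star x : seq_annihilator x -> seq_annihilator (star x).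
Proof.
move=> [hx x0]; split=> [|a]; first exact: comm_star.
by rewrite -[a]starK -star_seq_cst -starM -hx x0 star0.
Qed.

Definition central_quotient : star_subquotient seq_alg :=
  @StarSubquotient R seq_alg seq_commutant seq_annihilator ann_sub comm_lin
    commM comm_star ann0 ann_lin annMl annMr ann_star.

(* F_oo(A) = (A_oo \cap A') / Ann(A) *)
Definition central_seq_alg : Type := subquot central_quotient.
HB.instance Definition _ := StarAlgebra.on central_seq_alg.

Definition central_norm : central_seq_alg -> R :=
  @quotient_norm R _ central_quotient seq_norm.

End sequence_algebra.


HB.instance Definition _ (R : realType) := NormedModule.copy R[i] R[i]^o.

HB.mixin Record isCompactHausdorff T of Topological T := {
  compactT : compact [set: T];
  hausdorffT : hausdorff_space T
}.

#[short(type="compactHausdorffType")]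
HB.structure Definition CompactHausdorff :=
  {T of Topological T & isCompactHausdorff T}.

Section rnorm_topology.
Context {R : realType} {V : normedModType R[i]}.

Lemma gt0_complexE (e : R[i]) : 0 < e -> (complex.Re e)%:C = e /\ 0 < complex.Re e.
Proof. by rewrite ltcE; case: e => x y /= /andP[/eqP -> ->]. Qed.

Lemma cvg_rnormP {T} {F : set_system T} {FF : Filter F} (f : T -> V) (y : V) :
  f x @[x --> F] --> y <->
  forall e : R, 0 < e -> \near F, rnorm (y - f F) <= e.
Proof.
split=> [/cvgrPdist_le h e e0|h].
  have /h : 0 < e%:C by rewrite ltcR.
  by apply: filterS => x; rewrite -rnormE lecR.
apply/cvgrPdist_le => e /gt0_complexE[<- e0].
by apply: filterS (h _ e0) => x; rewrite -rnormE lecR.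
Qed.

Lemma cauchy_rnorm (F : set_system V) : ProperFilter F -> cauchy F ->
  forall e : R, 0 < e -> \forall x \near F & y \near F, rnorm (x - y) <= e.
Proof.
move=> FF /cauchy_ballP Fc e e0.
have := Fc e%:C; rewrite ltcR => /(_ e0).
apply: filterS => -[x y] /=; rewrite -ball_normE /= => xy.
by rewrite -lecR rnormE ltW.
Qed.

Lemma rnormN (v : V) : rnorm (- v) = rnorm v.
Proof. by rewrite /rnorm normrN. Qed.

Lemma rnorm_distC (v w : V) : rnorm (v - w) = rnorm (w - v).
Proof. by rewrite -rnormN opprB. Qed.

Lemma rnorm_dist (v w : V) : `|rnorm v - rnorm w| <= rnorm (v - w).
Proof.
rewrite ler_norml; apply/andP; split.
  rewrite lerNl opprB lerBlDr -[X in rnorm X <= _](subrK v).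
  by rewrite (le_trans (rnormD _ _))// rnorm_distC.
by rewrite lerBlDr -[X in rnorm X <= _](subrK w) rnormD.
Qed.

Lemma rnorm_continuous : continuous (@rnorm R V).
Proof.
move=> v; apply/cvgrPdist_le => e e0.
have /cvg_rnormP/(_ e e0) : x @[x --> v] --> v by exact: cvg_id.
by apply: filterS => w; exact/le_trans/rnorm_dist.
Qed.

End rnorm_topology.

Section complex_complete.
Context {R : realType}.
Implicit Types z w : R[i].

Lemma normc_Re_le z : `|complex.Re z| <= rnorm z.
Proof.
case: z => x y /=; rewrite /rnorm /= -sqrtr_sqr ler_sqrt ?lerDl ?sqr_ge0//.
by rewrite addr_ge0 ?sqr_ge0.
Qed.

Lemma normc_Im_le z : `|complex.Im z| <= rnorm z.
Proof.
case: z => x y /=; rewrite /rnorm /= -sqrtr_sqr ler_sqrt ?lerDr ?sqr_ge0//.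
by rewrite addr_ge0 ?sqr_ge0.
Qed.

Lemma normc_ge_ReIm z : rnorm z <= `|complex.Re z| + `|complex.Im z|.
Proof.
case: z => x y /=; rewrite /rnorm /= -[leRHS]ger0_norm ?addr_ge0//.
rewrite -sqrtr_sqr ler_sqrt ?sqr_ge0// sqrrD !real_normK ?num_real//.
by rewrite lerD2r lerDl mulrn_wge0// mulr_ge0.
Qed.

Lemma complex_complete (F : set_system R[i]) :
  ProperFilter F -> cauchy F -> cvg F.
Proof.
move=> FF Fc.
have part (f : R[i] -> R) : (forall z w, `|f z - f w| <= rnorm (z - w)) ->
    cvg (f @ F).
  move=> fle; apply: R_complete; apply/cauchy_ballP => e e0.
  have e20 : 0 < e / 2 by rewrite divr_gt0.
  have [[A B] [/= FA FB] AB] := cauchy_rnorm FF Fc e20.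
  exists (f @` A, f @` B) => /=.
    by split; [apply: filterS FA|apply: filterS FB] => z; exists z.
  move=> [_ _] /= [[z Az <-] [w Bw <-]]; rewrite -ball_normE /=.
  apply: (le_lt_trans (fle _ _)); apply: (le_lt_trans (AB (z, w) _)) => //=.
  by rewrite ltr_pdivrMr// ltr_pMr// ltr1n.
have /cvg_ex[a Fa] : cvg (@complex.Re R @ F).
  apply: part => z w; rewrite (_ : _ - _ = complex.Re (z - w)) ?normc_Re_le//.
  by case: z w => [? ?] [? ?].
have /cvg_ex[b Fb] : cvg (@complex.Im R @ F).
  apply: part => z w; rewrite (_ : _ - _ = complex.Im (z - w)) ?normc_Im_le//.
  by case: z w => [? ?] [? ?].
apply/cvg_ex; exists (a +i* b); apply/cvg_rnormP => e e0.
have e20 : 0 < e / 2 by rewrite divr_gt0.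
move/cvgrPdist_le : Fa => /(_ _ e20) Fa; move/cvgrPdist_le : Fb => /(_ _ e20) Fb.
apply: filterS2 Fa Fb => -[x y] /= xa yb.
by rewrite (le_trans (normc_ge_ReIm _))//= [leRHS](splitr e) lerD.
Qed.

Lemma conjc_rnorm z : rnorm z^* = rnorm z.
Proof. by case: z => x y; rewrite /rnorm /= sqrrN. Qed.

Lemma conjc_continuous : continuous (@conjc R).
Proof.
move=> z; apply/(@cvg_rnormP _ _ _ _ (nbhs_filter z)) => e e0.
have /(@cvg_rnormP _ _ _ _ (nbhs_filter z))/(_ e e0) : x @[x --> z] --> z.
  exact: cvg_id.
by apply: (@filterS _ _ (nbhs_filter z)) => w; rewrite -rmorphB conjc_rnorm.
Qed.

End complex_complete.

HB.instance Definition _ (R : realType) :=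
  Uniform_isComplete.Build R[i] (@complex_complete R).

(* C(X), with the pointwise operations and the supremum norm. It is an alias of
   the library type of continuous functions, so that the norm topology does not
   compete with the topologies of the library on that type. *)
Definition cfun (R : realType) (X : compactHausdorffType) : Type :=
  continuousType X R[i].

Section cfun.
Context {R : realType} {X : compactHausdorffType}.
Local Notation CX := (cfun R X).

HB.instance Definition _ := Choice.on CX.

Definition cfun_val (f : CX) : X -> R[i] := f.
Coercion cfun_val : cfun >-> Funclass.

Definition Cfun (f : X -> R[i]) (cf : continuous f) : CX :=
  HB.pack_for (continuousType X R[i]) f (@isContinuous.Build X R[i] f cf).

Lemma cfun_continuous (f : CX) : continuous f.
Proof. exact: cts_fun. Qed.

Lemma cfunP (f g : CX) : f =1 g -> f = g.
Proof. by move=> fg; exact/continuousEP. Qed.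

Let cstC (c : R[i]) : continuous (fun _ : X => c).
Proof. by move=> x; exact: cvg_cst. Qed.
Let addC (f g : CX) : continuous (fun x => f x + g x).
Proof. by move=> x; apply: cvgD; exact: cfun_continuous. Qed.
Let oppC (f : CX) : continuous (fun x => - f x).
Proof. by move=> x; apply: cvgN; exact: cfun_continuous. Qed.
Let mulC (f g : CX) : continuous (fun x => f x * g x).
Proof. by move=> x; apply: cvgM; exact: cfun_continuous. Qed.
Let scaleC (c : R[i]) (f : CX) : continuous (fun x => c * f x).
Proof. by move=> x; apply: cvgM; [exact: cvg_cst|exact: cfun_continuous]. Qed.
Let conjC (f : CX) : continuous (fun x => (f x)^*).
Proof.
by move=> x; apply: continuous_comp; [exact: cfun_continuous|exact: conjc_continuous].
Qed.

Definition cfun_cst (c : R[i]) : CX := Cfun (@cstC c).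
Definition cfun_add (f g : CX) : CX := Cfun (@addC f g).
Definition cfun_opp (f : CX) : CX := Cfun (@oppC f).
Definition cfun_mul (f g : CX) : CX := Cfun (@mulC f g).
Definition cfun_scale (c : R[i]) (f : CX) : CX := Cfun (@scaleC c f).
Definition cfun_conj (f : CX) : CX := Cfun (@conjC f).

Let addA : associative cfun_add.
Proof. by move=> f g h; apply: cfunP => x /=; exact: addrA. Qed.
Let addCC : commutative cfun_add.
Proof. by move=> f g; apply: cfunP => x /=; exact: addrC. Qed.
Let add0 : left_id (cfun_cst 0) cfun_add.
Proof. by move=> f; apply: cfunP => x /=; exact: add0r. Qed.
Let addN : left_inverse (cfun_cst 0) cfun_opp cfun_add.
Proof. by move=> f; apply: cfunP => x /=; exact: addNr. Qed.
HB.instance Definition _ := GRing.isZmodule.Build CX addA addCC add0 addN.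

Let scaleA (a b : R[i]) f : cfun_scale a (cfun_scale b f) = cfun_scale (a * b) f.
Proof. by apply: cfunP => x /=; exact: mulrA. Qed.
Let scale1 : left_id 1 cfun_scale.
Proof. by move=> f; apply: cfunP => x /=; exact: mul1r. Qed.
Let scaleDr : right_distributive cfun_scale +%R.
Proof. by move=> c f g; apply: cfunP => x /=; exact: mulrDr. Qed.
Let scaleDl f : {morph cfun_scale^~ f : a b / a + b}.
Proof. by move=> a b; apply: cfunP => x /=; exact: mulrDl. Qed.
HB.instance Definition _ :=
  GRing.Zmodule_isLmodule.Build R[i] CX scaleA scale1 scaleDr scaleDl.

Let mulA : associative cfun_mul.
Proof. by move=> f g h; apply: cfunP => x /=; exact: mulrA. Qed.
Let mulDl : left_distributive cfun_mul +%R.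
Proof. by move=> f g h; apply: cfunP => x /=; exact: mulrDl. Qed.
Let mulDr : right_distributive cfun_mul +%R.
Proof. by move=> f g h; apply: cfunP => x /=; exact: mulrDr. Qed.
Let scaleMl (c : R[i]) (f g : CX) : cfun_mul (c *: f) g = c *: cfun_mul f g.
Proof. by apply: cfunP => x /=; rewrite /GRing.scale /=; exact/esym/mulrA. Qed.
Let scaleMr (c : R[i]) (f g : CX) : cfun_mul f (c *: g) = c *: cfun_mul f g.
Proof. by apply: cfunP => x /=; rewrite /GRing.scale /=; exact: mulrCA. Qed.
Let conjK : involutive cfun_conj.
Proof. by move=> f; apply: cfunP => x /=; exact: conjcK. Qed.
Let conjD : {morph cfun_conj : f g / f + g}.
Proof. by move=> f g; apply: cfunP => x /=; exact: rmorphD. Qed.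
Let conjZ (c : R[i]) (f : CX) : cfun_conj (c *: f) = c^* *: cfun_conj f.
Proof. by apply: cfunP => x /=; exact: rmorphM. Qed.
Let conjM (f g : CX) :
  cfun_conj (cfun_mul f g) = cfun_mul (cfun_conj g) (cfun_conj f).
Proof. by apply: cfunP => x /=; rewrite -[RHS]mulrC; exact: rmorphM. Qed.
HB.instance Definition _ := isStarAlgebra.Build R CX
  mulA mulDl mulDr scaleMl scaleMr conjK conjD conjZ conjM.

Definition cfun_norm (f : CX) : R := sup [set rnorm (f x) | x in [set: X]].

Lemma cfun_bounded (f : CX) : exists M, forall x, rnorm (f x) <= M.
Proof.
have cf : continuous (fun x => rnorm (f x)).
  by move=> x; apply: continuous_comp; [exact: cfun_continuous|exact: rnorm_continuous].
have := continuous_compact (continuous_subspaceT cf) (@compactT X).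
move=> /compact_bounded[M [_ hM]]; exists (M + 1) => x.
have := hM (M + 1); rewrite ltrDl ltr01 => /(_ erefl) h.
by apply: (le_trans (ler_norm _)); apply: h; exists x.
Qed.

Lemma cfun_norm_ge (f : CX) x : rnorm (f x) <= cfun_norm f.
Proof.
have [M fM] := cfun_bounded f.
by apply: ub_le_sup; [exists M => _ [y _ <-]|exists x].
Qed.

Lemma cfun_norm_le (f : CX) (M : R) : 0 <= M ->
  (forall x, rnorm (f x) <= M) -> cfun_norm f <= M.
Proof.
move=> M0 fM; rewrite /cfun_norm.
have [->|/set0P[y Sy]] := eqVneq [set rnorm (f x) | x in [set: X]] set0.
  by rewrite sup0.
by apply: ge_sup; [exists y|move=> _ [x _ <-]].
Qed.

End cfun.

Section cfun_normed.
Context {R : realType} {X : compactHausdorffType}.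
Local Notation CX := (cfun R X).
Implicit Types f g : CX.

Lemma cfun_norm_ge0 f : 0 <= cfun_norm f.
Proof.
rewrite /cfun_norm.
have [->|/set0P[_ [x _ _]]] := eqVneq [set rnorm (f x) | x in [set: X]] set0.
  by rewrite sup0.
exact: le_trans (rnorm_ge0 _) (cfun_norm_ge f x).
Qed.

Let cnorm f : R[i] := (cfun_norm f)%:C.

Let cnormD f g : cnorm (f + g) <= cnorm f + cnorm g.
Proof.
rewrite -rmorphD lecR; apply: cfun_norm_le => [|x].
  by rewrite addr_ge0 ?cfun_norm_ge0.
by apply: le_trans (rnormD _ _) _; apply: lerD; exact: cfun_norm_ge.
Qed.

Let cnormZ (c : R[i]) f : cnorm (c *: f) = `|c| * cnorm f.
Proof.
rewrite -(rnormE (c : R[i]^o)) -rmorphM; congr (_%:C).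
have c0 : 0 <= rnorm (c : R[i]^o) by exact: rnorm_ge0.
apply/eqP; rewrite eq_le; apply/andP; split.
  apply: cfun_norm_le => [|x]; first by rewrite mulr_ge0 ?cfun_norm_ge0.
  by rewrite [leLHS](rnormZ c (f x)) ler_wpM2l// cfun_norm_ge.
have [c00|c00] := eqVneq (rnorm (c : R[i]^o)) 0.
  by rewrite c00 mul0r cfun_norm_ge0.
rewrite -ler_pdivlMl; last by rewrite lt_def c00.
apply: cfun_norm_le => [|x]; first by rewrite mulr_ge0 ?invr_ge0 ?cfun_norm_ge0.
rewrite ler_pdivlMl; last by rewrite lt_def c00.
by have := cfun_norm_ge (c *: f) x; rewrite [leLHS](rnormZ c (f x)).
Qed.

Let cnorm0 f : cnorm f = 0 -> f = 0.
Proof.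
move=> /(@complexI R) f0; apply: cfunP => x; apply: rnorm_eq0.
by apply/eqP; rewrite eq_le rnorm_ge0 andbT -f0 cfun_norm_ge.
Qed.

HB.instance Definition _ :=
  @Lmodule_isNormed.Build R[i] CX cnorm cnormD cnormZ cnorm0.

Lemma cfun_rnormE f : rnorm f = cfun_norm f.
Proof. by []. Qed.

Lemma cfun_complete (F : set_system CX) : ProperFilter F -> cauchy F -> cvg F.
Proof.
move=> FF Fc.
have pt x : cvg ((fun f : CX => f x) @ F).
  apply: complex_complete; apply/cauchy_ballP => e /gt0_complexE[<- e0].
  have e20 : 0 < complex.Re e / 2 by rewrite divr_gt0.
  have [[A B] [/= FA FB] AB] := cauchy_rnorm FF Fc e20.
  exists ((fun f : CX => f x) @` A, (fun f : CX => f x) @` B) => /=.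
    by split; [apply: filterS FA|apply: filterS FB] => f; exists f.
  move=> [_ _] /= [[f Af <-] [g Bg <-]]; rewrite -ball_normE /=.
  rewrite -rnormE ltcR; apply: (le_lt_trans (cfun_norm_ge (f - g) x)).
  apply: (le_lt_trans (AB (f, g) _)) => //=.
  by rewrite ltr_pdivrMr// ltr_pMr// ltr1n.
pose l x := lim ((fun f : CX => f x) @ F).
have Fl (e : R) : 0 < e -> F [set f : CX | forall x, rnorm (l x - f x) <= e].
  move=> e0; have [[A B] [/= FA FB] AB] := cauchy_rnorm FF Fc e0.
  apply: filterS FB => g Bg x.
  have cv : rnorm ((f : CX) x - g x) @[f --> F] --> rnorm (l x - g x).
    apply: (cvg_comp _ (@rnorm R R[i])); last exact: rnorm_continuous.
    by apply: cvgB; [exact: pt|exact: cvg_cst].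
  apply: (@closed_cvg _ _ F _ _ [set r : R | r <= e] _ _ _ cv).
    exact: closed_le.
  apply: filterS FA => f Af.
  exact: le_trans (cfun_norm_ge (f - g) x) (AB (f, g) (conj Af Bg)).
have lc : continuous l.
  move=> x; apply/(@cvg_rnormP _ _ _ _ (nbhs_filter x)) => e e0.
  have e30 : 0 < e / 3 by rewrite divr_gt0.
  have [f fl] := filter_ex (Fl _ e30).
  have /(@cvg_rnormP _ _ _ _ (nbhs_filter x))/(_ _ e30) := @cfun_continuous _ _ f x.
  apply: (@filterS _ _ (nbhs_filter x)) => y fxy.
  rewrite (_ : l x - l y = (l x - f x) + (f x - f y) + (f y - l y)); last first.
    by rewrite !addrA !subrK.
  rewrite (_ : e = e / 3 + e / 3 + e / 3); last first.
    by rewrite -!mulrDl -mulr2n -mulrSr -[e *+ 3]mulr_natr mulfK// pnatr_eq0.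
  apply: le_trans (rnormD _ _) _; apply: lerD; last by rewrite rnorm_distC.
  by apply: le_trans (rnormD _ _) _; apply: lerD.
apply/cvg_ex; exists (Cfun lc); apply/cvg_rnormP => e e0.
apply: filterS (Fl _ e0) => f fl.
by apply: cfun_norm_le (ltW e0) _ => x; exact: fl.
Qed.

HB.instance Definition _ := Uniform_isComplete.Build CX cfun_complete.

Let normM f g : `|f ** g| <= `|f| * `|g|.
Proof.
rewrite -!rnormE -rmorphM lecR; apply: cfun_norm_le => [|x].
  by rewrite mulr_ge0 ?rnorm_ge0.
rewrite [leLHS](rnormZ (f x) (g x)).
by apply: ler_pM; rewrite ?rnorm_ge0 ?(rnorm_ge0 (f x)) ?cfun_norm_ge.
Qed.

Let norm_star f : `|star f ** f| = `|f| ^+ 2.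
Proof.
rewrite -!rnormE -rmorphXn; congr (_%:C).
have sq x : rnorm ((star f ** f) x) = rnorm (f x) ^+ 2.
  by rewrite [LHS](rnormZ ((f x)^*) (f x)) expr2; congr (_ * _); exact: conjc_rnorm.
apply/eqP; rewrite eq_le; apply/andP; split.
  apply: cfun_norm_le => [|x]; first by rewrite exprn_ge0 ?rnorm_ge0.
  by rewrite sq lerXn2r ?nnegrE ?rnorm_ge0 ?(cfun_norm_ge f).
rewrite -[leRHS]sqr_sqrtr ?rnorm_ge0// lerXn2r ?nnegrE ?rnorm_ge0 ?sqrtr_ge0//.
apply: cfun_norm_le => [|x]; first exact: sqrtr_ge0.
rewrite -(@ler_pXn2r _ 2) ?nnegrE ?rnorm_ge0 ?sqrtr_ge0// sqr_sqrtr ?rnorm_ge0//.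
by rewrite -sq; exact: (cfun_norm_ge (star f ** f) x).
Qed.

HB.instance Definition _ := StarAlgebra_isCStar.Build R CX normM norm_star.

End cfun_normed.

HB.mixin Record isTopologicalGroup G of Group G & Topological G := {
  mulg_continuous : continuous (fun p : G * G => (p.1 * p.2)%g);
  invg_continuous : continuous (fun x : G => (x^-1)%g)
}.

#[short(type="compactGroupType")]
HB.structure Definition CompactGroup :=
  {G of Group G & CompactHausdorff G & isTopologicalGroup G}.

(* Compact Hausdorff spaces with a continuous action of G *)
Record gspace (G : compactGroupType) := GSpace {
  gspace_sort :> compactHausdorffType;
  gact : G -> gspace_sort -> gspace_sort;
  gact1 : forall x, gact 1%g x = x;
  gactM : forall g h x, gact (g * h)%g x = gact g (gact h x);
  gact_continuous : continuous (fun p : G * gspace_sort => gact p.1 p.2)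
}.

Definition left_translation (G : compactGroupType) : gspace G :=
  @GSpace G G (fun g x => (g * x)%g) (@mul1g G)
    (fun g h x => esym (mulgA g h x)) (@mulg_continuous G).

(* Point-norm continuous actions by *-automorphisms. [cact_norm] is automatic,
   as *-automorphisms of C*-algebras are isometric; it is recorded so that the
   induced action on sequences is defined without spectral theory. *)
Record cstar_action (R : realType) (G : compactGroupType) (A : cstarAlgType R) :=
  CstarAction {
  cact :> G -> A -> A;
  cact_linear : forall g (c : R[i]) a b, cact g (c *: a + b) = c *: cact g a + cact g b;
  cact_mul : forall g a b, cact g (a ** b) = cact g a ** cact g b;
  cact_star : forall g a, cact g (star a) = star (cact g a);
  cact_norm : forall g a, `|cact g a| = `|a|;
  cact1 : forall a, cact 1%g a = a;
  cactM : forall g h a, cact (g * h)%g a = cact g (cact h a);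
  cact_continuous : forall a, continuous (fun g => cact g a)
}.

Section function_action.
Context (R : realType) (G : compactGroupType) (X : gspace G).
Local Notation CX := (cfun R X).

Lemma gact_continuous_r (g : G) : continuous (@gact G X g).
Proof.
move=> x; apply: (@continuous2_cvg _ _ _ _ _ _ (fun _ => g) id (@gact G X) g x).
- exact: (@gact_continuous G X (g, x)).
- exact: cvg_cst.
- exact: cvg_id.
Qed.

Let transl_continuous (g : G) (f : CX) : continuous (fun x => f (gact g^-1%g x)).
Proof.
by move=> x; apply: continuous_comp; [exact: gact_continuous_r|exact: cfun_continuous].
Qed.

Definition translate (g : G) (f : CX) : CX := Cfun (@transl_continuous g f).

Let tr_lin g (c : R[i]) f h :
  translate g (c *: f + h) = c *: translate g f + translate g h.
Proof. exact: cfunP. Qed.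
Let tr_mul g f h : translate g (f ** h) = translate g f ** translate g h.
Proof. exact: cfunP. Qed.
Let tr_star g f : translate g (star f) = star (translate g f).
Proof. exact: cfunP. Qed.
Let tr1 f : translate 1%g f = f.
Proof. by apply: cfunP => x /=; rewrite invg1 gact1. Qed.
Let trM g h f : translate (g * h)%g f = translate g (translate h f).
Proof. by apply: cfunP => x /=; rewrite invgM gactM. Qed.
Let tr_norm g f : `|translate g f| = `|f|.
Proof.
rewrite -!rnormE; congr (_%:C).
have le h k : rnorm (translate h k) <= rnorm k.
  by apply: cfun_norm_le => [|x]; [exact: rnorm_ge0|exact: (cfun_norm_ge k)].
apply/eqP; rewrite eq_le le /=.
by rewrite -{1}(tr1 f) -(mulVg g) trM le.
Qed.

Let tr_continuous f : continuous (fun g => translate g f).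
Proof.
move=> g; apply/(@cvg_rnormP _ _ _ _ (nbhs_filter g)) => e e0.
have /compact_near_coveringP := @compactT X.
move=> /(_ G (nbhs g) (fun h x => rnorm (f (gact g^-1%g x) - f (gact h^-1%g x)) <= e)).
move=> /(_ (nbhs_filter g)) h.
apply: (@filterS _ _ (nbhs_filter g) _ _ _ (h _)).
  move=> k hk; apply: cfun_norm_le (ltW e0) _ => x; exact: (hk x I).
move=> x _.
pose F (p : X * G) := f (gact g^-1%g p.1) - f (gact p.2^-1%g p.1).
have cF : F p @[p --> (x, g)] --> F (x, g).
  apply: cvgB.
    apply: (continuous_comp (f := fun p : X * G => gact g^-1%g p.1) (g := f));
      last exact: cfun_continuous.
    apply: (continuous_comp (f := fst) (g := gact g^-1%g)); first exact: cvg_fst.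
    exact: gact_continuous_r.
  apply: (continuous_comp (f := fun p : X * G => gact p.2^-1%g p.1) (g := f));
    last exact: cfun_continuous.
  apply: (@continuous2_cvg _ _ _ _ _ _ (fun p : X * G => p.2^-1)%g fst
    (@gact G X) (g^-1)%g x).
  - exact: (@gact_continuous G X (g^-1, x)%g).
  - apply: (@continuous_comp _ _ _ (@snd X G) (fun y : G => y^-1)%g (x, g));
      first exact: cvg_snd.
    exact: invg_continuous.
  - exact: cvg_fst.
have /(@cvg_rnormP _ _ _ _ (nbhs_filter (x, g)))/(_ e e0) := cF.
rewrite /F /= subrr; apply: (@filterS _ _ (nbhs_filter (x, g))) => -[y k] /=.
by rewrite sub0r rnormN.
Qed.

(* The action (g, f) |-> f (g^-1 _) on C(X) *)
Definition canonical_action : cstar_action G CX :=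
  CstarAction tr_lin tr_mul tr_star tr_norm tr1 trM tr_continuous.

End function_action.

Section induced_action.
Context {R : realType} {G : compactGroupType} {A : cstarAlgType R}.
Variable alpha : cstar_action G A.

Lemma cact_rnorm g a : rnorm (alpha g a) = rnorm a.
Proof. by rewrite /rnorm cact_norm. Qed.

Lemma cactB g a b : alpha g (a - b) = alpha g a - alpha g b.
Proof. by rewrite addrC -scaleN1r cact_linear scaleN1r addrC. Qed.

Lemma linf_cact g (u : nat -> A) : linf u -> linf (fun n => alpha g (u n)).
Proof. by move=> [M uM]; exists M => n; rewrite cact_rnorm. Qed.

Lemma c0_cact g (u : nat -> A) : c0 u -> c0 (fun n => alpha g (u n)).
Proof.
by move=> u0; rewrite /c0 /= (_ : (fun n => _) = fun n => rnorm (u n)) //;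
  apply/funext => n; rewrite cact_rnorm.
Qed.

Definition seq_act (g : G) (x : seq_alg A) : seq_alg A :=
  @sq_class R _ (seq_quotient A) _ (linf_cact g (sq_reprP x)).

Lemma seq_actE g u (hu : linf u) :
  seq_act g (@sq_class R _ (seq_quotient A) u hu) =
  @sq_class R _ (seq_quotient A) _ (linf_cact g hu).
Proof.
apply: sq_class_eq.
have := c0_cact g (@sq_class_repr R _ (seq_quotient A) u hu).
set v := sq_repr _ => h.
rewrite (_ : (fun n => _) - _ = fun n => alpha g ((v - u) n)) //.
by apply/funext => n; exact/esym/cactB.
Qed.

Lemma seq_actM g (x y : seq_alg A) : seq_act g (x ** y) = seq_act g x ** seq_act g y.
Proof.
have [u [hu ->]] := sq_classP x; have [v [hv ->]] := sq_classP y.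
rewrite /smul /= sq_mulE !seq_actE sq_mulE; apply: sq_class_congr.
by apply/funext => n; exact: cact_mul.
Qed.

Lemma seq_act_cst g a : seq_act g (seq_cst a) = seq_cst (alpha g a).
Proof. by rewrite seq_actE; exact: sq_class_congr. Qed.

Lemma seq_commutant_act g (x : seq_alg A) :
  seq_commutant x -> seq_commutant (seq_act g x).
Proof.
move=> hx a; have -> : a = alpha g (alpha g^-1%g a) by rewrite -cactM mulgV cact1.
by rewrite -seq_act_cst -!seq_actM hx.
Qed.

Definition central_act (g : G) (x : central_seq_alg A) : central_seq_alg A :=
  @sq_class R _ (central_quotient A) _ (seq_commutant_act g (sq_reprP x)).

(* F_oo^(alpha)(A): the elements on which G acts continuously *)
Definition central_continuous : set (central_seq_alg A) :=
  [set x | forall g0 (e : R), 0 < e ->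
     \forall g \near g0, central_norm (central_act g x - central_act g0 x) < e].

End induced_action.

Section rokhlin.
Context {R : realType} {G : compactGroupType} {A : cstarAlgType R}.
Variable alpha : cstar_action G A.
Local Notation CG := (cfun R (left_translation G)).
Local Notation FA := (central_seq_alg A).

(* The maps are valued in F_oo^(alpha)(A), viewed inside F_oo(A); complete
   positivity may be tested in F_oo(A) since positivity of a matrix over a
   C*-subalgebra does not depend on the ambient C*-algebra. F_oo(A) is not
   given as a unital algebra, so its unit is characterised in [rok_unit]. *)
Record rokhlin_towers (d : nat) (phi : 'I_d.+1 -> {linear CG -> FA}) : Prop := {
  rok_continuous : forall j f, central_continuous alpha (phi j f);
  rok_cp : forall j, completely_positive (phi j);
  rok_contractive : forall j f, central_norm (phi j f) <= rnorm f;
  rok_order_zero : forall j, order_zero (phi j);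
  rok_equivariant : forall j g f,
    phi j (canonical_action R (left_translation G) g f) =
    central_act alpha g (phi j f);
  rok_commute : forall i j, i != j ->
    forall f h, phi i f ** phi j h = phi j h ** phi i f;
  rok_unit : let u := \sum_j phi j (cfun_cst 1) in
    forall x : FA, u ** x = x /\ x ** u = x
}.

(* The least [d] admitting Rokhlin towers, +oo if there is none. *)
Definition dim_Rok_c : \bar R :=
  ereal_inf [set d%:R%:E | d in [set d : nat |
    exists phi : 'I_d.+1 -> {linear CG -> FA}, rokhlin_towers phi]].
End rokhlin.

Definition unit_interval (R : realType) : Type := set_type `[0 : R, 1]%classic.
HB.instance Definition _ (R : realType) := Topological.on (unit_interval R).

Section unit_interval_theory.
Context {R : realType}.
Local Notation I := (unit_interval R).

Definition ival (t : I) : R := set_val (t : set_type `[0 : R, 1]%classic).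

Lemma ival_continuous : continuous ival.
Proof. exact: initial_continuous. Qed.

Lemma ival_inj : injective ival.
Proof. exact: val_inj. Qed.

Lemma unit_interval_compact : compact [set: I].
Proof.
move=> F FF _.
have GF : ProperFilter (ival @ F) by exact: fmap_proper_filter.
have [|p [p01 pcl]] := @segment_compact R 0 1 (ival @ F) GF.
  have FT : F setT by exact: filterT.
  apply: (@filterS _ F _ setT) => // t _.
  exact: (set_valP (t : set_type `[0 : R, 1]%classic)).
exists (exist _ p (mem_set p01)); split => // A B FA [C [[D oD <-] Dp] CB].
have := pcl (ival @` A) D.
have FA' : (ival @ F) (ival @` A) by apply: (@filterS _ F _ A) => // t At; exists t.
have Dp' : nbhs p D by exact: open_nbhs_nbhs.
by move=> /(_ FA' Dp')[_ [[t At <-] Dt]]; exists t; split=> //; exact: CB.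
Qed.
End unit_interval_theory.

Section join.
Context (R : realType) (X Y : compactHausdorffType).
Local Notation I := (unit_interval R).
Local Notation cyl := (X * Y * I)%type.

(* (x, y, 0) ~ (x', y, 0) and (x, y, 1) ~ (x, y', 1) *)
Definition join_rel (p q : cyl) : bool :=
  `[< p.2 = q.2 /\ [\/ p.1 = q.1,
                      ival p.2 = 0 /\ p.1.2 = q.1.2 |
                      ival p.2 = 1 /\ p.1.1 = q.1.1] >].

Lemma join_relP : equiv_class_of join_rel.
Proof.
split=> [p|p q|q p r]; rewrite /join_rel.
- by apply/asboolP; split=> //; exact: Or31.
- apply/asboolP/asboolP => -[-> [->|[? ->]|[? ->]]]; split=> //;
    [exact: Or31|exact: Or32|exact: Or33|exact: Or31|exact: Or32|exact: Or33].
- move=> /asboolP[pq hpq] /asboolP[qr hqr]; apply/asboolP; rewrite pq qr.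
  split=> //; move: hpq hqr; rewrite pq qr => -[->|[z ->]|[o ->]] //.
    move=> [->|[_ ->]|[o _]]; [exact: Or32|exact: Or32|].
    by exfalso; move: o; rewrite z => /eqP; rewrite eq_sym oner_eq0.
  move=> [->|[z _]|[_ ->]]; [exact: Or33| |exact: Or33].
  by exfalso; move: o; rewrite z => /eqP; rewrite eq_sym oner_eq0.
Qed.

Canonical join_equiv := EquivRelPack join_relP.

Definition join : Type := quotient_topology {eq_quot join_equiv}.
HB.instance Definition _ := Topological.on join.
HB.instance Definition _ := Quotient.on join.

Definition join_pi (p : cyl) : join := \pi_join p.

Lemma join_pi_continuous : continuous join_pi.
Proof. exact: pi_continuous. Qed.

Lemma join_piP p q : join_pi p = join_pi q <-> join_rel p q.
Proof. by split=> [/eqmodP|h]; [|exact/eqmodP]. Qed.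

Lemma join_pi_surj j : exists p, j = join_pi p.
Proof. by exists (repr j); rewrite /join_pi reprK. Qed.

Lemma join_openE (U : set join) : open U = open (join_pi @^-1` U).
Proof. by []. Qed.

Lemma join_continuous (Z : topologicalType) (f : join -> Z) :
  continuous (f \o join_pi) -> continuous f.
Proof. by move=> cf; apply/quotient_continuous. Qed.

Let join_compact : compact [set: join].
Proof.
have -> : [set: join] = join_pi @` [set: cyl].
  by apply/seteqP; split=> // j _; have [p ->] := join_pi_surj j; exists p.
apply: continuous_compact; first exact: continuous_subspaceT join_pi_continuous.
rewrite -!setXTT; apply: compact_setX; last exact: unit_interval_compact.
by apply: compact_setX; exact: compactT.
Qed.

Lemma join_open_sat (P : set cyl) (j : join) :
  open P -> (forall p q, join_rel p q -> P p -> P q) ->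
  forall p, j = join_pi p -> P p -> open (join_pi @` P) /\ (join_pi @` P) j.
Proof.
move=> oP sat p -> Pp; split; last by exists p.
rewrite join_openE (_ : _ @^-1` _ = P) //.
apply/seteqP; split=> [q [r Pr /join_piP]|q Pq]; last by exists q.
by move=> /sat; apply.
Qed.

Let sep (P Q : set cyl) (p q : cyl) :
  open P -> open Q ->
  (forall a b, join_rel a b -> P a -> P b) ->
  (forall a b, join_rel a b -> Q a -> Q b) ->
  P p -> Q q -> (forall a, P a -> Q a -> False) ->
  exists2 AB : set join * set join,
    join_pi p \in AB.1 /\ join_pi q \in AB.2 &
    [/\ open AB.1, open AB.2 & AB.1 `&` AB.2 == set0].
Proof.
move=> oP oQ sP sQ Pp Qq PQ.
have [oP' Pp'] := join_open_sat oP sP erefl Pp.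
have [oQ' Qq'] := join_open_sat oQ sQ erefl Qq.
exists (join_pi @` P, join_pi @` Q); first by split; exact: mem_set.
split=> //; apply/eqP/seteqP; split=> // _ [[a Pa <-] [b Qb /join_piP ba]].
exact: PQ Pa (sQ _ _ ba Qb).
Qed.

Let ivalc : continuous (fun p : cyl => ival p.2).
Proof. by move=> p; apply: continuous_comp; [exact: cvg_snd|exact: ival_continuous]. Qed.
Let xc : continuous (fun p : cyl => p.1.1).
Proof. by move=> p; apply: continuous_comp; exact: cvg_fst. Qed.
Let yc : continuous (fun p : cyl => p.1.2).
Proof. by move=> p; apply: continuous_comp; [exact: cvg_fst|exact: cvg_snd]. Qed.

Let join_hausdorff : hausdorff_space join.
Proof.
have hsep (T : compactHausdorffType) (a b : T) : a != b -> exists A B : set T,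
    [/\ open A, open B, A a, B b & forall c, A c -> B c -> False].
  have := @hausdorffT T; rewrite open_hausdorff => h /h[[A B] /=].
  rewrite !inE => -[Aa Bb] [oA oB AB0]; exists A, B; split=> // c Ac Bc.
  by have : set0 c by rewrite -AB0.
have sepR (a b : R) : a < b -> exists A B : set R,
    [/\ open A, open B, A a, B b & forall c, A c -> B c -> False].
  move=> ab; exists [set x | x < (a + b) / 2], [set x | x > (a + b) / 2].
  have [h1 h2] := midf_lt ab.
  split=> // c /= h3 /(lt_trans h3).
  by rewrite ltxx.
have opre (T : topologicalType) (f : cyl -> T) (A : set T) :
  continuous f -> open A -> open (f @^-1` A).
  by move=> /continuousP; apply.
have rel2 p q : join_rel p q -> p.2 = q.2 by move=> /asboolP[].
rewrite open_hausdorff => j k jk.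
have [[p jp] [q kq]] := (join_pi_surj j, join_pi_surj k); subst j k.
have [pq2|pq2] := eqVneq (ival p.2) (ival q.2); last first.
  have [A [B [oA oB Ap Bq AB]]] : exists A B : set R,
    [/\ open A, open B, A (ival p.2), B (ival q.2) & forall c, A c -> B c -> False].
    have [/sepR//|/sepR[A [B [? ? ? ? h]]]|/eqP] := ltgtP (ival p.2) (ival q.2);
      last by rewrite (negbTE pq2).
    by exists B, A; split=> // c ? ?; exact: (h c).
  apply: (@sep [set r | A (ival r.2)] [set r | B (ival r.2)]) => //.
  - exact: opre.
  - exact: opre.
  - by move=> a b /rel2 /= ->.
  - by move=> a b /rel2 /= ->.
  - by move=> a; exact: AB.
have pq2' : p.2 = q.2 by exact: ival_inj.
have npq : ~ join_rel p q by move=> /join_piP pq; move: jk; rewrite pq eqxx.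
have [p10|p11] := eqVneq p.1.1 q.1.1; last first.
  have [t0|t0] := eqVneq (ival p.2) 0.
    have y12 : p.1.2 != q.1.2.
      apply/eqP => y12; apply: npq; apply/asboolP; split=> //.
      exact: Or32.
    have [A [B [oA oB Ap Bq AB]]] := hsep _ _ _ y12.
    apply: (@sep [set r | ival r.2 < 1 /\ A r.1.2] [set r | ival r.2 < 1 /\ B r.1.2]).
    - by apply: openI; [exact: (opre _ _ _ ivalc (@open_lt _ 1))|exact: opre yc oA].
    - by apply: openI; [exact: (opre _ _ _ ivalc (@open_lt _ 1))|exact: opre yc oB].
    - move=> a b /asboolP[e [e1|[_ e1]|[e1 _]]] /=; rewrite -e ?e1 //.
      by rewrite ltxx => -[].
    - move=> a b /asboolP[e [e1|[_ e1]|[e1 _]]] /=; rewrite -e ?e1 //.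
      by rewrite ltxx => -[].
    - by split=> //; rewrite t0 ltr01.
    - by split=> //; rewrite -pq2 t0 ltr01.
    - by move=> a [_ Aa] [_ Ba]; exact: AB Aa Ba.
  have t0' : 0 < ival p.2.
    rewrite lt_def t0 /=; have := set_valP (p.2 : set_type `[0 : R, 1]%classic).
    by rewrite /= in_itv /= => /andP[].
  have [A [B [oA oB Ap Bq AB]]] := hsep _ _ _ p11.
  apply: (@sep [set r | 0 < ival r.2 /\ A r.1.1] [set r | 0 < ival r.2 /\ B r.1.1]).
  - by apply: openI; [exact: (opre _ _ _ ivalc (@open_gt _ 0))|exact: opre xc oA].
  - by apply: openI; [exact: (opre _ _ _ ivalc (@open_gt _ 0))|exact: opre xc oB].
  - move=> a b /asboolP[e [e1|[e1 _]|[_ e1]]] /=; rewrite -e ?e1 //.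
    by rewrite ltxx => -[].
  - move=> a b /asboolP[e [e1|[e1 _]|[_ e1]]] /=; rewrite -e ?e1 //.
    by rewrite ltxx => -[].
  - by [].
  - by rewrite /= -pq2.
  - by move=> a [_ Aa] [_ Ba]; exact: AB Aa Ba.
have y12 : p.1.2 != q.1.2.
  apply/eqP => y12; apply: npq; apply/asboolP; split=> //; apply: Or31.
  by move: p10 y12; case: (p.1) (q.1) => [? ?] [? ?] /= -> ->.
have t1 : ival p.2 < 1.
  rewrite lt_neqAle; apply/andP; split.
    by apply/eqP => t1; apply: npq; apply/asboolP; split=> //; exact: Or33.
  have := set_valP (p.2 : set_type `[0 : R, 1]%classic).
  by rewrite /= in_itv /= => /andP[].
have [A [B [oA oB Ap Bq AB]]] := hsep _ _ _ y12.
apply: (@sep [set r | ival r.2 < 1 /\ A r.1.2] [set r | ival r.2 < 1 /\ B r.1.2]).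
- by apply: openI; [exact: (opre _ _ _ ivalc (@open_lt _ 1))|exact: opre yc oA].
- by apply: openI; [exact: (opre _ _ _ ivalc (@open_lt _ 1))|exact: opre yc oB].
- move=> a b /asboolP[e [e1|[_ e1]|[e1 _]]] /=; rewrite -e ?e1 //.
  by rewrite ltxx => -[].
- move=> a b /asboolP[e [e1|[_ e1]|[e1 _]]] /=; rewrite -e ?e1 //.
  by rewrite ltxx => -[].
- by [].
- by rewrite /= -pq2.
- by move=> a [_ Aa] [_ Ba]; exact: AB Aa Ba.
Qed.

HB.instance Definition _ := isCompactHausdorff.Build join join_compact join_hausdorff.

End join.

Lemma continuous_pair (A B C : topologicalType) (f : A -> B) (g : A -> C) :
  continuous f -> continuous g -> continuous (fun x => (f x, g x)).
Proof. by move=> cf cg x; apply: cvg_pair; [exact: cf|exact: cg]. Qed.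

Section join_action.
Context (R : realType) (G : compactGroupType) (X Y : gspace G).
Local Notation cyl := (X * Y * unit_interval R)%type.
Local Notation J := (join R X Y).

Definition cyl_act (g : G) (p : cyl) : cyl := (gact g p.1.1, gact g p.1.2, p.2).

Definition join_act (g : G) (j : J) : J := join_pi (cyl_act g (repr j)).

Lemma join_actE g p : join_act g (join_pi p) = join_pi (cyl_act g p).
Proof.
rewrite /join_act; apply/join_piP/asboolP.
have /join_piP/asboolP[] : join_pi (repr (join_pi p : J)) = join_pi p.
  by rewrite {1}/join_pi reprK.
by rewrite /cyl_act /= => -> [->|[? ->]|[? ->]]; split=> //;
  [exact: Or31|exact: Or32|exact: Or33].
Qed.

Let jact1 j : join_act 1%g j = j.
Proof.
have [[[x y] t] ->] := join_pi_surj j.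
by rewrite join_actE /cyl_act /= !gact1.
Qed.

Let jactM g h j : join_act (g * h)%g j = join_act g (join_act h j).
Proof.
have [[[x y] t] ->] := join_pi_surj j.
by rewrite !join_actE /cyl_act /= !gactM.
Qed.

Let cyl_act_continuous : continuous (fun q : cyl * G => cyl_act q.2 q.1).
Proof.
have fstc : continuous (fun q : cyl * G => q.1.1).
  by move=> q; apply: (@continuous_comp _ _ _ fst fst q); exact: cvg_fst.
have pact (Z : gspace G) (f : cyl * G -> Z) :
    continuous f -> continuous (fun q => gact q.2 (f q)).
  move=> cf q; apply: (@continuous_comp _ _ _ (fun q => (q.2, f q))
    (fun p : G * Z => gact p.1 p.2) q); last exact: gact_continuous.
  by apply: continuous_pair => // p; exact: cvg_snd.
apply: continuous_pair; first apply: continuous_pair.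
- by apply: pact => q; apply: (@continuous_comp _ _ _ (fun q : cyl * G => q.1.1) fst q);
    [exact: fstc|exact: cvg_fst].
- by apply: pact => q; apply: (@continuous_comp _ _ _ (fun q : cyl * G => q.1.1) snd q);
    [exact: fstc|exact: cvg_snd].
- by move=> q; apply: (@continuous_comp _ _ _ fst snd q); [exact: cvg_fst|exact: cvg_snd].
Qed.

Import ArrowAsCompactOpen.

Let jact_continuous : continuous (fun p : G * J => join_act p.1 p.2).
Proof.
pose f (j : J) (g : G) := join_act g j.
have cf0 : continuous (fun q : cyl * G => join_pi (cyl_act q.2 q.1) : J).
  move=> q; apply: continuous_comp; first exact: cyl_act_continuous.
  exact: join_pi_continuous.
have cf : continuous f.
  apply: join_continuous.
  rewrite (_ : f \o _ = curry (fun q : cyl * G => join_pi (cyl_act q.2 q.1) : J)).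
    exact: continuous_curry_fun.
  by apply/funext => p; apply/funext => g; rewrite /f /= join_actE.
have cfj j : continuous (f j).
  have [p ->] := join_pi_surj j.
  rewrite (_ : f _ = curry (fun q : cyl * G => join_pi (cyl_act q.2 q.1) : J) p).
    by have [_] := continuous_curry cf0.
  by apply/funext => g; rewrite /f /= join_actE.
have lcG : locally_compact [set: G].
  move=> x _; rewrite withinET; exists [set: G]; first exact: filterT.
  by split; [exact: compactT|exact: closedT].
have := continuous_uncurry lcG (@hausdorffT G) cf cfj.
move=> cu [g j].
apply: (@continuous_comp _ _ _ (fun p : G * J => (p.2, p.1)) (uncurry f) (g, j));
  last exact: cu.
by apply: (@continuous_pair _ _ _ snd fst) => p; [exact: cvg_snd|exact: cvg_fst].
Qed.

Definition gjoin : gspace G :=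
  @GSpace G J join_act jact1 jactM jact_continuous.

End join_action.

(* The k-fold join of G with itself for 0 < k, with the action induced by left
   translation; for k = 0 it is G, a junk value. *)
Definition join_power (R : realType) (G : compactGroupType) (k : nat) : gspace G :=
  iter k.-1 (fun X => gjoin R X (left_translation G)) (left_translation G).

(* f is of class C^k on the open set U: all the directional derivatives of f
   exist and are of class C^(k-1) on U. *)
Fixpoint Ck_on (R : realType) (V W : normedModType R) (k : nat) (U : set V)
    (f : V -> W) : Prop :=
  if k is k'.+1 then
    forall v, (forall x, U x -> derivable f x v) /\ Ck_on k' U ('D_v f)
  else forall x, U x -> {for x, continuous f}.

Definition smooth_on (R : realType) (V W : normedModType R) (U : set V)
    (f : V -> W) : Prop :=
  open U /\ forall k, Ck_on k U f.

Record chart (R : realType) (T : topologicalType) (d : nat) := Chart {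
  chart_dom : set T;
  chart_map : T -> 'rV[R]_d;
  chart_inv : 'rV[R]_d -> T;
  chart_dom_open : open chart_dom;
  chart_im_open : open (chart_map @` chart_dom);
  chart_mapK : {in chart_dom, cancel chart_map chart_inv};
  chart_map_continuous : {within chart_dom, continuous chart_map};
  chart_inv_continuous : {within chart_map @` chart_dom, continuous chart_inv}
}.

Definition smooth_atlas (R : realType) (T : topologicalType) d
    (At : set (chart R T d)) : Prop :=
  (forall x, exists2 c, At c & chart_dom c x) /\
  (forall c c', At c -> At c' ->
     smooth_on (chart_map c @` (chart_dom c `&` chart_dom c'))
       (chart_map c' \o chart_inv c)).

(* G carries a smooth manifold structure for which its operations are smooth.
   All components of G have the same dimension, as translations are
   diffeomorphisms; second countability follows from compactness. *)
Definition is_lie_group (R : realType) (G : compactGroupType) : Prop :=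
  exists (d : nat) (At : set (chart R G d)),
  [/\ smooth_atlas At,
      forall c c', At c -> At c' ->
        smooth_on
          [set v | (chart_map c @` chart_dom c) v /\ chart_dom c' (chart_inv c v)^-1%g]
          (fun v => chart_map c' (chart_inv c v)^-1%g) &
      forall c1 c2 c3, At c1 -> At c2 -> At c3 ->
        smooth_on
          [set p : 'rV[R]_d * 'rV[R]_d |
            [/\ (chart_map c1 @` chart_dom c1) p.1, (chart_map c2 @` chart_dom c2) p.2 &
               chart_dom c3 (chart_inv c1 p.1 * chart_inv c2 p.2)%g]]
          (fun p => chart_map c3 (chart_inv c1 p.1 * chart_inv c2 p.2)%g)].

(* Main.v *)
Require Import Defs.
From HB Require Import structures.
From mathcomp Require Import all_boot all_order all_algebra.
From mathcomp Require Import complex ring lra zify.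
From mathcomp Require Import boolp classical_sets functions cardinality reals ereal.
From mathcomp Require Import topology normedtype derive sequences realfun.

(** Upper bound. A point of the join of [n.+1] copies of [G] is a family of
    weights [t_j] of sum 1 together with group elements [g_j], where [g_j]
    matters only if [t_j] is nonzero. For a function [f] on [G], the function
    sending such a point to [t_j f(g_j)] is continuous, and the constant
    sequences at these functions are [n.+1] commuting equivariant order zero
    maps whose values at 1 sum to 1 ([coordinate_towers], [dim_Rok_c_le]).

    Lower bound. Suppose that there are [d.+1] towers with [d < n]. Evaluating
    lifts of the towers at a point [z] of the join, far enough along the
    sequence, gives [d.+1] almost positive, almost order zero functionals on the
    continuous functions on [G]. A limit along an ultrafilter is exactly
    positive and order zero, hence a multiple of the evaluation at a point of
    [G] ([order_zero_functional]); so the functionals are close to a point of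
    the join of [d.+1] copies ([approx_points]). This point can be chosen
    equivariantly and depends on [z] with arbitrarily small jumps
    ([towers_approximable]).

    An honest equivariant map would contradict the Borsuk-Ulam theorem. To allow
    for jumps, the argument is carried out with simplicial chains whose
    simplices are finite sequences of points that are close to each other, as in
    the homology theory of Vietoris. Only a cyclic subgroup matters: the Lie
    group [G] has an element [h] of finite order [q > 1] ([lie_torsion]): if a
    power [g ^+ k] of some [g <> 1] is close to 1, then it has a [k]-th root [w]
    that is close to 1 and commutes with [g], and [h] is [g * w^-1]. On the join
    of [k.+1] copies there are arbitrarily fine chains of degrees up to [k] that
    lift the periodic resolution of the cyclic group of order [q]
    ([fine_chains_join]). Joining the given maps with the identity of [G] and
    composing, one reaches the join of [d.+1] copies from joins of arbitrarily
    many copies ([approximable_join]), so this join carries such chains in every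
    degree ([fine_chains_transport]). But [h] acts freely on this compact space,
    which therefore has an equivariant labelling by finitely many free orbits of
    labels that is coherent on fine simplices ([free_labelling]), and the labels
    bound the degree of the chains ([no_coherent_chains]). *)

Set Implicit Arguments.
Unset Strict Implicit.
Unset Printing Implicit Defensive.

Import Order.TTheory GRing.Theory Num.Theory.
Import numFieldNormedType.Exports.

Local Open Scope classical_set_scope.
Local Open Scope ring_scope.
Local Open Scope complex_scope.
Local Open Scope star_scope.


(** * Alternating cochains on sequences *)

Section coboundary.
Context {T : Type} {K : pzRingType}.
Implicit Types (f g : seq T -> K) (s : seq T).

(** The alternating sum of the values of [f] on the faces of a sequence, in the
    augmented convention: the only face of a vertex is the empty sequence. *)
Fixpoint cobound f s : K :=
  if s is x :: s' then f s' - cobound (fun t => f (x :: t)) s' else 0.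

Lemma eq_cobound f g s : f =1 g -> cobound f s = cobound g s.
Proof.
elim: s f g => [//|x s IH] f g fg /=; rewrite fg; congr (_ - _).
by apply: IH => t; exact: fg.
Qed.

Lemma coboundB f g s :
  cobound (fun t => f t - g t) s = cobound f s - cobound g s.
Proof.
elim: s f g => [|x s IH] f g /=; first by rewrite subr0.
by rewrite IH !opprD !opprK addrACA.
Qed.

Lemma coboundD f g s :
  cobound (fun t => f t + g t) s = cobound f s + cobound g s.
Proof.
elim: s f g => [|x s IH] f g /=; first by rewrite addr0.
by rewrite IH opprD addrACA.
Qed.

Lemma cobound_sum (I : Type) (r : seq I) (F : I -> seq T -> K) s :
  cobound (fun t => \sum_(i <- r) F i t) s = \sum_(i <- r) cobound (F i) s.
Proof.
elim: s F => [|x s IH] F /=; first by rewrite big1.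
by rewrite IH sumrB.
Qed.

Lemma coboundK f s : cobound (cobound f) s = 0.
Proof.
elim: s f => [//|x s IH] f /=.
by rewrite (coboundB (fun t => f t)) IH subr0 subrr.
Qed.

End coboundary.

Lemma cobound_map (S T : Type) (K : pzRingType) (p : S -> T)
    (f : seq T -> K) s :
  cobound (fun t => f (map p t)) s = cobound f (map p s).
Proof.
elim: s f => [//|x s IH] f /=; congr (_ - _).
exact: (IH (fun t => f (p x :: t))).
Qed.

(** A relation between cochains which holds on a class of sequences closed under
    taking faces passes to their coboundaries. *)
Lemma cobound_faces (T : eqType) (K : pzRingType) (f g : seq T -> K) s :
  (forall t, subseq t s -> size s = (size t).+1 -> f t = g t) ->
  cobound f s = cobound g s.
Proof.
elim: s f g => [//|x s IH] f g fg /=; congr (_ - _).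
  by apply: fg => //; exact: subseq_cons.
apply: IH => t ts st; apply: fg; last by rewrite /= st.
by rewrite /= eqxx.
Qed.

Section cyclic_operators.
Context {T : Type} {K : pzRingType} (q : nat) (h : T -> T).

(** In degree [i], the operator [h - 1] for odd [i] and the norm
    [1 + h + ... + h^(q-1)] for even [i] of a map [h] of order [q]. These are
    the differentials of the periodic resolution of a cyclic group. *)
Definition periodic (i : nat) (f : seq T -> K) (s : seq T) : K :=
  if odd i then f (map h s) - f s else \sum_(j < q) f (map (iter j h) s).

Lemma periodicB i f g s :
  periodic i (fun t => f t - g t) s = periodic i f s - periodic i g s.
Proof.
rewrite /periodic; case: ifP => _; last by rewrite sumrB.
by rewrite !opprD !opprK addrACA.
Qed.

Lemma eq_periodic i f g s :
  (forall j, f (map (iter j h) s) = g (map (iter j h) s)) ->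
  periodic i f s = periodic i g s.
Proof.
move=> fg; rewrite /periodic; case: ifP => _; last by apply: eq_bigr => j _.
congr (_ - _); first exact: (fg 1%N).
by have := fg 0%N; rewrite (eq_map (_ : iter 0 h =1 id)) ?map_id.
Qed.

Lemma cobound_periodic i f s :
  cobound (periodic i f) s = periodic i (cobound f) s.
Proof.
rewrite /periodic; case: ifP => _.
  by rewrite (coboundB (fun t => f (map h t)) f) cobound_map.
rewrite cobound_sum; apply: eq_bigr => j _; exact: cobound_map.
Qed.

Hypothesis hq : forall x, iter q h x = x.

Lemma map_iterS j (s : seq T) : map (iter j h) (map h s) = map (iter j.+1 h) s.
Proof. by rewrite -map_comp; apply: eq_map => x; rewrite /= -iterSr. Qed.

Lemma norm_invariant (f : seq T -> K) s :
  \sum_(j < q) f (map (iter j h) (map h s)) = \sum_(j < q) f (map (iter j h) s).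
Proof.
under eq_bigr do rewrite map_iterS.
case: q hq => [|q'] hq'; first by rewrite !big_ord0.
rewrite big_ord_recr big_ord_recl /= addrC; congr (_ + _).
by congr (f _); apply: eq_map => x /=; rewrite -iterS hq'.
Qed.

Lemma periodicK i f s : periodic i (periodic i.+1 f) s = 0.
Proof.
rewrite /periodic /=; case: (odd i) => /=.
  by rewrite norm_invariant subrr.
rewrite sumrB; apply/eqP; rewrite subr_eq0; apply/eqP.
rewrite -norm_invariant; apply: eq_bigr => j _; congr (f _).
rewrite map_iterS -map_comp; exact: eq_map.
Qed.

End cyclic_operators.

Lemma periodic_map (S T : Type) (K : pzRingType) q (hS : S -> S) (hT : T -> T)
    (p : S -> T) i (f : seq T -> K) s :
  (forall x, p (hS x) = hT (p x)) ->
  periodic q hS i (fun t => f (map p t)) s = periodic q hT i f (map p s).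
Proof.
move=> ph; have ph' j x : p (iter j hS x) = iter j hT (p x).
  by elim: j => //= j <-.
have pm j : map p (map (iter j hS) s) = map (iter j hT) (map p s).
  by rewrite -!map_comp; apply: eq_map => x /=.
rewrite /periodic; case: ifP => _; last by apply: eq_bigr => j _; rewrite pm.
by rewrite (pm 1%N).
Qed.

Section alternating.
Context {T : eqType} {K : pzRingType}.
Implicit Types (P : seq T -> Prop) (f g : seq T -> K) (s : seq T).

Definition alternating_on P f :=
  (forall s1 x y s2, P (s1 ++ x :: y :: s2) ->
     f (s1 ++ x :: y :: s2) = - f (s1 ++ y :: x :: s2)) /\
  (forall s1 x s2, P (s1 ++ x :: x :: s2) -> f (s1 ++ x :: x :: s2) = 0).

Definition hereditary P := forall s t, subseq s t -> P t -> P s.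

(** The faces opposite to two exchanged adjacent entries appear with opposite
    signs, and the other faces are themselves exchanged. *)
Lemma alternating_cobound P f :
  hereditary P -> alternating_on P f -> alternating_on P (cobound f).
Proof.
have consP P' x : hereditary P' -> hereditary (fun s => P' (x :: s)).
  by move=> hP s t st; apply: hP; rewrite /= eqxx.
have consf P' f' x : alternating_on P' f' ->
    alternating_on (fun s => P' (x :: s)) (fun s => f' (x :: s)).
  by move=> [h1 h2]; split=> [s1|s1]; [exact: (h1 (x :: s1))|exact: (h2 (x :: s1))].
have sub0 (x y : T) s t : subseq s t -> subseq [:: x, y & s] [:: x, y & t].
  by move=> st; rewrite /= !eqxx.
move=> hP aP; split=> s1 x.
  move=> y s2; elim: s1 P f hP aP => [|z s1 IH] P f hP aP Ps /=.
    rewrite (cobound_faces (g := fun t => - f [:: y, x & t])) => [|t ts _]; last first.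
      by apply: (aP.1 [::]); apply: hP Ps; exact: sub0.
    have -> : cobound (fun t => - f [:: y, x & t]) s2 =
        - cobound (fun t => f [:: y, x & t]) s2.
      rewrite -[RHS]add0r.
      have <- : cobound (fun=> 0) s2 = 0 :> K.
        by elim: (s2) => //= ? ? ->; rewrite subr0.
      by rewrite -coboundB; apply: eq_cobound => t; rewrite sub0r.
    by rewrite opprK opprD addrA [RHS]opprB [RHS]addrAC.
  rewrite (IH _ _ (consP _ z hP) (consf _ _ z aP)) //.
  rewrite (aP.1) 1?opprD ?opprK //.
  by apply: hP Ps; exact: subseq_cons.
move=> s2; elim: s1 P f hP aP => [|z s1 IH] P f hP aP Ps /=.
  rewrite opprB addrC subrK.
  rewrite (cobound_faces (g := fun t => 0)) => [|t ts _]; last first.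
    by apply: (aP.2 [::]); apply: hP Ps; exact: sub0.
  by elim: (s2) => //= ? ? ->; rewrite subr0.
rewrite (IH _ _ (consP _ z hP) (consf _ _ z aP)) // subr0.
by rewrite (aP.2) //; apply: hP Ps; exact: subseq_cons.
Qed.

(** Transpositions bring the two equal entries next to each other. *)
Lemma alternating_repeat P f s1 x s2 s3 :
  (forall s t, perm_eq s t -> P s -> P t) -> alternating_on P f ->
  P (s1 ++ x :: s2 ++ x :: s3) -> f (s1 ++ x :: s2 ++ x :: s3) = 0.
Proof.
move=> permP [h1 h2]; elim: s2 s1 => [|y s2 IH] s1 Ps; first exact: h2.
rewrite /= h1 // -cat_rcons IH ?oppr0 // cat_rcons.
apply: permP Ps; rewrite perm_cat2l /=.
by rewrite -(cat1s x) -(cat1s y (x :: _)) -(cat1s y) -(cat1s x (s2 ++ _)) perm_catCA.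
Qed.

End alternating.

(** * A Borsuk-Ulam theorem for chains with a cyclic symmetry *)

(** Chains [c_0, ..., c_k], one in each degree, such that the boundary of
    [c_(i+1)] is the image of [c_i] by the operator [periodic i.+1]: they lift the
    first [k] steps of the periodic resolution. Encoding a chain as the evaluation
    of cochains on it avoids free modules, and makes its support the extent to
    which this evaluation depends on the cochain. *)
Record cyclic_chains (T : Type) (K : pzRingType) (q : nat) (h : T -> T)
    (P : seq T -> Prop) (k : nat) (e : nat -> (seq T -> K) -> K) : Prop := {
  chain_vertex : exists x, forall f, e 0%N f = f [:: x];
  chain_boundary : forall i f, (i < k)%N ->
    e i.+1 (cobound f) = e i (periodic q h i.+1 f);
  chain_support : forall i f g, (i <= k)%N ->
    (forall s, size s = i.+1 -> P s -> f s = g s) -> e i f = e i g;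
  chain_sub : forall i f g, (i <= k)%N ->
    e i (fun s => f s - g s) = e i f - e i g
}.

Lemma chain0 (T : Type) (K : pzRingType) q h P k (e : nat -> (seq T -> K) -> K) i f :
  cyclic_chains q h P k e -> (i <= k)%N ->
  (forall s, size s = i.+1 -> P s -> f s = 0) -> e i f = 0.
Proof.
move=> ce ik f0; rewrite -[RHS](subrr (e i f)) -(chain_sub ce) //.
by apply: (chain_support ce) => // s s1 Ps; rewrite f0 // subrr.
Qed.

(** Consecutive operators of the periodic resolution have product zero, so the
    image of the last chain is a cycle: there is no obstruction in homology to
    adding one more chain. *)
Lemma chain_cycle (T : Type) (K : pzRingType) q (h : T -> T) P k
    (e : nat -> (seq T -> K) -> K) f : (forall x, iter q h x = x) ->
  cyclic_chains q h P k e -> e k (cobound (periodic q h k.+1 f)) = 0.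
Proof.
case: k => [|k] hq ce.
  by have [x ->] := chain_vertex ce; rewrite /= /periodic /= subrr subr0.
rewrite (chain_boundary ce) //; apply: (chain0 ce) => // s _ _; exact: periodicK.
Qed.

Lemma cyclic_chains_le (T : Type) (K : pzRingType) q (h : T -> T) P m k
    (e : nat -> (seq T -> K) -> K) : (m <= k)%N ->
  cyclic_chains q h P k e -> cyclic_chains q h P m e.
Proof.
move=> mk ce; split; first exact: chain_vertex ce.
- by move=> i f im; apply: (chain_boundary ce); exact: leq_trans mk.
- by move=> i f g im; apply: (chain_support ce); exact: leq_trans mk.
- by move=> i f g im; apply: (chain_sub ce); exact: leq_trans mk.
Qed.

Lemma push_chains (S T : Type) (K : pzRingType) q (hS : S -> S) (hT : T -> T)
    (p : S -> T) P Q k (e : nat -> (seq S -> K) -> K) :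
  (forall x, p (hS x) = hT (p x)) -> (forall s, P s -> Q (map p s)) ->
  cyclic_chains q hS P k e ->
  cyclic_chains q hT Q k (fun i f => e i (fun s => f (map p s))).
Proof.
move=> ph PQ ce; split.
- by have [x ex] := chain_vertex ce; exists (p x) => f; rewrite ex.
- move=> i f ik; rewrite -(chain_support ce (f := cobound (fun s => f (map p s)))) //.
    rewrite (chain_boundary ce) //; apply: (chain_support ce) => [|s _ _]; first exact: ltnW.
    exact: periodic_map.
  by move=> s _ _; exact: cobound_map.
- move=> i f g ik fg; apply: (chain_support ce) => // s si Ps.
  by apply: fg; [rewrite size_map|exact: PQ].
- by move=> i f g ik; exact: (chain_sub ce).
Qed.

Section labels.
Context (q : nat) (q1 : (1 < q)%N) (m : nat).
Local Notation K := 'Z_q.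
Local Notation T := (nat * 'Z_q)%type.
Implicit Types (x y : T) (s t : seq T) (f g : seq T -> K).

Definition label_shift x : T := (x.1, x.2 + 1).

(** The simplices of the join of [m] copies of the cyclic group: they have at most
    one vertex in each copy. *)
Definition coherent s :=
  (forall x, x \in s -> (x.1 < m)%N) /\
  (forall x y, x \in s -> y \in s -> x.1 = y.1 -> x = y).

Local Notation h := label_shift.

Let iter_h j x : iter j h x = (x.1, x.2 + j%:R).
Proof.
elim: j => [|j IH] /=; first by rewrite addr0; case: x.
by rewrite IH /h /= -addrA natr1.
Qed.

Let hq x : iter q h x = x.
Proof. by rewrite iter_h char_Zp ?addr0; case: x. Qed.

Let coherent_sub s t : {subset s <= t} -> coherent t -> coherent s.
Proof.
move=> st [h1 h2]; split=> [x /st/h1 //|x y /st xt /st yt]; exact: h2.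
Qed.

Let coherent_hered : hereditary coherent.
Proof. by move=> s t st; apply: coherent_sub => x; exact: mem_subseq. Qed.

Let coherent_perm s t : perm_eq s t -> coherent s -> coherent t.
Proof. by move=> st; apply: coherent_sub => x; rewrite (perm_mem st). Qed.

Let coherent_h s : coherent s -> coherent (map h s).
Proof.
move=> [h1 h2]; split=> [x /mapP[y ys ->]|x y /mapP[a As ->] /mapP[b Bs ->] ab].
  exact: (h1 y).
by rewrite (h2 _ _ As Bs ab).
Qed.

Let coherent_iter s j : coherent s -> coherent (map (iter j h) s).
Proof.
move=> cs; elim: j => [|j IH].
  by rewrite (eq_map (_ : iter 0 h =1 id)) ?map_id.
by have := coherent_h IH; rewrite -map_comp.
Qed.

(** On coherent sequences this second coordinate at the smallest first coordinate
    is symmetric and equivariant: it exhibits the freeness of the action of the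
    cyclic group on simplices. *)
Definition phase s : K :=
  (foldr (fun x y => if (x.1 <= y.1)%N then x else y) (last (0%N, 0) s) s).2.

Let phaseP s : s != [::] -> exists2 x, x \in s &
  phase s = x.2 /\ forall y, y \in s -> (x.1 <= y.1)%N.
Proof.
move=> s0; pose mn z t := foldr (fun x y : T => if (x.1 <= y.1)%N then x else y) z t.
have mn_in z t : mn z t \in z :: t.
  elim: t => [|x t IH] /=; first by rewrite mem_head.
  case: ifP => _; first by rewrite !inE eqxx orbT.
  by move: IH; rewrite !inE => /orP[->|->]; rewrite ?orbT.
have mn_le z t y : y \in t -> ((mn z t).1 <= y.1)%N.
  elim: t => [//|x t IH] /=; rewrite inE; case: ifPn => [xm|].
    by move=> /orP[/eqP->//|/IH]; exact: leq_trans.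
  by rewrite -ltnNge => xm /orP[/eqP->|/IH//]; exact: ltnW.
exists (mn (last (0%N, 0) s) s).
  have := mn_in (last (0%N, 0) s) s; rewrite inE => /orP[/eqP ->|//].
  by case: (s) s0 => //= x s' _; exact: mem_last.
by split=> // y; exact: mn_le.
Qed.

Let phaseE s x : coherent s -> x \in s ->
  (forall y, y \in s -> (x.1 <= y.1)%N) -> phase s = x.2.
Proof.
move=> [_ cs] xs xm; have [|y ys [-> ym]] := @phaseP s; first by case: (s) xs.
by rewrite (cs y x ys xs) //; apply/eqP; rewrite eqn_leq xm // ym.
Qed.

Let phase_mem s t : coherent t -> s != [::] -> s =i t -> phase s = phase t.
Proof.
move=> ct s0 st; have [x xs [-> xm]] := phaseP s0.
by rewrite (@phaseE t x) -?st // => y; rewrite -st; exact: xm.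
Qed.

Let phase_h s : coherent s -> s != [::] -> phase (map h s) = phase s + 1.
Proof.
move=> cs s0; have [x xs [-> xm]] := phaseP s0.
rewrite (@phaseE _ (h x)) ?map_f //; first exact: coherent_h.
by move=> y /mapP[z zs ->]; exact: (xm z).
Qed.

Let phase_iter s j : coherent s -> s != [::] ->
  phase (map (iter j h) s) = phase s + j%:R.
Proof.
move=> cs s0; elim: j => [|j IH].
  by rewrite (eq_map (_ : iter 0 h =1 id)) ?map_id ?addr0.
have -> : map (iter j.+1 h) s = map h (map (iter j h) s) by rewrite -map_comp.
rewrite phase_h ?IH -?addrA ?natr1 //; first exact: coherent_iter.
by rewrite -size_eq0 size_map size_eq0.
Qed.

Local Notation tau i f := (periodic q h i f).

(** Exactness of the periodic resolution for the free action on simplices. An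
    invariant cochain is the norm of its restriction to phase 0; a cochain of norm
    zero is the coboundary, for the cyclic group, of its partial sums along the
    orbit up to the given phase. *)
Let periodic_solve i f n : alternating_on coherent f ->
  (forall s, size s = n.+1 -> coherent s -> tau i f s = 0) ->
  exists2 g, alternating_on coherent g &
    forall s, size s = n.+1 -> coherent s -> tau i.+1 g s = f s.
Proof.
move=> [f1 f2] f0.
have swap s1 x y s2 : s1 ++ x :: y :: s2 =i s1 ++ y :: x :: s2.
  by move=> z; rewrite !mem_cat !inE; congr orb; rewrite orbCA.
have cswap s1 x y s2 : coherent (s1 ++ x :: y :: s2) -> coherent (s1 ++ y :: x :: s2).
  by apply: coherent_sub => z; rewrite swap.
have vS (c : 'Z_q) : nat_of_ord (c + 1) = (c.+1 %% q)%N.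
  by rewrite -[c in LHS]natr_Zp natr1 val_Zp_nat.
have nz s1 x s2 : s1 ++ x :: s2 != [::] by case: s1.
case oi : (odd i); last first.
  pose g s := \sum_(j < phase s) f (map (iter (q - j.+1) h) s).
  exists g; last first.
    move=> s sn cs; have s0 : s != [::] by case: (s) sn.
    have pq : (phase s < q)%N by rewrite -[X in (_ < X)%N](Zp_cast q1).
    rewrite /periodic /= oi /= /g phase_h //.
    have [pm|pm] := eqVneq (phase s).+1 q.
      have -> : phase s + 1 = 0 by apply/ord_inj; rewrite vS pm modnn.
      rewrite big_ord0 sub0r; have := f0 s sn cs; rewrite /periodic oi.
      have sumN (F : nat -> K) n' N : n'.+1 = N ->
          \sum_(j < N) F j = F 0%N + \sum_(j < n') F (N - j.+1)%N.
        move=> <-; rewrite big_ord_recl (reindex_inj rev_ord_inj) /=; congr (_ + _).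
        apply: eq_bigr => j _; congr F; rewrite /bump add1n.
        by rewrite subnSK.
      rewrite (sumN (fun j => f (map (iter j h) s)) _ _ pm) => /eqP.
      rewrite addrC addr_eq0 => /eqP ->; rewrite opprK.
      by rewrite (eq_map (_ : iter 0 h =1 id)) ?map_id.
    have -> : nat_of_ord (phase s + 1) = (phase s).+1.
      by rewrite vS modn_small // ltn_neqAle pm.
    rewrite big_ord_recl map_iterS subn1 prednK ?(ltnW q1) //.
    rewrite (eq_map hq) map_id; apply/eqP; rewrite subr_eq; apply/eqP.
    congr (_ + _); apply: eq_bigr => j _.
    rewrite map_iterS /= /bump leq0n add1n subnSK //.
    rewrite -[X in (_ < X)%N](prednK (ltnW q1)) ltnS.
    by rewrite (leq_trans (ltn_ord j)) // -ltnS prednK // ltnW.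
  split=> [s1 x y s2 cs|s1 x s2 cs]; last first.
    rewrite /g big1 // => j _; rewrite map_cat /= f2 //.
    by have := coherent_iter (q - j.+1) cs; rewrite map_cat.
  rewrite /g (phase_mem (cswap _ _ _ _ cs) (nz _ _ _) (swap _ _ _ _)) -sumrN.
  apply: eq_bigr => j _; rewrite !map_cat /= f1 //.
  by have := coherent_iter (q - j.+1) cs; rewrite map_cat.
pose g s := if phase s == 0 then f s else 0.
exists g; last first.
  move=> s sn cs; have s0 : s != [::] by case: (s) sn.
  have inv j : f (map (iter j h) s) = f s.
    elim: j => [|j IH]; first by rewrite (eq_map (_ : iter 0 h =1 id)) ?map_id.
    have := f0 (map (iter j h) s); rewrite size_map => /(_ sn (coherent_iter j cs)).
    by rewrite /periodic oi -map_comp IH => /eqP; rewrite subr_eq0 => /eqP.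
  rewrite /periodic /= oi /= /g.
  under eq_bigr do rewrite inv phase_iter //.
  pose c : 'Z_q := - phase s; have cq : (c < q)%N by rewrite -[X in (_ < X)%N](Zp_cast q1).
  have pc : phase s + (Ordinal cq)%:R == 0.
    by apply/eqP; rewrite -[RHS](subrr (phase s)); congr (_ + _); exact: natr_Zp.
  rewrite (bigD1 (Ordinal cq)) // ifT //= big1 ?addr0 // => j jc.
  case: eqP => // pj; case/eqP: jc; apply/ord_inj.
  transitivity (nat_of_ord (j%:R : 'Z_q)); first by rewrite val_Zp_nat // modn_small.
  suff -> : j%:R = c by [].
  by apply/eqP; rewrite -subr_eq0 opprK addrC pj.
split=> [s1 x y s2 cs|s1 x s2 cs]; last by rewrite /g f2 // if_same.
rewrite /g (phase_mem (cswap _ _ _ _ cs) (nz _ _ _) (swap _ _ _ _)).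
by case: ifP; rewrite ?oppr0 // f1.
Qed.

(** A coherent sequence with more than [m] terms repeats one of them. *)
Let alternating_dim f s : alternating_on coherent f -> coherent s ->
  (m < size s)%N -> f s = 0.
Proof.
move=> af cs ms; have : ~~ uniq s.
  apply/negP => us; have : uniq (map fst s).
    by rewrite map_inj_in_uniq // => x y; exact: cs.2.
  have sub : {subset map fst s <= iota 0 m}.
    by move=> i /mapP[x xs ->]; rewrite mem_iota; exact: cs.1.
  by move=> /uniq_leq_size /(_ sub); rewrite size_map size_iota leqNgt ms.
have split_rep (t : seq T) : ~~ uniq t ->
    exists s1 x s2 s3, t = s1 ++ x :: s2 ++ x :: s3.
  elim: t => //= x t IH; rewrite negb_and negbK.
  have [/path.splitPr[s2 s3] _|_ /= /IH[s1 [y [s2 [s3 ->]]]]] := boolP (x \in t).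
    by exists [::], x, s2, s3.
  by exists (x :: s1), y, s2, s3.
move=> /split_rep[s1 [x [s2 [s3 es]]]]; move: cs; rewrite es.
exact: alternating_repeat.
Qed.

(** The chains detect the classes of the cyclic group: the label [x.2] pairs to 1
    with the chains in degree 0, and exactness transports this value to degree
    [m], where alternating cochains on simplices vanish for lack of vertices. *)
Theorem no_coherent_chains (e : nat -> (seq T -> K) -> K) :
  ~ cyclic_chains q h coherent m e.
Proof.
move=> ce.
have key i : (i <= m)%N -> exists2 g, alternating_on coherent g &
    e i (tau i.+1 g) = 1 /\
    forall s, size s = i.+2 -> coherent s -> cobound (tau i.+1 g) s = 0.
  elim: i => [_|i IH im].
    pose g s : K := if s is [:: x] then x.2 else 0; exists g.
      by split=> [[|? [|? ?]]|[|? [|? ?]]] //= *; rewrite oppr0.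
    have g1 x : tau 1 g [:: x] = 1 by rewrite /periodic /= addrC addKr.
    split; first by have [x ex] := chain_vertex ce; rewrite ex.
    case=> [|x [|y []]] // _ _.
    have -> : cobound (tau 1 g) [:: x; y] = tau 1 g [:: y] - (tau 1 g [:: x] - 0) by [].
    by rewrite !g1 subr0 subrr.
  have [g ag [eg dg]] := IH (ltnW im).
  (* [cobound g] still pairs to 1, and [periodic i.+1] kills it. *)
  have acg := alternating_cobound coherent_hered ag.
  have [|g' ag' g'E] := @periodic_solve i.+1 (cobound g) i.+1 acg.
    by move=> s si cs; rewrite -cobound_periodic dg.
  exists g' => //; split.
    rewrite -eg -[RHS](chain_boundary ce) //.
    by apply: (chain_support ce).
  move=> s si cs; rewrite -[RHS](coboundK g s); apply: cobound_faces => t ts st.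
  by apply: g'E; [apply/eqP; rewrite -eqSS -st si|exact: coherent_hered ts cs].
have [g ag [eg _]] := key m (leqnn m).
have : e m (tau m.+1 g) = 0.
  apply: (chain0 ce) => // s sm cs.
  have g0 t : size t = m.+1 -> coherent t -> g t = 0.
    by move=> tm ct; apply: alternating_dim => //; rewrite tm.
  rewrite (@eq_periodic _ _ q h m.+1 g (fun=> 0)) => [|j].
    by rewrite /periodic; case: ifP; rewrite ?subrr // big1.
  by apply: g0; [rewrite size_map|exact: coherent_iter].
by rewrite eg => /eqP; rewrite oner_eq0.
Qed.

End labels.

(** * Torsion in compact Lie groups *)

Section near_identity.
Context {R : realType}.

Lemma row_norm_le n (x : 'rV[R]_n) (r : R) : 0 <= r ->
  (forall i, `|x 0 i| <= r) -> `|x| <= r.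
Proof.
move=> r0 xr; rewrite [leLHS]/Num.Def.normr/= mx_normrE (bigmax_le _ r0) //=.
by case=> i j _; rewrite ord1.
Qed.

Lemma row_coord_le n (x : 'rV[R]_n) i : `|x 0 i| <= `|x|.
Proof.
by rewrite [leRHS]/Num.Def.normr/= mx_normrE; exact: (le_bigmax _ _ (0, i)).
Qed.

Lemma mean_value_ge0 (V : normedModType R) n (F : V -> 'rV[R]_n) p v w (b s : R) :
  0 <= s ->
  (forall t, 0 <= t <= s ->
     derivable F (p + t *: v) v /\ `|'D_v F (p + t *: v) - w| <= b) ->
  `|F (p + s *: v) - F p - s *: w| <= b * s.
Proof.
move=> s0 dF; have b0 : 0 <= b.
  by apply: le_trans (normr_ge0 _) (dF 0 _).2; rewrite lexx.
apply: row_norm_le => [|i]; first exact: mulr_ge0.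
pose g t := F (p + t *: v) 0 i.
have dg (t : R) : 0 <= t <= s -> is_derive t 1 g ('D_v F (p + t *: v) 0 i).
  move=> ts; have [dFt _] := dF t ts.
  have dFi := (derivable_mxP F _ v).1 dFt 0 i.
  have eq_g : (fun h : R => h^-1 *: (g (h *: 1 + t) - g t)) =
      (fun h => h^-1 *: (F (h *: v + (p + t *: v)) 0 i - F (p + t *: v) 0 i)).
    apply/funext => h; congr (_ *: (F _ 0 i - _)).
    by rewrite /= [h *: 1]mulr1 scalerDl addrCA.
  apply: DeriveDef; first by rewrite /derivable /= eq_g.
  by rewrite (derive_mx dFt) mxE /derive /= eq_g.
have [t||c cs gE] := @MVT_segment R g (fun t => 'D_v F (p + t *: v) 0 i) 0 s s0.
- by rewrite in_itv /= => /andP[t0 ts]; apply: dg; rewrite !ltW.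
- apply: derivable_within_continuous => t ts.
  by have [] := dg t; rewrite ?(itvP ts).
have -> : (F (p + s *: v) - F p - s *: w) 0 i = (('D_v F (p + c *: v) - w) 0 i) * s.
  rewrite !mxE mulrBl; congr (_ - _); last by rewrite mulrC.
  by rewrite subr0 in gE; rewrite -gE /g scale0r addr0.
rewrite normrM (ger0_norm s0) ler_wpM2r // (le_trans (row_coord_le _ i)) //.
by apply: (dF c _).2; rewrite !(itvP cs).
Qed.

Lemma mean_value (V : normedModType R) n (F : V -> 'rV[R]_n) p v w (b s : R) :
  (forall t, Num.min 0 s <= t <= Num.max 0 s ->
     derivable F (p + t *: v) v /\ `|'D_v F (p + t *: v) - w| <= b) ->
  `|F (p + s *: v) - F p - s *: w| <= b * `|s|.
Proof.
have [s0|s0] := leP 0 s => dF.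
  by rewrite ger0_norm //; exact: mean_value_ge0.
rewrite ltr0_norm //.
have -> : F (p + s *: v) - F p - s *: w =
    - (F ((p + s *: v) + (- s) *: v) - F (p + s *: v) - (- s) *: w).
  by rewrite !scaleNr addrK opprK !opprD opprK [X in X - _]addrC.
rewrite normrN; apply: mean_value_ge0; first by rewrite oppr_ge0 ltW.
move=> t /andP[t0 ts]; rewrite -addrA -scalerDl; apply: dF.
by rewrite lerDl t0 -lerBrDl sub0r ts.
Qed.

(** A map whose partial derivatives are close to those of the identity differs
    from the identity by a small Lipschitz map: change one coordinate at a
    time. *)
Lemma near_identity d (F : 'rV[R]_d -> 'rV[R]_d) (a : 'rV[R]_d) (r b : R) :
  (forall x i, `|x - a| <= r -> derivable F x (delta_mx 0 i) /\
     `|'D_(delta_mx 0 i) F x - delta_mx 0 i| <= b) ->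
  forall x y, `|x - a| <= r -> `|y - a| <= r ->
    `|F x - F y - (x - y)| <= (b * `|x - y|) *+ d.
Proof.
move=> dF x y xr yr; have r0 : 0 <= r by exact: le_trans (normr_ge0 _) xr.
pose z k : 'rV[R]_d := \row_i (if (i < k)%N then x 0 i else y 0 i).
have z0 : z 0%N = y by apply/rowP => i; rewrite mxE.
have zd : z d = x by apply/rowP => i; rewrite mxE ltn_ord.
have zS (k : 'I_d) : z k.+1 = z k + (x - y) 0 k *: delta_mx 0 k.
  apply/rowP => i; rewrite !mxE eqxx /= ltnS leq_eqVlt -val_eqE.
  by case: eqP => [/val_inj ->|_] /=; rewrite ?ltnn ?mulr1 ?subrKC // mulr0 addr0.
(* [z k] has the first [k] coordinates of [x] and the other ones of [y]. *)
have -> : F x - F y - (x - y) =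
    \sum_(k < d) (F (z k.+1) - F (z k) - (x - y) 0 k *: delta_mx 0 k).
  rewrite sumrB -row_sum_delta; congr (_ - _).
  rewrite -(big_mkord xpredT (fun k => F (z k.+1) - F (z k))).
  by rewrite telescope_sumr // z0 zd.
rewrite (le_trans (ler_norm_sum _ _ _)) //.
rewrite -[X in _ *+ X]card_ord -sumr_const; apply: ler_sum => k _.
rewrite zS (@le_trans _ _ (b * `|(x - y) 0 k|)) //; last first.
  rewrite ler_wpM2l ?row_coord_le //.
  by apply: le_trans (normr_ge0 _) (dF x k xr).2.
apply: mean_value => t /andP[t1 t2]; apply: dF.
apply: row_norm_le => // i; rewrite !mxE.
have xi : `|x 0 i - a 0 i| <= r.
  by rewrite (le_trans _ xr) // (le_trans _ (row_coord_le _ i)) // !mxE.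
have yi : `|y 0 i - a 0 i| <= r.
  by rewrite (le_trans _ yr) // (le_trans _ (row_coord_le _ i)) // !mxE.
rewrite eqxx /=; case: eqVneq => [ik|_]; last by rewrite mulr0 addr0; case: ifP.
move: t1 t2; rewrite -ik !mxE ltnn mulr1.
move: xi yi; rewrite !ler_norml => /andP[x1 x2] /andP[y1 y2].
rewrite ge_min le_max => /orP[t1|t1] /orP[t2|t2]; apply/andP; split;
  rewrite ?(lerBrDr, lerBlDr); lra.
Qed.

End near_identity.

(** Coordinates near the unit of a topological group in which the product is
    the addition, up to a Lipschitz error of constant 1/8. *)
Record additive_coordinates (R : realType) (G : compactGroupType) d
    (phi : G -> 'rV[R]_d) (dom : set G) (r : R) : Prop := {
  coord_r : 0 < r;
  coord_dom1 : dom 1%g;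
  coord1 : phi 1%g = 0;
  coord_inj : forall g h, dom g -> dom h -> phi g = phi h -> g = h;
  coord_surj : forall v, `|v| <= r -> exists2 g, dom g & phi g = v;
  coord_nbhs : forall s, 0 < s -> nbhs 1%g [set g | dom g /\ `|phi g| <= s];
  coord_small : forall N : set G, nbhs 1%g N ->
    exists2 s, 0 < s & forall g, dom g -> `|phi g| <= s -> N g;
  coord_domM : forall g h, dom g -> dom h -> `|phi g| <= r -> `|phi h| <= r ->
    dom (g * h)%g;
  coord_mul : forall g h g' h', dom g -> dom h -> dom g' -> dom h' ->
    `|phi g| <= r -> `|phi h| <= r -> `|phi g'| <= r -> `|phi h'| <= r ->
    `|(phi (g * h)%g - phi g - phi h) - (phi (g' * h')%g - phi g' - phi h')| <=
      (`|phi g - phi g'| + `|phi h - phi h'|) / 8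
}.

Lemma scale_pair0r (R : realType) (V : lmodType R) h (v x y : V) :
  h *: ((v, 0) : V * V) + (x, y) = (h *: v + x, y).
Proof. by congr (_, _); rewrite -[RHS]add0r; congr (_ + _); exact: scaler0. Qed.

Lemma scale_pair0l (R : realType) (V : lmodType R) h (v x y : V) :
  h *: ((0, v) : V * V) + (x, y) = (x, h *: v + y).
Proof. by congr (_, _); rewrite -[RHS]add0r; congr (_ + _); exact: scaler0. Qed.

Section lie_coordinates.
Context {R : realType} {G : compactGroupType}.

(** In a chart, the partial derivatives of the product at the unit are those of
    the addition, since multiplying by the unit changes nothing. They are
    continuous, so they stay close to those of the addition nearby. *)
Lemma lie_coordinates : is_lie_group R G ->
  exists d (phi : G -> 'rV[R]_d) dom r, additive_coordinates phi dom r.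
Proof.
move=> [d [At [[cover _] _ smoothM]]]; have [c Atc c1] := cover 1%g.
exists d; set a := chart_map c 1%g; pose V := 'rV[R]_d.
have inva : chart_inv c a = 1%g by apply: chart_mapK; exact: mem_set.
pose im : set V := chart_map c @` chart_dom c.
have imK v : im v -> chart_dom c (chart_inv c v) /\ chart_map c (chart_inv c v) = v.
  by move=> [g dg <-]; rewrite chart_mapK //; exact: mem_set.
have ima : im a by exists 1%g.
have [] := smoothM c c c Atc Atc Atc.
set W := [set p | _]; set F : V * V -> V := fun p => _; move=> oW /(_ 1%N) C1.
have F1 x : im x -> F (x, a) = x by move=> /imK[_ xK]; rewrite /F /= inva mulg1.
have F2 x : im x -> F (a, x) = x by move=> /imK[_ xK]; rewrite /F /= inva mul1g.
have Wa : W (a, a) by split=> //=; rewrite !inva mulg1.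
pose e i : V := delta_mx 0 i.
have near_im (v : V) : \forall h \near (0 : R), im (h *: v + a).
  have cf : (fun h : R => h *: v + a) h @[h --> 0] --> (0 : R) *: v + a.
    by apply: cvgD; [apply: cvgZr_tmp; exact: cvg_id|exact: cvg_cst].
  apply: cf; rewrite scale0r add0r; apply: open_nbhs_nbhs; split=> //.
  exact: chart_im_open.
have D1 i : 'D_((e i, 0) : V * V) F (a, a) = e i.
  apply/cvg_lim => //; apply: cvg_near_cst.
  have : \forall h \near 0^', im (h *: e i + a) by apply: cvg_within; exact: near_im.
  have : \forall h \near 0^', h != 0 :> R by exact: nbhs_dnbhs_neq.
  apply: filterS2 => h h0 imh.
  rewrite /= scale_pair0r.
  by rewrite !F1 // addrK scalerA mulVf // scale1r.
have D2 i : 'D_((0, e i) : V * V) F (a, a) = e i.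
  apply/cvg_lim => //; apply: cvg_near_cst.
  have : \forall h \near 0^', im (h *: e i + a) by apply: cvg_within; exact: near_im.
  have : \forall h \near 0^', h != 0 :> R by exact: nbhs_dnbhs_neq.
  apply: filterS2 => h h0 imh.
  rewrite /= scale_pair0l.
  by rewrite !F2 // addrK scalerA mulVf // scale1r.
(* The errors along the [d] coordinates add up to at most 1/8. *)
pose b : R := (8 * d.+1%:R)^-1.
have b0 : 0 < b by rewrite invr_gt0 mulr_gt0.
have nearD (v : V * V) (w : V) : 'D_v F (a, a) = w ->
    \forall p \near ((a, a) : V * V), `|'D_v F p - w| <= b.
  move=> <-; have /cvgrPdist_le/(_ _ b0) := (C1 v).2 _ Wa.
  by apply: filterS => p; rewrite distrC.
have : \forall p \near ((a, a) : V * V), [/\ W p, im p.1 &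
    forall i, `|'D_((e i, 0) : V * V) F p - e i| <= b /\
              `|'D_((0, e i) : V * V) F p - e i| <= b].
  near=> p; split.
  - by near: p; exact: open_nbhs_nbhs.
  - near: p; apply: (cvg_fst (F := nbhs a) (G := nbhs a)).
    by apply: open_nbhs_nbhs; split=> //; exact: chart_im_open.
  - by near: p; apply: filter_forall => i; apply: filterI (nearD _ _ (D1 i)) (nearD _ _ (D2 i)).
move=> /nbhs_ballP[r' /= r'0 ballr].
pose r := r' / 2; have r0 : 0 < r by rewrite divr_gt0.
have rr' : r < r' by rewrite ltr_pdivrMr // ltr_pMr // ltr1n.
have box (x y : V) : `|x - a| <= r -> `|y - a| <= r -> [/\ W (x, y), im x &
    forall i, `|'D_((e i, 0) : V * V) F (x, y) - e i| <= b /\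
              `|'D_((0, e i) : V * V) F (x, y) - e i| <= b].
  move=> xr yr; apply: (ballr (x, y)).
  by split; rewrite -ball_normE /= distrC; exact: le_lt_trans rr'.
have bd (t : R) : 0 <= t -> (b * t) *+ d <= t / 8.
  move=> t0; rewrite -mulr_natr mulrAC [leRHS]mulrC ler_wpM2r //.
  rewrite /b invfM -mulrA ler_piMr ?invr_ge0 // mulrC ler_pdivrMr // mul1r.
  by rewrite ler_nat.
have Lip1 (x x' y : V) : `|x - a| <= r -> `|x' - a| <= r -> `|y - a| <= r ->
    `|F (x, y) - F (x', y) - (x - x')| <= `|x - x'| / 8.
  move=> xr xr' yr; apply: le_trans (bd _ (normr_ge0 _)).
  apply: (@near_identity _ _ (fun x => F (x, y)) a r b) => // z i zr.
  have [Wz _ Dz] := box z y zr yr.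
  have eqd : (fun h : R => h^-1 *: (F (h *: delta_mx 0 i + z, y) - F (z, y))) =
      (fun h => h^-1 *: (F (h *: ((e i, 0) : V * V) + (z, y)) - F (z, y))).
    by apply/funext => h; rewrite scale_pair0r.
  rewrite /derivable /derive /= eqd; split; last exact: (Dz i).1.
  exact: (C1 _).1.
have Lip2 (x y y' : V) : `|x - a| <= r -> `|y - a| <= r -> `|y' - a| <= r ->
    `|F (x, y) - F (x, y') - (y - y')| <= `|y - y'| / 8.
  move=> xr yr yr'; apply: le_trans (bd _ (normr_ge0 _)).
  apply: (@near_identity _ _ (fun y => F (x, y)) a r b) => // z i zr.
  have [Wz _ Dz] := box x z xr zr.
  have eqd : (fun h : R => h^-1 *: (F (x, h *: delta_mx 0 i + z) - F (x, z))) =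
      (fun h => h^-1 *: (F (h *: ((0, e i) : V * V) + (x, z)) - F (x, z))).
    by apply/funext => h; rewrite scale_pair0l.
  rewrite /derivable /derive /= eqd; split; last exact: (Dz i).2.
  exact: (C1 _).1.
pose phi g := chart_map c g - a.
have FM g h : chart_dom c g -> chart_dom c h ->
    F (chart_map c g, chart_map c h) = chart_map c (g * h)%g.
  by move=> dg dh; rewrite /F /= !chart_mapK //; exact: mem_set.
exists phi, (chart_dom c), r; split=> //.
- by rewrite /phi subrr.
- move=> g h dg dh /addIr /(congr1 (chart_inv c)).
  by rewrite !chart_mapK //; exact: mem_set.
- move=> v vr; have [||_ [g dg gv] _] := box (v + a) a.
  + by rewrite addrK.
  + by rewrite subrr normr0 ltW.
  by exists g => //; rewrite /phi gv addrK.
- move=> s s0.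
  have := chart_map_continuous (c := c).
  rewrite (continuous_open_subspace _ (chart_dom_open c)) => /(_ 1%g (mem_set c1)).
  move=> /cvgrPdist_le/(_ _ s0); have : nbhs 1%g (chart_dom c).
    by apply: open_nbhs_nbhs; split; [exact: chart_dom_open|exact: c1].
  by apply: filterS2 => g dg; rewrite distrC.
- move=> N N1.
  have := @chart_inv_continuous _ _ _ c.
  rewrite (continuous_open_subspace _ (@chart_im_open _ _ _ c)) => /(_ a (mem_set ima)).
  rewrite /continuous_at inva => h; have /nbhs_ballP[s /= s0 sN] := h N N1.
  exists (s / 2); first by rewrite divr_gt0.
  move=> g dg gs; rewrite -(chart_mapK (mem_set dg)); apply: sN.
  rewrite -ball_normE /= distrC (le_lt_trans gs) //.
  by rewrite ltr_pdivrMr // ltr_pMr // ltr1n.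
- move=> g h dg dh gr hr; have [[_ _]] := box _ _ gr hr.
  by rewrite /= !chart_mapK //; exact: mem_set.
- move=> g h g' h' dg dh dg' dh' gr hr gr' hr'.
  rewrite /phi -!FM //; set x := chart_map c g; set y := chart_map c h.
  set x' := chart_map c g'; set y' := chart_map c h'.
  have -> : F (x, y) - a - (x - a) - (y - a) - (F (x', y') - a - (x' - a) - (y' - a)) =
      (F (x, y) - F (x', y) - (x - x')) + (F (x', y) - F (x', y') - (y - y')).
    by apply/rowP => i; rewrite !mxE; ring.
  have -> : x - a - (x' - a) = x - x' by apply/rowP => i; rewrite !mxE; ring.
  have -> : y - a - (y' - a) = y - y' by apply/rowP => i; rewrite !mxE; ring.
  rewrite (le_trans (ler_normD _ _)) // mulrDl lerD //; [exact: Lip1|exact: Lip2].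
Unshelve. all: by end_near.
Qed.

End lie_coordinates.

HB.instance Definition _ (R : realType) d := Complete.on 'rV[R]_d.

Section small_roots.
Context {R : realType} {G : compactGroupType} {d : nat}.
Context {phi : G -> 'rV[R]_d} {dom : set G} {r : R}.
Hypothesis C : additive_coordinates phi dom r.

Let D (s : R) (g : G) := dom g /\ `|phi g| <= s.

Let r_gt0 : 0 < r. Proof. exact: coord_r C. Qed.

Let D1 s : 0 <= s -> D s 1%g.
Proof. by move=> s0; split; [exact: coord_dom1 C|rewrite (coord1 C) normr0]. Qed.

Lemma coord_mulr g h : D r g -> D r h ->
  dom (g * h)%g /\ `|phi (g * h)%g - phi g - phi h| <= `|phi h| / 8.
Proof.
move=> [dg gr] [dh hr]; split; first exact: (coord_domM C).
have [d1 r1] := D1 (ltW r_gt0).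
have := coord_mul C dg dh dg d1 gr hr gr r1.
by rewrite mulg1 (coord1 C) !subrr !subr0 normr0 add0r.
Qed.

Lemma square_root_unique g h : D r g -> D r h -> (g * g = h * h)%g -> g = h.
Proof.
move=> [dg gr] [dh hr] gh; apply: (coord_inj C) => //.
have := coord_mul C dg dg dh dh gr gr hr hr; rewrite gh.
have -> : phi (h * h)%g - phi g - phi g - (phi (h * h)%g - phi h - phi h) =
    - (phi g - phi h) *+ 2.
  by rewrite mulr2n; apply/rowP => i; rewrite !mxE; ring.
rewrite normrMn normrN -mulr2n => le2; apply/eqP; rewrite -subr_eq0 -normr_eq0.
by rewrite eq_le normr_ge0 andbT; lra.
Qed.

(** In coordinates, a square root of [v] is a fixed point of the contraction
    [x |-> (v - E x) / 2], where [E] is the difference between squaring and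
    doubling. *)
Lemma square_root_exists u : D r u -> exists2 g, D r g & (g * g = u)%g.
Proof.
move=> [du ur]; pose V := 'rV[R]_d.
have /choice[psi psiP] (v : V) : exists g, `|v| <= r -> dom g /\ phi g = v.
  have [/(coord_surj C)[g dg gv]|] := boolP (`|v| <= r); first by exists g.
  by exists 1%g.
pose U : set V := [set v | `|v| <= r].
pose f (x : V) : V := 2^-1 *: (phi u - (phi (psi x * psi x)%g - x - x)).
have lip x y : U x -> U y -> `|f x - f y| <= (1 / 8) * `|x - y|.
  move=> Ux Uy; have [[dx ex] [dy ey]] := (psiP x Ux, psiP y Uy).
  have := coord_mul C dx dx dy dy; rewrite ex ey => /(_ Ux Ux Uy Uy).
  rewrite /f -scalerBr normrZ gtr0_norm // => le.
  rewrite (_ : phi u - _ - (phi u - _) =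
    - (phi (psi x * psi x)%g - x - x - (phi (psi y * psi y)%g - y - y))); last first.
    by apply/rowP => i; rewrite !mxE; ring.
  by rewrite normrN; lra.
have psi0 : psi 0 = 1%g.
  have [|d0 e0] := psiP 0; first by rewrite normr0 ltW.
  by apply: (coord_inj C); rewrite ?(coord1 C) //; exact: coord_dom1 C.
have fU : set_fun U U f.
  move=> x Ux; have U0 : U 0 by rewrite /U /= normr0 ltW.
  have := lip x 0 Ux U0; rewrite subr0.
  have -> : f 0 = 2^-1 *: phi u.
    by rewrite /f psi0 mulg1 (coord1 C) !subr0.
  move=> le; rewrite /U /= -(subrK (2^-1 *: phi u) (f x)).
  rewrite (le_trans (ler_normD _ _)) // normrZ gtr0_norm //.
  have {}Ux : `|x| <= r by [].
  by move: r_gt0 Ux ur le; lra.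
have q0 : (0 : R) <= 1 / 8 by [].
have [|||x Ux fx] := @banach_fixed_point R 'rV[R]_d U (mkfun_fun fU).
- exists (NngNum q0); split=> /=; first lra.
  by case=> x y [Ux Uy]; exact: lip.
- have -> : U = (fun x : V => `|x|) @^-1` [set y | y <= r] by [].
  by apply: closed_comp; [move=> x _; exact: norm_continuous|exact: closed_le].
- by exists 0; rewrite /U /= normr0 ltW.
have [dx ex] := psiP x Ux; exists (psi x); first by split; rewrite ?ex.
have xr : D r (psi x) by split; rewrite ?ex.
apply: (coord_inj C) => //; first exact: (coord_mulr xr xr).1.
have {}fx : x = f x by [].
have e2 : x + x = phi u - (phi (psi x * psi x)%g - x - x).
  have -> : x + x = 2 *: x by rewrite scaler_nat.
  by rewrite {1}fx /f scalerA divff // scale1r.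
apply/eqP; rewrite eq_sym -subr_eq0; apply/eqP.
have -> : phi u - phi (psi x * psi x)%g = phi u - (phi (psi x * psi x)%g - x - x) - (x + x).
  by apply/rowP => i; rewrite !mxE; ring.
by rewrite -e2 subrr.
Qed.

(** Roots of [u] of order [2 ^ n], obtained by repeated square roots. The powers
    of such a root, up to [u], stay near the segment from 0 to [u]. Indeed a rough
    bound keeps the powers of the next root in the domain of the coordinates;
    there products are almost sums, which bounds the root by [s] over [2 ^ n.+1],
    up to a constant, and then its powers by [3 * s] again. By uniqueness of square
    roots, the roots commute with whatever commutes with [u]. *)
Lemma dyadic_root (s : R) (u h : G) : 0 <= s -> 7 * s <= r ->
  (forall g, D (3 * s) g -> D r (h * g * h^-1)%g) ->
  D s u -> (h * u = u * h)%g ->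
  forall n, exists x, [/\ (x ^+ (2 ^ n))%g = u, (h * x = x * h)%g,
    `|phi x| * (2 ^ n)%:R <= 2 * s &
    forall k, (k <= 2 ^ n)%N -> D (3 * s) (x ^+ k)%g].
Proof.
move=> s0 sr hD [du us] hu; elim=> [|n [x [xu hx _ xD]]].
  exists u; rewrite expn0 mulr1; split=> //; first by lra.
  case=> [|[|//]] _; first by apply: D1; lra.
  by split=> //; lra.
have n0 : (0 < 2 ^ n)%N by rewrite expn_gt0.
move eN : (2 ^ n.+1)%N => N.
have [dx xs] : D (3 * s) x by have := xD 1%N n0; rewrite expg1.
have rx : D r x by split=> //; lra.
have [y [dy ry] yx] := square_root_exists rx.
have [_ le_y] := coord_mulr (conj dy ry) (conj dy ry).
have ys : `|phi y| <= 3 * s.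
  have : `|phi y *+ 2| <= `|phi x| + `|phi y| / 8.
    rewrite (le_trans _ (lerD (lexx _) le_y)) // yx.
    apply: le_trans (ler_normB _ _).
    rewrite le_eqVlt; apply/orP; left; apply/eqP; congr `|_|.
    by rewrite mulr2n; apply/rowP => i; rewrite !mxE; ring.
  by rewrite normrMn; move: xs s0; lra.
(* An odd power of [y] is one more factor [y] away from a power of [x]: its norm
   is at most [3 * s + 3 * s + 3 / 8 * s], whence the constant 7. *)
have yD k : (k <= N)%N -> D r (y ^+ k)%g.
  move=> k2; have Dx i : (i <= 2 ^ n)%N -> D (3 * s) (y ^+ i.*2)%g.
    by move=> /xD; rewrite -yx -expg2 -expgnA mul2n.
  rewrite -(odd_double_half k); case ok : (odd k); last first.
    rewrite add0n; have [|dk kr] := Dx k./2.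
      by rewrite -(doubleK (2 ^ n)%N) -mul2n -expnS half_leq // eN.
    by split=> //; lra.
  have [|dk kr] := Dx k./2.
    by rewrite -(doubleK (2 ^ n)%N) -mul2n -expnS half_leq // eN.
  have rk : D r (y ^+ k./2.*2)%g by split=> //; lra.
  have [dm le] := coord_mulr rk (conj dy ry).
  rewrite add1n expgSr; split=> //.
  set z := phi _ in le *.
  have -> : z = (z - phi (y ^+ k./2.*2)%g - phi y) + (phi (y ^+ k./2.*2)%g + phi y).
    by apply/rowP => i; rewrite !mxE; ring.
  rewrite (le_trans (ler_normD _ _)) //.
  have := ler_normD (phi (y ^+ k./2.*2)%g) (phi y); lra.
have lin k : (k <= N)%N ->
    `|phi (y ^+ k)%g - phi y *+ k| <= (`|phi y| / 8) *+ k.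
  elim: k => [_|k IH k2]; first by rewrite (coord1 C) subrr normr0.
  have [_ le] := coord_mulr (yD k (ltnW k2)) (conj dy ry).
  rewrite expgSr; have -> : phi (y ^+ k * y)%g - phi y *+ k.+1 =
      (phi (y ^+ k)%g - phi y *+ k) + (phi (y ^+ k * y)%g - phi (y ^+ k)%g - phi y).
    by rewrite mulrS; apply/rowP => i; rewrite !mxE; ring.
  rewrite (le_trans (ler_normD _ _)) // mulrSr lerD //.
  exact: IH (ltnW k2).
have yu : (y ^+ N)%g = u by rewrite -eN expnS expgnA expg2 yx.
have y2 : `|phi y| * N%:R <= 8 / 7 * s.
  have le1 := lin _ (leqnn N); have le2 := lerB_dist (phi y *+ N) (phi u).
  rewrite yu distrC -[X in _ <= X]mulr_natr in le1.
  by rewrite normrMn -mulr_natr in le2; move: us le1 le2; lra.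
exists y; split=> //.
- have hyD : D r (h * y * h^-1)%g by apply: hD.
  have : (h * y * h^-1 = y)%g.
    apply: square_root_unique => //.
    by rewrite -!mulgA mulKg !mulgA -(mulgA h) yx hx mulgK.
  by move=> {2}<-; rewrite mulgVK.
- by lra.
- move=> k k2; split; first exact: (yD k k2).1.
  have le1 := lin k k2; have le2 := ler_normD (phi (y ^+ k)%g - phi y *+ k) (phi y *+ k).
  rewrite -[X in _ <= X]mulr_natr in le1; rewrite subrK normrMn -(mulr_natr `|_|) in le2.
  have : `|phi y| * k%:R <= `|phi y| * N%:R by rewrite ler_wpM2l // ler_nat.
  by lra.
Qed.

End small_roots.

Section topological_group.
Context {G : compactGroupType}.

Lemma continuous_mulg (T : topologicalType) (f g : T -> G) :
  continuous f -> continuous g -> continuous (fun x => f x * g x)%g.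
Proof.
move=> cf cg x; apply: (continuous_comp (f := fun x => (f x, g x))
  (g := fun p : G * G => (p.1 * p.2)%g)); last exact: mulg_continuous.
by apply: cvg_pair; [exact: cf|exact: cg].
Qed.

Lemma continuous_invg (T : topologicalType) (f : T -> G) :
  continuous f -> continuous (fun x => (f x)^-1)%g.
Proof.
by move=> cf x; apply: continuous_comp; [exact: cf|exact: invg_continuous].
Qed.

Lemma continuous_expg n : continuous (fun x : G => x ^+ n)%g.
Proof.
elim: n => [|n IH]; first by move=> x; exact: cvg_cst.
rewrite (_ : (fun x => _) = (fun x : G => x * x ^+ n)%g); last first.
  by apply/funext => x; rewrite expgS.
by apply: continuous_mulg => // x; exact: cvg_id.
Qed.

(** The powers of [h] have a cluster point, so that two of them are close. *)
Lemma recurrence (h : G) (N : set G) : nbhs 1%g N ->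
  exists2 k, (0 < k)%N & N (h ^+ k)%g.
Proof.
move=> N1; have [z [_ zh]] : [set: G] `&` cluster ((h ^+ n)%g @[n --> \oo]) !=set0.
  by apply: (@compactT G); exact: filterT.
have cdiv : continuous (fun p : G * G => p.1 * p.2^-1)%g.
  apply: continuous_mulg => [p|]; first exact: cvg_fst.
  by apply: continuous_invg => p; exact: cvg_snd.
have := cdiv (z, z) N; rewrite /= mulgV => /(_ N1)[[A B] [/= Az Bz] AB].
have near_z (i : nat) C : nbhs z C -> exists2 n, (i < n)%N & C (h ^+ n)%g.
  move=> Cz; have [|_ [[n ni <-] Cn]] := zh [set (h ^+ n)%g | n in [set n | (i < n)%N]] C _ Cz.
    by exists i.+1 => // n /= ni; exists n.
  by exists n.
have [i _ Bi] := near_z 0%N B Bz; have [j ij Aj] := near_z i A Az.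
exists (j - i)%N; first by rewrite subn_gt0.
by rewrite expgnFr ?(ltnW ij) //; exact: (AB (_, _)).
Qed.

End topological_group.

(** If [h ^+ k] is small, let [w] be a limit of powers of its roots of orders
    [2 ^ n], with exponents close to [2 ^ n / k]. Then [w] is small,
    [w ^+ k = h ^+ k], and [w] commutes with [h]. Hence [h * w^-1] is torsion,
    and it is not 1 as soon as [w] is too small to be [h]. *)
Theorem lie_torsion (R : realType) (G : compactGroupType) :
  is_lie_group R G -> (exists g : G, g <> 1%g) ->
  exists (t : G) (k : nat), [/\ (0 < k)%N, t <> 1%g & (t ^+ k = 1)%g].
Proof.
move=> /lie_coordinates[d [phi [dom [r C]]]] [h h1].
pose D (s : R) (g : G) := dom g /\ `|phi g| <= s.
have [[A B] [/= /set_mem A1 /set_mem Bh] [oA oB AB0]] : exists2 AB : set G * set G,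
    1%g \in AB.1 /\ h \in AB.2 & [/\ open AB.1, open AB.2 & AB.1 `&` AB.2 == set0].
  by have := @hausdorffT G; rewrite open_hausdorff; apply; apply/eqP => /esym.
have [sA sA0 DA] := coord_small C (open_nbhs_nbhs (conj oA A1)).
have [sh sh0 Dh] : exists2 s, 0 < s & forall g, dom g -> `|phi g| <= s ->
    D r (h * g * h^-1)%g.
  apply: (coord_small C).
  have cj : continuous (fun g : G => h * g * h^-1)%g.
    apply: continuous_mulg => [|x]; last exact: cvg_cst.
    by apply: continuous_mulg => x; [exact: cvg_cst|exact: cvg_id].
  apply: (cj 1%g); rewrite mulg1 mulgV; exact: coord_nbhs C _ (coord_r C).
(* [D (3 * s)] avoids [h], and its conjugate by [h] has square roots. *)
pose s := Num.min (Num.min sA sh) r / 7.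
have s0 : 0 < s by rewrite divr_gt0 // !lt_min sA0 sh0 (coord_r C).
have [sA7 sh7 sr] : [/\ 7 * s <= sA, 7 * s <= sh & 7 * s <= r].
  by rewrite /s mulrC divfK //; split; rewrite ?ge_min ?lexx ?orbT.
have [k k0 [du us]] := recurrence h (coord_nbhs C s0).
set u := (h ^+ k)%g in du us.
have hu : (h * u = u * h)%g by exact/commuteX.
have hD g : D (3 * s) g -> D r (h * g * h^-1)%g.
  by move=> [dg gs]; apply: Dh => //; rewrite (le_trans gs) //; lra.
have /choice[x xP] := dyadic_root C (ltW s0) sr hD (conj du us) hu.
pose w_ n := (x n ^+ (2 ^ n %/ k))%g.
have [w [_ wF]] : [set: G] `&` cluster (w_ @ \oo) !=set0.
  by apply: (@compactT G); exact: filterT.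
have clusterW (P : set G) : closed P -> (forall n, P (w_ n)) -> P w.
  move=> cP Pw; apply: cP => V Vw; apply: wF Vw.
  by exists 0%N => // n _; exact: Pw.
exists (h * w^-1)%g, k; split=> //.
  move=> hw; have Bw : nbhs w B.
    by apply: open_nbhs_nbhs; split=> //; rewrite -(mul1g w) -hw mulgVK.
  have [|g [Ag Bg]] := wF A B _ Bw; last by have : set0 g by rewrite -(eqP AB0).
  exists 0%N => // n _; have [_ _ _ /(_ (2 ^ n %/ k)%N (leq_div _ _))[dw ws]] := xP n.
  by apply: DA => //; rewrite (le_trans ws) //; lra.
have hw : (h * w = w * h)%g.
  apply: (clusterW [set g | (h * g = g * h)%g]) => [|n]; last first.
    by have [_ hx _ _] := xP n; exact/commuteX.
  have cc : continuous (fun g : G => g^-1 * (h * g))%g.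
    apply: continuous_mulg => [|].
      by apply: continuous_invg => y; exact: cvg_id.
    by apply: continuous_mulg => y; [exact: cvg_cst|exact: cvg_id].
  rewrite (_ : [set _ | _] = (fun g : G => g^-1 * (h * g))%g @^-1` [set h]).
    apply: closed_comp => [y _|]; first exact: cc.
    by apply: accessible_closed_set1; apply: hausdorff_accessible; exact: hausdorffT.
  apply/seteqP; split=> y /=; first by move=> ->; rewrite mulKg.
  by move=> yh; rewrite -{2}yh mulVKg.
suff wk : (w ^+ k = u)%g by rewrite expgnFl ?wk ?mulgV.
apply: contrapT => wku.
have [[P Q] [/= /set_mem Pw /set_mem Qu] [oP oQ PQ0]] : exists2 AB : set G * set G,
    (w ^+ k)%g \in AB.1 /\ u \in AB.2 & [/\ open AB.1, open AB.2 & AB.1 `&` AB.2 == set0].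
  by have := @hausdorffT G; rewrite open_hausdorff; apply; exact/eqP.
pose N : set G := [set y | forall j : 'I_k, Q (u * (y ^+ j)^-1)%g].
have N1 : nbhs 1%g N.
  apply: filter_forall => j.
  have cq : continuous (fun y : G => u * (y ^+ j)^-1)%g.
    apply: continuous_mulg => [y|]; first exact: cvg_cst.
    by apply: continuous_invg; exact: continuous_expg.
  apply: (cq 1%g); rewrite /= expg1n invg1 mulg1; exact: open_nbhs_nbhs.
have [e e0 eN] := coord_small C N1.
(* The roots [x n] converge to 1, and [w_ n ^+ k] differs from [u] by one of the
   first [k] powers of [x n]. *)
pose M := Num.bound (2 * s / e).
have [||g [[n nM <-] Pg]] := wF (w_ @` [set n | (M <= n)%N]) [set g | P (g ^+ k)%g].
- by exists M => // n /= Mn; exists n.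
- exact: (@continuous_expg G k w P (open_nbhs_nbhs (conj oP Pw))).
have [xu _ xs xD] := xP n.
have [dx _] : D (3 * s) (x n) by have := xD 1%N; rewrite expg1 expn_gt0; exact.
have xe : `|phi (x n)| <= e.
  have : 2 * s / e <= (2 ^ n)%:R.
    have se0 : 0 <= 2 * s / e by apply: divr_ge0; [apply: mulr_ge0|] => //; exact: ltW.
    apply: (le_trans (ltW (archi_boundP se0))).
    by rewrite ler_nat (leq_trans nM) // ltnW // ltn_expl.
  rewrite ler_pdivrMr // => le; rewrite -(@ler_pM2r _ (2 ^ n)%:R) ?ltr0n ?expn_gt0 //.
  by rewrite (le_trans xs) // (le_trans le) // mulrC.
have {eN} Nx := eN _ dx xe.
have : set0 (w_ n ^+ k)%g; last by [].
rewrite -(eqP PQ0); split=> //.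
have := Nx (Ordinal (ltn_pmod (2 ^ n) k0)); rewrite /= -{1}xu {1}(divn_eq (2 ^ n) k).
by rewrite expgnDr expgnA mulgK.
Qed.


(** * Coordinates on the iterated join *)

Lemma compact_finite_cover (X : topologicalType) (I : eqType) (P : I -> X -> Prop) :
  compact [set: X] -> (forall x : X, exists i, \forall y \near x, P i y) ->
  exists s : seq I, forall x, exists2 i, i \in s & P i x.
Proof.
move=> /compact_near_coveringP cX Px.
pose F : set_system (seq I) := fun S =>
  exists s0 : seq I, forall s : seq I, {subset s0 <= s} -> S s.
have FF : Filter F.
  split.
  - by exists [::].
  - move=> S T [s hS] [t hT]; exists (s ++ t) => u stu.
    by split; [apply: hS|apply: hT] => i iu; apply: stu; rewrite mem_cat iu ?orbT.
  - by move=> S T ST [s hS]; exists s => u /hS; exact: ST.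
have := cX _ F (fun s x => exists2 i, i \in s & P i x) FF.
case=> [x _|s hs]; last by exists s => x; exact: hs.
have [i Pi] := Px x.
exists ([set y | P i y], [set s : seq I | i \in s]); first split=> //=.
  by exists [:: i] => s; apply; rewrite mem_head.
by case=> y s [/= Py si]; exists i.
Qed.

Section real_functions.
Context {R : realType} {X : compactHausdorffType}.

Lemma continuous_realC (T : topologicalType) (f : T -> R) :
  continuous f -> continuous (fun x => (f x)%:C : R[i]).
Proof.
move=> cf x; apply/(@cvg_rnormP _ _ _ _ (nbhs_filter x)) => e e0.
have /cvgrPdist_le/(_ e e0) := cf x; apply: (@filterS _ _ (nbhs_filter x)) => y.
by rewrite -rmorphB /rnorm normc_def /= expr0n addr0 sqrtr_sqr.
Qed.

Lemma realC_ge0 (r : R) : (0 <= r%:C) = (0 <= r).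
Proof. by rewrite lecR. Qed.

Lemma rnorm_realC (r : R) : rnorm (r%:C : R[i]) = `|r|.
Proof. by rewrite /rnorm normc_def /= expr0n addr0 sqrtr_sqr. Qed.

Lemma separate_closed (x : X) (B : set X) : closed B -> ~ B x ->
  exists a : cfun R X,
    [/\ forall y, 0 <= a y, a x = 0 & forall y, B y -> a y = 1].
Proof.
move=> cB Bx; have normalX := compact_normal (@hausdorffT X) (@compactT X).
have cx : closed [set x].
  by apply: accessible_closed_set1; apply: hausdorff_accessible; exact: hausdorffT.
have xB : [set x] `&` B = set0.
  by apply/seteqP; split=> // y [/= ->].
move/normal_separatorP : normalX => /(_ R) sep.
have /(@uniform_separatorP _ R)[f [cf f01 f0 f1]] := sep _ _ cx cB xB.
exists (Cfun (continuous_realC cf)); split=> [y||y By].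
- rewrite [X in _ <= X]/((f y)%:C) realC_ge0.
  have : range f (f y) by exists y.
  by move=> /f01 /=; rewrite in_itv /= => /andP[].
- by rewrite [LHS]/((f x)%:C) (f0 (f x)) //; exists x.
- by rewrite [LHS]/((f y)%:C) (f1 (f y)) //; exists y.
Qed.

End real_functions.

Section join_coordinates.
Context {R : realType} {X Y : compactHausdorffType}.
Context (w : R -> R) (cw : continuous w) (w0 : w 0 = 0).
Local Notation cyl := (X * Y * unit_interval R)%type.
Local Notation J := (join R X Y).

Lemma join_descend (Phi : cyl -> R[i]) : continuous Phi ->
  (forall p q, join_rel p q -> Phi p = Phi q) ->
  continuous (fun z : J => Phi (repr z)) /\
  forall p, Phi (repr (join_pi p : J)) = Phi p.
Proof.
move=> cPhi rPhi; have E p : Phi (repr (join_pi p : J)) = Phi p.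
  by apply: rPhi; apply/join_piP; rewrite /join_pi reprK.
split=> //; apply: join_continuous; rewrite (_ : _ \o _ = Phi) //.
by apply/funext => p /=; exact: E.
Qed.

Lemma cyl_time_continuous : continuous (fun p : cyl => ival p.2).
Proof.
by move=> p; apply: continuous_comp; [exact: cvg_snd|exact: ival_continuous].
Qed.

Lemma cyl_left_continuous : continuous (fun p : cyl => p.1.1).
Proof. by move=> p; apply: continuous_comp; exact: cvg_fst. Qed.

Lemma cyl_right_continuous : continuous (fun p : cyl => p.1.2).
Proof. by move=> p; apply: continuous_comp; [exact: cvg_fst|exact: cvg_snd]. Qed.

Let left_fun (f : cfun R X) (p : cyl) : R[i] := (w (ival p.2))%:C * f p.1.1.
Let right_fun (f : cfun R Y) (p : cyl) : R[i] := (w (1 - ival p.2))%:C * f p.1.2.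

Let left_descend f := @join_descend (left_fun f).
Let right_descend f := @join_descend (right_fun f).

Let left_cont f : continuous (left_fun f).
Proof.
move=> p; apply: cvgM.
  apply: (continuous_realC (f := fun p : cyl => w (ival p.2))) => q.
  by apply: continuous_comp; [exact: cyl_time_continuous|exact: cw].
apply: (continuous_comp (f := fun p : cyl => p.1.1)).
  exact: cyl_left_continuous.
exact: cfun_continuous.
Qed.

Let right_cont f : continuous (right_fun f).
Proof.
move=> p; apply: cvgM.
  apply: (continuous_realC (f := fun p : cyl => w (1 - ival p.2))) => q.
  apply: (continuous_comp (f := fun p : cyl => 1 - ival p.2)); last exact: cw.
  by apply: cvgB; [exact: cvg_cst|exact: cyl_time_continuous].
apply: (continuous_comp (f := fun p : cyl => p.1.2)).
  exact: cyl_right_continuous.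
exact: cfun_continuous.
Qed.

Let left_rel f p q : join_rel p q -> left_fun f p = left_fun f q.
Proof.
move=> /asboolP[e [e1|[t0 _]|[_ e1]]]; rewrite /left_fun -e ?e1 //.
by rewrite t0 w0 !mul0r.
Qed.

Let right_rel f p q : join_rel p q -> right_fun f p = right_fun f q.
Proof.
move=> /asboolP[e [e1|[_ e1]|[t1 _]]]; rewrite /right_fun -e ?e1 //.
by rewrite t1 subrr w0 !mul0r.
Qed.

(** The functions [w(t) f(x)] and [w(1 - t) f(y)], which descend to the join since
    [w] vanishes at 0. Barycentric coordinates use [w = id]; their square roots, with
    [w = Num.sqrt], are what complete positivity requires. *)
Definition join_left (f : cfun R X) : cfun R J :=
  Cfun (left_descend (@left_cont f) (@left_rel f)).1.

Definition join_right (f : cfun R Y) : cfun R J :=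
  Cfun (right_descend (@right_cont f) (@right_rel f)).1.

Lemma join_leftE f x y t : join_left f (join_pi (x, y, t)) = (w (ival t))%:C * f x.
Proof. exact: (left_descend (@left_cont f) (@left_rel f)).2. Qed.

Lemma join_rightE f x y t :
  join_right f (join_pi (x, y, t)) = (w (1 - ival t))%:C * f y.
Proof. exact: (right_descend (@right_cont f) (@right_rel f)).2. Qed.

End join_coordinates.

Section unit_interval_points.
Context {R : realType}.

Lemma ival01 (t : unit_interval R) : 0 <= ival t <= 1.
Proof.
have := set_valP (t : set_type `[0 : R, 1]%classic).
by rewrite /= in_itv.
Qed.

Lemma ival_surj (r : R) : 0 <= r <= 1 -> exists t : unit_interval R, ival t = r.
Proof.
move=> r01; have r01' : r \in `[0 : R, 1]%classic by rewrite inE /= in_itv.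
by exists (exist _ r r01').
Qed.

End unit_interval_points.

Lemma continuous_idfun (R : realType) : continuous (id : R -> R).
Proof. by move=> x. Qed.

Section iterated_join.
Context (R : realType) (G : compactGroupType).

Definition multi_join (k : nat) : gspace G := join_power R G k.+1.
Local Notation Z := multi_join.
Local Notation CG := (cfun R (left_translation G)).

Fixpoint weighted_coord (w : R -> R) (cw : continuous w) (w0 : w 0 = 0) (k j : nat)
    (f : CG) : cfun R (Z k) :=
  if k is k'.+1 return cfun R (Z k) then
    if j == k'.+1 then join_right cw w0 f
    else join_left cw w0 (weighted_coord cw w0 k' j f)
  else if j == 0%N then f else 0.

(** At a point with barycentric coordinates [t] and entries [g], the value of
    [coord k j f] is [t j * f (g j)], and that of [sqrt_coord k j f] is
    [Num.sqrt (t j) * f (g j)]. *)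
Definition coord := weighted_coord (@continuous_idfun R) erefl.
Definition sqrt_coord := weighted_coord (@sqrt_continuous R) (sqrtr0 R).

(** The point at time [t] of the segment from [y] to [x]. *)
Definition join_point k (x : Z k) (y : G) (t : unit_interval R) : Z k.+1 :=
  join_pi (x, y, t).

Lemma join_pointP k (z : Z k.+1) : exists x y t, z = join_point x y t.
Proof. by have [[[x y] t] ->] := join_pi_surj z; exists x, y, t. Qed.

Lemma weighted_coordE w cw w0 k j f (x : Z k) y t :
  @weighted_coord w cw w0 k.+1 j f (join_point x y t) =
  if j == k.+1 then (w (1 - ival t))%:C * f y
  else (w (ival t))%:C * weighted_coord cw w0 k j f x.
Proof.
by rewrite /=; case: eqP => _; [exact: join_rightE|exact: join_leftE].
Qed.

Lemma gact_join_point k g (x : Z k) y t :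
  gact g (join_point x y t) = join_point (gact g x) (g * y)%g t.
Proof. exact: (@join_actE R G (Z k) (left_translation G) g (x, y, t)). Qed.

Lemma multi_join_pointP k (z : Z k) : exists (t : nat -> R) (g : nat -> G),
  [/\ forall j, 0 <= t j, \sum_(j < k.+1) t j = 1 &
    forall j f, coord k j f z = (t j)%:C * f (g j) /\
                sqrt_coord k j f z = (Num.sqrt (t j))%:C * f (g j)].
Proof.
elim: k z => [|k IH] z.
  exists (fun j => (j == 0%N)%:R), (fun=> z); split=> [j||j f].
  - by rewrite ler0n.
  - by rewrite big_ord1.
  rewrite /coord /sqrt_coord /=; case: eqP => _ /=.
    by rewrite sqrtr1 !mul1r.
  by rewrite sqrtr0 !mul0r.
have [x [y [s ->]]] := join_pointP z; have [t [g [t0 t1 tE]]] := IH x.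
have /andP[s0 s1] := ival01 s.
exists (fun j => if j == k.+1 then 1 - ival s else ival s * t j).
exists (fun j => if j == k.+1 then y else g j); split=> [j||j f].
- by case: eqP; rewrite ?subr_ge0 // mulr_ge0.
- rewrite big_ord_recr /= eqxx (eq_bigr (fun j : 'I_k.+1 => ival s * t j)) => [|j _].
    by rewrite -mulr_sumr t1 mulr1 addrC subrK.
  by rewrite ltn_eqF.
rewrite /coord /sqrt_coord !weighted_coordE; case: eqP => // _.
rewrite sqrtrM // !rmorphM /= -!mulrA.
by have [<- <-] := tE j f.
Qed.

End iterated_join.

Section coord_theory.
Context {R : realType} {G : compactGroupType}.
Local Notation Z := (multi_join R G).
Local Notation CG := (cfun R (left_translation G)).

Lemma multi_join_point k (t : nat -> R) (g : nat -> G) :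
  (forall j, 0 <= t j) -> \sum_(j < k.+1) t j = 1 ->
  exists z : Z k, forall j f, (j <= k)%N -> coord k j f z = (t j)%:C * f (g j).
Proof.
move=> t0; elim: k t t0 => [|k IH] t t0.
  rewrite big_ord1 => t1; exists (g 0%N) => -[|//] f _.
  by rewrite /coord /= t1 mul1r.
rewrite big_ord_recr /= => t1; pose s := \sum_(j < k.+1) t j.
have s0 : 0 <= s by apply: sumr_ge0.
have sle1 : s <= 1 by rewrite -t1 lerDl.
have [|u uE] := @ival_surj R s; first by rewrite s0.
have t1' : t k.+1 = 1 - ival u by rewrite uE -t1 addrAC subrr add0r.
have [sz|sz] := eqVneq s 0.
  have t00 j : (j <= k)%N -> t j = 0.
    move=> jk; apply/eqP; move/eqP: sz; rewrite psumr_eq0 //.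
    by move=> /allP /(_ (Ordinal (jk : (j < k.+1)%N))) /=; rewrite mem_index_enum => /(_ isT).
  have [||x _] := IH (fun j => (j == 0%N)%:R).
  - by move=> j; rewrite ler0n.
  - by rewrite big_ord_recl big1 ?addr0.
  exists (join_point x (g k.+1) u) => j f jk.
  rewrite /coord weighted_coordE; case: eqP => [->|/eqP jk1]; first by rewrite t1'.
  by rewrite uE sz t00 ?mul0r // -ltnS ltn_neqAle jk1.
have [||x xE] := IH (fun j => t j / s).
- by move=> j; rewrite divr_ge0.
- by rewrite -mulr_suml divff.
exists (join_point x (g k.+1) u) => j f jk.
rewrite /coord weighted_coordE; case: eqP => [->|/eqP jk1]; first by rewrite t1'.
have jk' : (j <= k)%N by rewrite -ltnS ltn_neqAle jk1.
have := xE j f jk'; rewrite /coord => xE'.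
by rewrite xE' uE mulrA -rmorphM /= mulrCA divff // mulr1.
Qed.

Lemma coord_equivariant (w : R -> R) (cw : continuous w) (w0 : w 0 = 0)
    k j (g : G) (f : CG) (z : Z k) :
  weighted_coord cw w0 k j (translate g f) z =
  weighted_coord cw w0 k j f (gact g^-1%g z).
Proof.
elim: k j z => [|k IH] j z; first by rewrite /=; case: ifP.
have [x [y [t ->]]] := join_pointP z.
by rewrite gact_join_point !weighted_coordE; case: eqP => _ //; rewrite IH.
Qed.

Lemma multi_join_free k (g : G) (z : Z k) : gact g z = z -> g = 1%g.
Proof.
have freeG (y : G) : (g * y)%g = y -> g = 1%g.
  by move=> gy; apply: (@mulIg _ y); rewrite gy mul1g.
elim: k z => [|k IH] z; first exact: freeG.
have [x [y [t ->]]] := join_pointP z; rewrite gact_join_point.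
move=> /join_piP/asboolP[_ [[_ /freeG //]|[_ /freeG //]|[_ /IH //]]].
Qed.

Lemma coord_out k j (f : CG) (z : Z k) : (k < j)%N -> coord k j f z = 0.
Proof.
elim: k z => [|k IH] z kj; first by rewrite /coord /= gtn_eqF.
have [x [y [t ->]]] := join_pointP z.
by rewrite /coord weighted_coordE gtn_eqF // [X in _ * X]IH ?mulr0 // ltnW.
Qed.

Lemma separate_points (X : compactHausdorffType) (x y : X) : x <> y ->
  exists f : cfun R X, (forall z, 0 <= f z) /\ f x <> f y.
Proof.
move=> xy; have cy : closed [set y].
  by apply: accessible_closed_set1; apply: hausdorff_accessible; exact: hausdorffT.
have [//|f [f0 fx fy]] := @separate_closed R _ x _ cy.
by exists f; split=> //; rewrite fx fy // => /esym/eqP; rewrite oner_eq0.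
Qed.

Lemma coord_separates k (z z' : Z k) : z <> z' ->
  exists j (f : CG), (forall x, 0 <= f x) /\ coord k j f z <> coord k j f z'.
Proof.
elim: k z z' => [|k IH] z z' zz'.
  by have [f f0] := separate_points zz'; exists 0%N, f.
have [[x [y [s ez]]] [x' [y' [s' ez']]]] := (join_pointP z, join_pointP z').
subst z z'.
have [ss|ss] := eqVneq (ival s) (ival s'); last first.
  exists k.+1, (cfun_cst 1); split=> [u|]; first exact: ler01.
  rewrite /coord !weighted_coordE eqxx /= !mulr1 => /complexI /addrI /oppr_inj /eqP.
  exact/negP.
have {}ss : s = s' by exact: ival_inj.
subst s'; have nrel : ~ join_rel (x, y, s) (x', y', s) by move=> /join_piP.
have [[yy s1]|nyy] := pselect (y <> y' /\ 1 - ival s != 0).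
  have [f [f0 fyy]] := separate_points yy; exists k.+1, f; split=> //.
  rewrite /coord !weighted_coordE eqxx => /mulfI E; apply: fyy; apply: E.
  by apply/eqP => /(@complexI R)/eqP; exact/negP.
have [[xx s0]|nxx] := pselect (x <> x' /\ ival s != 0).
  have [j [f [f0 fxx]]] := IH x x' xx.
  have jk : j != k.+1.
    by apply/eqP => jk; apply: fxx; rewrite jk !coord_out.
  exists j, f; split=> //; rewrite /coord !weighted_coordE (negbTE jk).
  move=> /mulfI E; apply: fxx; apply: E.
  by apply/eqP => /(@complexI R)/eqP; exact/negP.
exfalso; apply: nrel; apply/asboolP; split=> //=.
have [s0|s0] := eqVneq (ival s) 0.
  apply: Or32; split=> //; apply: contrapT => yy; apply: nyy; split=> //.
  by rewrite s0 subr0 oner_eq0.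
have xx : x = x' by apply: contrapT => xx; apply: nxx.
have [s1|s1] := eqVneq (ival s) 1; first exact: Or33.
apply: Or31; rewrite xx; congr (_, _); apply: contrapT => yy; apply: nyy; split=> //.
by rewrite subr_eq0 eq_sym.
Qed.

(** The functions [coord k j a] define the topology of the iterated join,
    which is compact: by compactness of the square, finitely many of them
    control a given function. *)
Lemma coord_control k (f : cfun R (Z k)) (e : R) : 0 < e ->
  exists (A : seq CG) (b : R), [/\ 0 < b, forall a x, a \in A -> 0 <= a x &
    forall z z', (forall j a, a \in A ->
      rnorm (coord k j a z - coord k j a z') <= b) -> rnorm (f z - f z') <= e].
Proof.
move=> e0; pose D (j : nat) (a : CG) (p : Z k * Z k) := coord k j a p.1 - coord k j a p.2.
have cD (g : cfun R (Z k)) : continuous (fun p : Z k * Z k => rnorm (g p.1 - g p.2)).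
  move=> p; apply: (continuous_comp (f := fun p : Z k * Z k => g p.1 - g p.2));
    last exact: rnorm_continuous.
  apply: cvgB.
    by apply: (continuous_comp (f := fst)); [exact: cvg_fst|exact: cfun_continuous].
  by apply: (continuous_comp (f := snd)); [exact: cvg_snd|exact: cfun_continuous].
pose P (i : option (nat * CG * R)) (p : Z k * Z k) :=
  if i is Some (j, a, b) then [/\ 0 < b, forall x, 0 <= a x & b < rnorm (D j a p)]
  else rnorm (f p.1 - f p.2) < e.
have [||s hs] := @compact_finite_cover (Z k * Z k)%type _ P.
- by rewrite -setXTT; apply: compact_setX; exact: compactT.
- case=> z z'; have [->|zz] := pselect (z = z').
    exists None; apply: (cvgr_lt _ (cD f (z', z'))).
    by rewrite /= subrr rnorm0.
  have [j [a [a0 azz]]] := coord_separates zz.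
  have b0 : 0 < rnorm (D j a (z, z')).
    rewrite lt_def rnorm_ge0 andbT; apply/eqP => /rnorm_eq0 /eqP.
    by rewrite subr_eq0 => /eqP.
  exists (Some (j, a, rnorm (D j a (z, z')) / 2)).
  have : \forall p \near (z, z'), rnorm (D j a (z, z')) / 2 < rnorm (D j a p).
    apply: (cvgr_gt _ (cD (coord k j a) (z, z'))).
    by rewrite ltr_pdivrMr // ltr_pMr // ltr1n.
  by apply: filterS => p hp; split=> //; rewrite divr_gt0.
pose pick (i : option (nat * CG * R)) : option CG :=
  if i is Some (j, a, b) then if `[< forall x, 0 <= a x >] then Some a else None
  else None.
pose A := pmap pick s.
pose b := \big[Num.min/1]_(i <- s) (if i is Some (_, _, b) then if 0 < b then b else 1 else 1).
exists A, b; split.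
- rewrite /b; elim: (s) => [|i s' IH]; first by rewrite big_nil.
  by rewrite big_cons lt_min IH andbT; case: i => [[[? ?] c]|//]; case: ifP.
- move=> a x; rewrite mem_pmap => /mapP[[[[j a'] c]|//] _ /=].
  by case: asboolP => // a0 [->]; exact: a0.
move=> z z' close; have [[[[j a] c]|] si /=] := hs (z, z'); last exact: ltW.
move=> [c0 a0]; rewrite ltNge => /negP[].
apply: le_trans (close j a _) _.
  by rewrite mem_pmap; apply/mapP; exists (Some (j, a, c)); rewrite //= asboolT.
rewrite /b; elim: (s) si => [//|i s' IH]; rewrite inE big_cons ge_min => /orP[/eqP <-|/IH ->].
  by rewrite c0 lexx.
by rewrite orbT.
Qed.

End coord_theory.

(** * Sequences of functions in the central sequence algebra *)

Section central_classes.
Context {R : realType} {X : compactHausdorffType}.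
Local Notation A := (cfun R X).
Local Notation SA := (seq_alg A).
Local Notation FA := (central_seq_alg A).
Local Notation S := (seq_quotient A).
Local Notation C := (central_quotient A).
Implicit Types (u v : nat -> A).

Lemma sq_class_inj (E : starAlgType R) (Q : star_subquotient E) x y
    (Dx : sq_dom Q x) (Dy : sq_dom Q y) :
  sq_class Dx = sq_class Dy -> sq_ker Q (x - y).
Proof. by move=> /eqmodP /= /asboolP. Qed.

Lemma seq_commutant_all (x : SA) : seq_commutant x.
Proof.
move=> a; have [u [hu ->]] := sq_classP x.
rewrite [LHS](sq_mulE (S := S)) [RHS](sq_mulE (S := S)); apply: sq_class_congr.
by apply/funext => n; apply: cfunP => z; exact: mulrC.
Qed.

(** The class of a bounded sequence: for a commutative algebra, every bounded
    sequence is central. *)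
Definition central_class u (hu : linf u) : FA :=
  @sq_class R _ C _ (seq_commutant_all (@sq_class R _ S u hu)).

Lemma central_classP (x : FA) : exists u (hu : linf u), x = central_class hu.
Proof.
have [y [Dy ->]] := sq_classP x; have [u [hu e]] := sq_classP y.
by exists u, hu; apply: sq_class_congr.
Qed.

(** As [A] is unital, an annihilating class is its own product with 1. *)
Lemma seq_annihilator0 (z : SA) : seq_annihilator z -> z = 0.
Proof.
move=> [_ /(_ (cfun_cst 1)) z0]; rewrite -z0; have [w [hw ->]] := sq_classP z.
rewrite [RHS](sq_mulE (S := S)); apply: sq_class_congr.
by apply/funext => n; apply: cfunP => x; rewrite /smul /= mulr1.
Qed.

Lemma central_class_eq u v (hu : linf u) (hv : linf v) :
  central_class hu = central_class hv <-> c0 (u - v).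
Proof.
split=> [/sq_class_inj /seq_annihilator0 /eqP|h]; last first.
  by apply: sq_class_congr; exact: sq_class_eq.
by rewrite subr_eq0 => /eqP /sq_class_inj.
Qed.

Lemma central_class_congr u v (hu : linf u) (hv : linf v) :
  u = v -> central_class hu = central_class hv.
Proof. by move=> uv; apply: sq_class_congr; exact: sq_class_congr. Qed.

Lemma central_classD u v (hu : linf u) (hv : linf v) (h : linf (u + v)) :
  central_class hu + central_class hv = central_class h.
Proof.
rewrite [LHS](sq_addE (S := C)); apply: sq_class_congr.
by rewrite [LHS](sq_addE (S := S)); exact: sq_class_congr.
Qed.

Lemma central_classZ c u (hu : linf u) (h : linf (c *: u)) :
  c *: central_class hu = central_class h.
Proof.
rewrite [LHS](sq_scaleE (S := C)); apply: sq_class_congr.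
by rewrite [LHS](sq_scaleE (S := S)); exact: sq_class_congr.
Qed.

Lemma central_classM u v (hu : linf u) (hv : linf v) (h : linf (u ** v)) :
  central_class hu ** central_class hv = central_class h.
Proof.
rewrite [LHS](sq_mulE (S := C)); apply: sq_class_congr.
by rewrite [LHS](sq_mulE (S := S)); exact: sq_class_congr.
Qed.

Lemma central_class_star u (hu : linf u) (h : linf (star u)) :
  star (central_class hu) = central_class h.
Proof.
rewrite [LHS](sq_starE (S := C)); apply: sq_class_congr.
by rewrite [LHS](sq_starE (S := S)); exact: sq_class_congr.
Qed.

Lemma central_class_act (G : compactGroupType) (alpha : cstar_action G A) g u
    (hu : linf u) (h : linf (fun n => alpha g (u n))) :
  central_act alpha g (central_class hu) = central_class h.
Proof.
apply: sq_class_congr; set x := sq_repr _.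
have -> : x = @sq_class R _ S u hu.
  apply/eqP; rewrite -subr_eq0; apply/eqP/seq_annihilator0.
  exact: (@sq_class_repr R _ C).
by rewrite seq_actE; exact: sq_class_congr.
Qed.

Lemma central_norm_class u (hu : linf u) M : 0 <= M ->
  (forall n, rnorm (u n) <= M) -> central_norm (central_class hu) <= M.
Proof.
move=> M0 uM.
have sup_le : sup_norm u <= M.
  apply: ge_sup; first by exists (rnorm (u 0%N)), 0%N.
  by move=> _ [n _ <-]; exact: uM.
have norm_ge0 (x : SA) : 0 <= seq_norm x.
  rewrite /seq_norm /quotient_norm; apply: lb_le_inf.
    have [v [hv ->]] := sq_classP x.
    by exists (sup_norm v), v => //; exists hv.
  move=> _ [v [[B vB] _] <-]; apply: le_trans (rnorm_ge0 (v 0%N)) _.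
  by apply: ub_le_sup; [exists B => _ [n _ <-]|exists 0%N].
apply: le_trans sup_le.
have : seq_norm (@sq_class R _ S u hu) <= sup_norm u.
  apply: ge_inf; last by exists u => //; exists hu.
  exists 0 => _ [v [[B vB] _] <-]; apply: le_trans (rnorm_ge0 (v 0%N)) _.
  by apply: ub_le_sup; [exists B => _ [n _ <-]|exists 0%N].
apply: le_trans; apply: ge_inf; first by exists 0 => _ [v _ <-].
by exists (@sq_class R _ S u hu) => //; exists (seq_commutant_all _).
Qed.

End central_classes.

(** * The coordinates of the iterated join are Rokhlin towers *)

Section upper_bound.
Context {R : realType} {G : compactGroupType} (n : nat).
Local Notation Z := (multi_join R G).
Local Notation CG := (cfun R (left_translation G)).
Local Notation A := (cfun R (Z n)).
Local Notation FA := (central_seq_alg A).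
Local Notation alpha := (canonical_action R (Z n)).

Let kappa (a : A) : FA := central_class (linf_cst a).

Let kappaD a b : kappa (a + b) = kappa a + kappa b.
Proof. exact/esym/central_classD. Qed.
Let kappaZ c a : kappa (c *: a) = c *: kappa a.
Proof. exact/esym/central_classZ. Qed.
Let kappaM a b : kappa (a ** b) = kappa a ** kappa b.
Proof. exact/esym/central_classM. Qed.
Let kappa_star a : kappa (star a) = star (kappa a).
Proof. exact/esym/central_class_star. Qed.
Let kappa0 : kappa 0 = 0.
Proof. by rewrite -(scale0r (0 : A)) kappaZ scale0r. Qed.
Let kappa_act g a : central_act alpha g (kappa a) = kappa (alpha g a).
Proof. exact: central_class_act. Qed.
Let kappa_norm a : central_norm (kappa a) <= rnorm a.
Proof. by apply: central_norm_class => //; exact: rnorm_ge0. Qed.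

Lemma coord_linear k j (c : R[i]) (f h : CG) :
  coord k j (c *: f + h) = c *: coord k j f + coord k j h.
Proof.
apply: cfunP => z; have [t [g [_ _ tE]]] := multi_join_pointP z.
rewrite [RHS]/(c * coord k j f z + coord k j h z).
rewrite (tE j _).1 (tE j f).1 (tE j h).1 [X in _ * X]/(c * f (g j) + h (g j)).
by rewrite mulrDr mulrCA.
Qed.

Lemma sqrt_weight (t : R) (a b : R[i]) : 0 <= t ->
  t%:C * (conjc a * b) = conjc ((Num.sqrt t)%:C * a) * ((Num.sqrt t)%:C * b).
Proof.
move=> t0; have -> : conjc ((Num.sqrt t)%:C * a) = (Num.sqrt t)%:C * conjc a.
  by rewrite rmorphM; congr (_ * _); exact: conjc_real.
by rewrite mulrACA -rmorphM -expr2 sqr_sqrtr.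
Qed.

(** This factorization makes [coord k j] completely positive. *)
Lemma coord_sqrt k j (f h : CG) :
  coord k j (star f ** h) = star (sqrt_coord k j f) ** sqrt_coord k j h.
Proof.
apply: cfunP => z; have [t [g [t0 _ tE]]] := multi_join_pointP z.
rewrite (tE j _).1.
suff E : (t j)%:C * (conjc (f (g j)) * h (g j)) =
    conjc (sqrt_coord k j f z) * sqrt_coord k j h z by exact: E.
by rewrite (tE j f).2 (tE j h).2 sqrt_weight.
Qed.

Lemma cfun_sumE (I : Type) (r : seq I) (F : I -> A) z :
  (\sum_(i <- r) F i) z = \sum_(i <- r) F i z.
Proof. by elim/big_rec2: _ => [//|i u v _ <-]. Qed.

Lemma coord_sum1 : \sum_(j < n.+1) coord n j (cfun_cst 1) = cfun_cst 1 :> A.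
Proof.
apply: cfunP => z; rewrite [LHS]cfun_sumE; have [t [g [_ t1 tE]]] := multi_join_pointP z.
rewrite (eq_bigr (fun j : 'I_n.+1 => (t j)%:C)) => [|j _].
  by rewrite -rmorph_sum t1.
by rewrite (tE j _).1 mulr1.
Qed.

Definition tower (j : nat) (f : CG) : FA := kappa (coord n j f).

Let tower_linear j : linear (tower j).
Proof. by move=> c f h; rewrite /tower coord_linear kappaD kappaZ. Qed.

HB.instance Definition _ j := GRing.isLinear.Build R[i] CG FA *:%R (tower j)
  (tower_linear j).

Lemma coord_le j (f : CG) : (j <= n)%N -> rnorm (coord n j f) <= rnorm f.
Proof.
move=> jn; apply: cfun_norm_le => [|z]; first exact: rnorm_ge0.
have [t [g [t0 t1 tE]]] := multi_join_pointP z; rewrite (tE j f).1.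
rewrite [leLHS](rnormZ ((t j)%:C : R[i]^o) (f (g j))).
have tj1 : t j <= 1.
  by rewrite -t1 (bigD1 (Ordinal (jn : (j < n.+1)%N))) //= lerDl sumr_ge0.
rewrite [X in X * _]rnorm_realC ger0_norm //.
apply: le_trans (cfun_norm_ge f (g j)).
by rewrite ler_piMl // rnorm_ge0.
Qed.

Theorem coordinate_towers : rokhlin_towers alpha (fun j : 'I_n.+1 => tower j : {linear CG -> FA}).
Proof.
split.
- move=> j f g0 e e0; have e20 : 0 < e / 2 by rewrite divr_gt0.
  have /(@cvg_rnormP _ _ _ _ (nbhs_filter g0))/(_ _ e20) :=
    @cact_continuous _ _ _ alpha (coord n j f) g0.
  apply: (@filterS _ _ (nbhs_filter g0)) => g le.
  suff : central_norm (central_act alpha g (kappa (coord n j f)) -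
                       central_act alpha g0 (kappa (coord n j f))) < e by [].
  rewrite !kappa_act -scaleN1r -kappaZ -kappaD scaleN1r.
  apply: le_lt_trans (kappa_norm _) _; rewrite rnorm_distC (le_lt_trans le) //.
  by rewrite ltr_pdivrMr // ltr_pMr // ltr1n.
- move=> j k M [Y YM]; exists (map_mx (fun f => kappa (sqrt_coord n j f)) Y) => a b.
  rewrite mxE YM linear_sum; apply: eq_bigr => l _; rewrite !mxE.
  suff : kappa (coord n j (star (Y l a) ** Y l b)) =
    star (kappa (sqrt_coord n j (Y l a))) ** kappa (sqrt_coord n j (Y l b)) by [].
  by rewrite coord_sqrt kappaM kappa_star.
- move=> j f; apply: le_trans (kappa_norm _) _; apply: coord_le.
  by rewrite -ltnS.
- move=> j a b _ _ ab; rewrite -[RHS]kappa0.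
  suff : kappa (coord n j a) ** kappa (coord n j b) = kappa 0 by [].
  rewrite -kappaM; congr kappa; apply: cfunP => z; have [t [g [_ _ tE]]] := multi_join_pointP z.
  have ab0 : a (g j) * b (g j) = 0 by exact: (congr1 (fun f : CG => f (g j)) ab).
  suff : coord n j a z * coord n j b z = 0 by [].
  by rewrite (tE j a).1 (tE j b).1 mulrACA ab0 mulr0.
- move=> j g f; suff : kappa (coord n j (translate g f)) =
    central_act alpha g (kappa (coord n j f)) by [].
  by rewrite kappa_act; congr kappa; apply: cfunP => z; exact: coord_equivariant.
- move=> i j _ f h; 
  suff : kappa (coord n i f) ** kappa (coord n j h) =
    kappa (coord n j h) ** kappa (coord n i f) by [].
  rewrite -!kappaM; congr kappa; apply: cfunP => z; exact: mulrC.
have -> : \sum_(j < n.+1) tower j (cfun_cst 1) = kappa (cfun_cst 1).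
  rewrite -coord_sum1; elim/big_rec2: _ => [|j u v _ E]; [exact/esym/kappa0|by rewrite kappaD -E].
move=> e x; have [u [hu ->]] := central_classP x; rewrite {}/e /kappa; split.
  rewrite (central_classM _ _ (@sq_domM R _ (seq_quotient A) _ _ (linf_cst _) hu)).
  apply: central_class_congr.
  by apply/funext => m; apply: cfunP => z; exact: mul1r.
rewrite (central_classM _ _ (@sq_domM R _ (seq_quotient A) _ _ hu (linf_cst _))).
apply: central_class_congr.
by apply/funext => m; apply: cfunP => z; exact: mulr1.
Qed.

Lemma dim_Rok_c_le : (dim_Rok_c alpha <= n%:R%:E)%E.
Proof.
apply: ereal_inf_lbound; exists n => //.
by exists (fun j : 'I_n.+1 => tower j : {linear CG -> FA}); exact: coordinate_towers.
Qed.

End upper_bound.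

(** * Order zero functionals *)

Section order_zero_functional.
Context {R : realType} {X : compactHausdorffType}.
Local Notation A := (cfun R X).
Implicit Types (f h : A) (c : R).

Definition nonneg f := forall x, 0 <= f x.

Lemma nonnegE f x : nonneg f -> f x = (complex.Re (f x))%:C.
Proof.
by move=> /(_ x); rewrite lecE; case: (f x) => a b /= /andP[/eqP -> _].
Qed.

Lemma nonneg_Re f x : nonneg f -> 0 <= complex.Re (f x).
Proof. by move=> f0; rewrite -realC_ge0 -nonnegE. Qed.

Lemma continuous_Re f : continuous (fun x => complex.Re (f x)).
Proof.
move=> x; apply/cvgrPdist_le => e e0.
have /(@cvg_rnormP _ _ _ _ (nbhs_filter x))/(_ e e0) := @cfun_continuous _ _ f x.
apply: (@filterS _ _ (nbhs_filter x)) => y; apply: le_trans.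
rewrite (_ : _ - _ = complex.Re (f x - f y)) ?normc_Re_le //.
by case: (f x) (f y) => [? ?] [? ?].
Qed.

Let max0C (a : X -> R) : continuous a -> continuous (fun x => Num.max (a x) 0).
Proof. by move=> ca x; apply: continuous_max => //; [exact: ca|exact: cvg_cst]. Qed.

Let aboveC f c : continuous (fun x => Num.max (complex.Re (f x) - c) 0).
Proof. by apply: max0C => x; apply: cvgB; [exact: continuous_Re|exact: cvg_cst]. Qed.

Let belowC f c : continuous (fun x => Num.max (c - complex.Re (f x)) 0).
Proof. by apply: max0C => x; apply: cvgB; [exact: cvg_cst|exact: continuous_Re]. Qed.

(** The positive parts of [f - c] and of [c - f], which are orthogonal. *)
Definition above f c : A := Cfun (continuous_realC (@aboveC f c)).
Definition below f c : A := Cfun (continuous_realC (@belowC f c)).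

Lemma aboveE f c x : above f c x = (Num.max (complex.Re (f x) - c) 0)%:C.
Proof. by []. Qed.
Lemma belowE f c x : below f c x = (Num.max (c - complex.Re (f x)) 0)%:C.
Proof. by []. Qed.

Lemma above_nonneg f c : nonneg (above f c).
Proof. by move=> x; rewrite aboveE realC_ge0 le_max lexx orbT. Qed.
Lemma below_nonneg f c : nonneg (below f c).
Proof. by move=> x; rewrite belowE realC_ge0 le_max lexx orbT. Qed.

Lemma below_above0 f c : below f c ** above f c = 0.
Proof.
apply: cfunP => x; suff : below f c x * above f c x = 0 by [].
rewrite belowE aboveE -rmorphM.
have [le|lt] := leP (complex.Re (f x)) c.
  by rewrite (max_r (x := _ - c)) ?subr_le0 // mulr0.
by rewrite max_r ?mul0r // subr_le0 ltW.
Qed.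

Lemma nonnegD f h : nonneg f -> nonneg h -> nonneg (f + h).
Proof. by move=> f0 h0 x; exact: addr_ge0. Qed.

Lemma nonnegZ c f : 0 <= c -> nonneg f -> nonneg (c%:C *: f).
Proof. by move=> c0 f0 x; apply: mulr_ge0 => //; rewrite realC_ge0. Qed.

Lemma nonneg1 : nonneg (cfun_cst 1).
Proof. by move=> x; exact: ler01. Qed.

Context (psi : A -> R).
Hypothesis psiD : forall f h, nonneg f -> nonneg h -> psi (f + h) = psi f + psi h.
Hypothesis psiZ : forall c f, 0 <= c -> nonneg f -> psi (c%:C *: f) = c * psi f.
Hypothesis psi_ge0 : forall f, nonneg f -> 0 <= psi f.
Hypothesis psi_order_zero : forall f h, nonneg f -> nonneg h -> f ** h = 0 ->
  psi f * psi h = 0.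

Let psi_mono f h : nonneg f -> nonneg h -> (forall x, f x <= h x) -> psi f <= psi h.
Proof.
move=> f0 h0 fh; have d0 : nonneg (h - f) by move=> x; rewrite subr_ge0.
by rewrite -(subrK f h) psiD // lerDr psi_ge0.
Qed.

Let psi_support0 : psi (cfun_cst 1) = 0 -> forall f, nonneg f -> psi f = 0.
Proof.
move=> p10 f f0; apply/eqP; rewrite eq_le psi_ge0 // andbT.
have n0 := cfun_norm_ge0 f.
rewrite -(mulr0 (cfun_norm f)) -p10 -psiZ //.
apply: psi_mono => //; first exact: nonnegZ.
move=> x; suff : f x <= (cfun_norm f)%:C * 1 by [].
rewrite mulr1 (nonnegE x f0) lecR.
by apply: le_trans (ler_norm _) (le_trans (normc_Re_le _) (cfun_norm_ge f x)).
Qed.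

(** An order zero functional is a multiple of an evaluation. If it is not zero, it
    has a support point: otherwise, by compactness, it would kill a function bounded
    below by 1. A function vanishing at a support point [x] is, up to a small
    constant, orthogonal to a function which is positive at [x], hence not killed;
    so it is killed itself. *)
Lemma order_zero_functional (x0 : X) : exists t x,
  0 <= t /\ forall f, nonneg f -> (psi f)%:C = t%:C * f x.
Proof.
have [p10|p1] := eqVneq (psi (cfun_cst 1)) 0.
  by exists 0, x0; split=> // f f0; rewrite psi_support0 // mul0r.
have [[x xP]|nx] := pselect (exists x, forall f, nonneg f -> 0 < f x -> psi f != 0);
    last first.
  exfalso; move/negP: p1; apply.
  pose P f x := [/\ nonneg f, psi f = 0 & 1 < complex.Re (f x)].
  have [|x|s hs] := @compact_finite_cover X A P; first exact: compactT.
    have [f [f0 fx pf]] : exists f, [/\ nonneg f, 0 < f x & psi f = 0].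
      apply: contrapT => nf; apply: nx; exists x => f f0 fx; apply/eqP => pf.
      by apply: nf; exists f.
    have fx' : 0 < complex.Re (f x) by rewrite -ltcR -nonnegE.
    have c0 : 0 <= 2 / complex.Re (f x) by rewrite divr_ge0 // ltW.
    exists ((2 / complex.Re (f x))%:C *: f); set h := _ *: _.
    have : \forall y \near x, 1 < complex.Re (h y).
      apply: (cvgr_gt _ (continuous_Re (f := h) (x := x))).
      suff : 1 < complex.Re ((2 / complex.Re (f x))%:C * f x) by [].
      rewrite (nonnegE x f0) -rmorphM /= divfK ?gt_eqF //.
      by rewrite ltr1n.
    by apply: filterS => y hy; split=> //; [exact: nonnegZ|rewrite psiZ // pf mulr0].
  pose F := \sum_(f <- s | `[< nonneg f /\ psi f = 0 >]) f.
  have [F0 pF] : nonneg F /\ psi F = 0.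
    apply: (big_ind (fun f => nonneg f /\ psi f = 0)) => [|f h [f0 pf] [h0 ph]|f /asboolP//].
      split; first by move=> x.
      by rewrite -(scale0r (cfun_cst 1 : A)) (psiZ (c := 0)) ?mul0r.
    by split; [exact: nonnegD|rewrite psiD // pf ph addr0].
  rewrite eq_le psi_ge0 // andbT -pF; apply: psi_mono => //.
  move=> x; have [f fs [f0 pf fx]] := hs x.
  rewrite /F (big_rem f) //= asboolT //.
  set h := \sum_(_ <- _ | _) _; have h0 : nonneg h.
    rewrite /h; apply: (big_ind nonneg) => [y //|? ? ? ?|? /asboolP[]//].
    exact: nonnegD.
  suff : 1%:C + 0 <= f x + h x by rewrite addr0.
  by apply: lerD; [rewrite [leRHS](nonnegE x f0) lecR ltW|exact: h0].
exists (psi (cfun_cst 1)), x; split; first exact/psi_ge0/nonneg1.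
have van f : nonneg f -> f x = 0 -> psi f = 0.
  move=> f0 fx; apply/eqP; rewrite eq_le psi_ge0 // andbT leNgt; apply/negP => pf.
  pose N := psi (cfun_cst 1); have N0 : 0 <= N by exact/psi_ge0/nonneg1.
  have small e : 0 < e -> psi f <= e * N.
    move=> e0; have pa : psi (above f e) = 0.
      have pb : psi (below f e) != 0.
        apply: xP; first exact: below_nonneg.
        by rewrite belowE ltcR fx subr0 lt_max e0.
      have := psi_order_zero (@below_nonneg f e) (@above_nonneg f e) (below_above0 f e).
      by move=> /eqP; rewrite mulf_eq0 (negbTE pb) => /eqP.
    have e1 : nonneg (e%:C *: cfun_cst 1) by apply: nonnegZ => //; exact: ltW.
    have a0 := @above_nonneg f e.
    rewrite /N -psiZ //; last exact: ltW.
    rewrite -[leRHS]addr0 -pa -psiD //.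
    apply: psi_mono => //; first exact: nonnegD.
    move=> y; suff : f y <= e%:C * 1 + above f e y by [].
    rewrite mulr1 aboveE -rmorphD /= (nonnegE y f0) lecR.
    by rewrite -lerBlDl le_max lexx.
  have N1 : 0 < N + 1 by rewrite ltr_wpDl.
  have := small (psi f / (N + 1)) (divr_gt0 pf N1).
  rewrite mulrAC ler_pdivlMr // ler_pM2l // leNgt ltrDl ltr01 //.
move=> f f0.
(* [f] and the constant [c] differ by functions vanishing at [x]. *)
pose c := complex.Re (f x); have c0 : 0 <= c by exact: nonneg_Re.
rewrite (nonnegE x f0) -rmorphM /=; congr (_%:C).
have E : f + below f c = c%:C *: cfun_cst 1 + above f c.
  apply: cfunP => y; suff : f y + below f c y = c%:C * 1 + above f c y by [].
  rewrite mulr1 (nonnegE y f0) belowE aboveE -!rmorphD /=; congr (_%:C).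
  have [le|lt] := leP (complex.Re (f y)) c.
    by rewrite max_l ?subr_ge0 // max_r ?subr_le0 // addr0 addrC subrK.
  by rewrite max_r ?subr_le0 ?ltW // max_l ?subr_ge0 ?ltW // addr0 addrC subrK.
have a0 := @above_nonneg f c; have b0 := @below_nonneg f c.
have := congr1 psi E; rewrite !psiD //; last exact: nonnegZ.
rewrite psiZ // (van (below f c)) // ?(van (above f c)) // ?addr0.
- by rewrite mulrC.
- by rewrite aboveE subrr maxxx.
- by rewrite belowE subrr maxxx.
Qed.

End order_zero_functional.

(** * From towers to approximately continuous equivariant maps *)

Section ultrafilter_limits.
Context {R : realType} (W : set_system nat) {UW : UltraFilter W}.

Lemma bounded_ultra_cvg (r : nat -> R) (M : R) :
  (forall n, 0 <= r n <= M) -> exists l : R, r n @[n --> W] --> l.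
Proof.
move=> rM; have PW : ProperFilter W by exact: ultra_proper.
have [|l [_ cl]] := @segment_compact R 0 M (r @ W).
  have : \forall n \near W, `[0, M]%classic (r n).
    by apply: nearW => n; rewrite /= in_itv /=; exact: rM.
  exact.
exists l => B lB.
have [//|WB] := in_ultra_setVsetC (r @^-1` B) UW.
by have [y [nBy By]] := cl (~` B) B WB lB.
Qed.

End ultrafilter_limits.

Section tower_points.
Context {R : realType} {G : compactGroupType} {n d : nat}.
Local Notation Z := (multi_join R G).
Local Notation CG := (cfun R (left_translation G)).
Local Notation A := (cfun R (Z n)).
Local Notation FA := (central_seq_alg A).
Local Notation alpha := (canonical_action R (Z n)).
Context (phi : 'I_d.+1 -> {linear CG -> FA}).
Hypothesis towers : rokhlin_towers alpha phi.

Lemma nonneg_positive (a : CG) : nonneg a -> exists b : CG, a = star b ** b.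
Proof.
move=> a0; have cs : continuous (fun x => Num.sqrt (complex.Re (a x))).
  by move=> x; apply: continuous_comp; [exact: continuous_Re|exact: sqrt_continuous].
exists (Cfun (continuous_realC cs)); apply: cfunP => x.
suff : a x = conjc (Num.sqrt (complex.Re (a x)))%:C * (Num.sqrt (complex.Re (a x)))%:C by [].
rewrite [X in X * _]conjc_real -rmorphM -expr2 sqr_sqrtr; first exact: nonnegE.
exact: nonneg_Re.
Qed.

(** By complete positivity the value of a tower on a nonnegative function is a
    square in the central sequence algebra, so it has a nonnegative representative. *)
Lemma tower_lift j (a : CG) : exists u : nat -> A, nonneg a ->
  exists hu : linf u, phi j a = central_class hu /\ forall m, nonneg (u m).
Proof.
have [a0|na] := pselect (nonneg a); last by exists (fun=> 0).
have [b ab] := nonneg_positive a0.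
have [|Y YE] := @rok_cp _ _ _ _ _ _ towers j 1%N (const_mx a).
  by exists (const_mx b) => i i'; rewrite big_ord1 !mxE.
have := YE 0 0; rewrite !mxE big_ord1; have [v [hv ->]] := central_classP (Y 0 0).
have hsv : linf (star v) := @sq_dom_star R _ (seq_quotient A) _ hv.
have hvv : linf (star v ** v) := @sq_domM R _ (seq_quotient A) _ _ hsv hv.
rewrite (central_class_star _ hsv) (central_classM _ _ hvv) => E.
exists (star v ** v) => _; exists hvv; split=> // m x.
suff : 0 <= conjc (v m x) * v m x by [].
by rewrite mulrC mul_conjC_ge0.
Qed.

Definition tower_lifts (U : 'I_d.+1 -> CG -> nat -> A) :=
  forall j a, nonneg a ->
    exists hu : linf (U j a), phi j a = central_class hu /\ forall m, nonneg (U j a m).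

Lemma tower_lifts_exist : exists U, tower_lifts U.
Proof.
have /choice[U UP] (ja : 'I_d.+1 * CG) := tower_lift ja.1 ja.2.
by exists (fun j a => U (j, a)) => j a; exact: (UP (j, a)).
Qed.

Lemma central_class0 (h : linf (0 : nat -> A)) : central_class h = 0.
Proof. by apply: sq_class_congr; exact: sq_class_congr. Qed.

Context (U : 'I_d.+1 -> CG -> nat -> A).
Hypothesis UP : tower_lifts U.

Lemma lift_equivariant j g a : nonneg a ->
  c0 (U j (translate g a) - (fun m => translate g (U j a m))).
Proof.
move=> a0; have ta0 : nonneg (translate g a) by move=> x; exact: a0.
have [hu [E _]] := UP j a0; have [hv [E' _]] := UP j ta0.
apply/(central_class_eq hv (linf_cact alpha g hu)).
rewrite -E' -central_class_act -E; exact: (rok_equivariant towers).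
Qed.

Lemma lift_add j a b : nonneg a -> nonneg b ->
  c0 (U j (a + b) - (U j a + U j b)).
Proof.
move=> a0 b0; have [hu [Ea _]] := UP j a0; have [hv [Eb _]] := UP j b0.
have [hw [Eab _]] := UP j (nonnegD a0 b0).
have huv : linf (U j a + U j b) := @sq_domD R _ (seq_quotient A) _ _ hu hv.
by apply/(central_class_eq hw huv); rewrite -Eab -central_classD -Ea -Eb linearD.
Qed.

Lemma lift_scale j (c : R) a : 0 <= c -> nonneg a ->
  c0 (U j (c%:C *: a) - c%:C *: U j a).
Proof.
move=> c0' a0; have [hu [Ea _]] := UP j a0; have [hw [Eca _]] := UP j (nonnegZ c0' a0).
have hcu : linf (c%:C *: U j a) := @sq_domZ R _ (seq_quotient A) _ _ hu.
by apply/(central_class_eq hw hcu); rewrite -Eca -(central_classZ hu) -Ea linearZ.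
Qed.

Lemma lift_order_zero j a b : nonneg a -> nonneg b -> a ** b = 0 ->
  c0 (U j a ** U j b).
Proof.
move=> a0 b0 ab; have [hu [Ea _]] := UP j a0; have [hv [Eb _]] := UP j b0.
have huv : linf (U j a ** U j b) := @sq_domM R _ (seq_quotient A) _ _ hu hv.
have h0 : linf (0 : nat -> A) := @sq_dom0 R _ (seq_quotient A).
have [/(_ _) + _] := central_class_eq huv h0; rewrite subr0; apply.
rewrite -central_classM -Ea -Eb (rok_order_zero towers) ?central_class0 //.
  exact: nonneg_positive.
exact: nonneg_positive.
Qed.

Lemma lift_sum1 : c0 ((fun m => \sum_j U j (cfun_cst 1) m) - (fun=> cfun_cst 1)).
Proof.
have h1 : linf (fun=> cfun_cst 1 : A) by exact: linf_cst.
have [hs E] : exists hs : linf (fun m => \sum_j U j (cfun_cst 1) m),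
    \sum_j phi j (cfun_cst 1) = central_class hs.
  elim: (index_enum _) => [|j s [hs E]].
    have hs : linf (fun m => \sum_(j <- [::]) U j (cfun_cst 1) m).
      by exists 0 => m; rewrite big_nil rnorm0.
    exists hs; rewrite big_nil -(central_class0 (@sq_dom0 R _ (seq_quotient A))).
    by apply: central_class_congr; apply/funext => m; rewrite big_nil.
  have [hu [Eu _]] := UP j nonneg1.
  have hD := @sq_domD R _ (seq_quotient A) _ _ hu hs.
  have eD : U j (cfun_cst 1) + (fun m => \sum_(i <- s) U i (cfun_cst 1) m) =
      (fun m => \sum_(i <- j :: s) U i (cfun_cst 1) m).
    by apply/funext => m; rewrite big_cons.
  have hs' : linf (fun m => \sum_(i <- j :: s) U i (cfun_cst 1) m) by rewrite -eD.
  by exists hs'; rewrite big_cons E Eu (central_classD _ _ hD); exact: central_class_congr.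
have := (rok_unit towers (central_class h1)).1; rewrite E.
have hm := @sq_domM R _ (seq_quotient A) _ _ hs h1.
rewrite (central_classM _ _ hm) => /central_class_eq.
rewrite (_ : _ ** _ = fun m => \sum_j U j (cfun_cst 1) m) //.
by apply/funext => m; apply: cfunP => x; exact: mulr1.
Qed.

(** For large [m], the values of the lifts at each [x] are close to the coordinates
    of a point of the iterated join. Otherwise, evaluate the lifts at a bad point
    for each [m]: in the limit along an ultrafilter they become order zero
    functionals of total mass 1, that is, the coordinates of a point. *)
Lemma approx_points (A' : seq CG) (e : R) (m0 : nat) : 0 < e ->
  (forall a, a \in A' -> nonneg a) ->
  exists2 m, (m0 <= m)%N & forall x, exists y : Z d, forall (j : 'I_d.+1) a, a \in A' ->
    rnorm (U j a m x - coord d j a y) <= e.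
Proof.
move=> e0 A0; apply: contrapT => nP.
have /choice[x xP] (m : nat) : exists x, (m0 <= m)%N -> forall y : Z d,
    ~ forall (j : 'I_d.+1) a, a \in A' -> rnorm (U j a m x - coord d j a y) <= e.
  have [mm|mm] := boolP (m0 <= m)%N; last first.
    have [||z _] := @multi_join_point R G n (fun j => (j == 0%N)%:R) (fun=> 1%g).
    - by move=> j; rewrite ler0n.
    - by rewrite big_ord_recl big1 ?addr0.
    by exists z.
  apply: contrapT => nx; apply: nP; exists m => // x; apply: contrapT => ny; apply: nx.
  by exists x => _ y Py; apply: ny; exists y.
have [W [UW sW]] := ultraFilterLemma (eventually_filter : ProperFilter \oo).
have PW : ProperFilter W by exact: ultra_proper.
have evW (w : nat -> A) : c0 w -> rnorm (w m (x m)) @[m --> W] --> (0 : R).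
  move=> w0; have {}w0 : rnorm (w m) @[m --> W] --> (0 : R).
    by apply: cvg_trans w0; exact: cvg_app.
  apply: (squeeze_cvgr _ (cvg_cst (0 : R)) w0); apply: nearW => m.
  by rewrite rnorm_ge0 (cfun_norm_ge (w m)).
pose r j a m := complex.Re (U j a m (x m)).
have rE j a m : nonneg a -> U j a m (x m) = (r j a m)%:C.
  by move=> a0; apply: nonnegE; have [_ [_]] := UP j a0.
have /choice[psi' psi'P] (ja : 'I_d.+1 * CG) : exists l : R, nonneg ja.2 ->
    r ja.1 ja.2 m @[m --> W] --> l.
  case: ja => j a /=; have [a0|na] := pselect (nonneg a); last by exists 0.
  have [[M UM] [_ U0]] := UP j a0.
  have [m|l rl] := @bounded_ultra_cvg R W UW (r j a) M; last by exists l.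
  rewrite nonneg_Re //=; apply: le_trans (UM m).
  apply: le_trans (ler_norm _) (le_trans (normc_Re_le _) (cfun_norm_ge _ _)).
pose psi j a := psi' (j, a).
have psiP j a : nonneg a -> r j a m @[m --> W] --> psi j a by exact: (psi'P (j, a)).
have lim0 (s : nat -> R) (l : R) (w : nat -> A) : c0 w ->
    (forall m, `|s m| = rnorm (w m (x m))) -> s m @[m --> W] --> l -> l = 0.
  move=> w0 sw sl; apply/eqP; rewrite -normr_eq0; apply/eqP.
  have : `|s m| @[m --> W] --> `|l| by exact: cvg_norm.
  rewrite (_ : (fun m => `|s m|) = fun m => rnorm (w m (x m))); last exact/funext.
  by move=> /(cvg_unique (@Rhausdorff R)); apply; exact: evW.
have /choice[tg tgP] (j : 'I_d.+1) : exists tg : R * G,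
    0 <= tg.1 /\ forall a, nonneg a -> (psi j a)%:C = tg.1%:C * a tg.2.
  have [||||t [g tgE]] := @order_zero_functional R (left_translation G) (psi j) _ _ _ _ 1%g;
    last by exists (t, g).
  - move=> a b a0 b0; apply/eqP; rewrite -subr_eq0; apply/eqP.
    have ab0 := nonnegD a0 b0.
    apply: (lim0 (fun m => r j (a + b) m - (r j a m + r j b m)) _ _ (lift_add j a0 b0)).
      move=> m; rewrite -rnorm_realC; congr rnorm.
      by rewrite rmorphB rmorphD /= -!rE.
    by apply: cvgB; [exact: psiP|apply: cvgD; exact: psiP].
  - move=> c a c0' a0; apply/eqP; rewrite -subr_eq0; apply/eqP.
    have ca0 := nonnegZ c0' a0.
    apply: (lim0 (fun m => r j (c%:C *: a) m - c * r j a m) _ _ (lift_scale j c0' a0)).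
      move=> m; rewrite -rnorm_realC; congr rnorm.
      by rewrite rmorphB rmorphM /= -!rE.
    by apply: cvgB; [exact: psiP|apply: cvgMr; exact: psiP].
  - move=> a a0; have [_ [_ U0]] := UP j a0.
    apply: (cvgr_to_ge (psiP j a a0)).
    by apply: nearW => m; exact: nonneg_Re.
  - move=> a b a0 b0 ab.
    apply: (lim0 (fun m => r j a m * r j b m) _ _ (lift_order_zero j a0 b0 ab)).
      move=> m; rewrite -rnorm_realC; congr rnorm.
      by rewrite rmorphM /= -!rE.
    by apply: cvgM; exact: psiP.
pose t j := (tg (inord j)).1 *+ (j <= d)%N; pose g j := (tg (inord j)).2.
have psi1 j : psi j (cfun_cst 1) = (tg j).1.
  have := (tgP j).2 _ nonneg1; rewrite mulr1; exact: complexI.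
have sum1 : \sum_(j < d.+1) (tg j).1 = 1.
  apply/eqP; rewrite -subr_eq0; apply/eqP.
  apply: (lim0 (fun m => \sum_j r j (cfun_cst 1) m - 1) _ _ lift_sum1).
    move=> m; rewrite -rnorm_realC; congr rnorm.
    rewrite rmorphB rmorph_sum /=; congr (_ - _).
    rewrite (eq_bigr (fun j => U j (cfun_cst 1) m (x m))) => [|j _].
      exact/esym/cfun_sumE.
    by rewrite rE //; exact: nonneg1.
  apply: cvgB; last exact: cvg_cst.
  elim: (index_enum _) => [|j s IH].
    rewrite big_nil (_ : (fun m => _) = fun=> 0); first exact: cvg_cst.
    by apply/funext => m; rewrite big_nil.
  rewrite big_cons (_ : (fun m => _) =
    fun m => r j (cfun_cst 1) m + \sum_(i <- s) r i (cfun_cst 1) m).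
    by apply: cvgD => //; rewrite -psi1; apply: psiP; exact: nonneg1.
  by apply/funext => m; rewrite big_cons.
have [||y yE] := @multi_join_point R G d t g.
- by move=> j; rewrite mulrn_wge0 // (tgP _).1.
- rewrite -sum1; apply: eq_bigr => j _.
  by rewrite /t inord_val -ltnS ltn_ord.
have near_a (j : 'I_d.+1) a : nonneg a -> \forall m \near W,
    rnorm (U j a m (x m) - coord d j a y) <= e.
  move=> a0; have /cvgrPdist_le/(_ e e0) := psiP j a a0.
  have jd : (j <= d)%N by rewrite -ltnS.
  apply: filterS => m; rewrite yE // /t /g inord_val jd mulr1n.
  by rewrite -(tgP j).2 // rE // -rmorphB rnorm_realC distrC.
have near_A (j : 'I_d.+1) : \forall m \near W, forall a, a \in A' ->
    rnorm (U j a m (x m) - coord d j a y) <= e.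
  elim: (A') A0 => [|a s IH] s0; first by apply: nearW.
  have : \forall m \near W, rnorm (U j a m (x m) - coord d j a y) <= e.
    by apply: near_a; apply: s0; rewrite mem_head.
  have : \forall m \near W, forall a, a \in s -> rnorm (U j a m (x m) - coord d j a y) <= e.
    by apply: IH => b bs; apply: s0; rewrite inE bs orbT.
  apply: filterS2 => m hs ha b; rewrite inE => /orP[/eqP ->//|]; exact: hs.
have Wm0 : \forall m \near W, (m0 <= m)%N by apply: sW; exists m0.
have near_all : \forall m \near W, forall (j : 'I_d.+1) a, a \in A' ->
    rnorm (U j a m (x m) - coord d j a y) <= e by exact: filter_forall.
have [m [m0m mP]] := filter_ex (filterI Wm0 near_all).
by apply: (xP m m0m y) => j a aA; exact: mP.
Qed.

End tower_points.

Section approximable.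
Context {R : realType} {G : compactGroupType}.
Local Notation Z := (multi_join R G).
Local Notation CG := (cfun R (left_translation G)).

(** There are maps from the join of [r.+1] copies to that of [r'.+1] copies,
    equivariant for [h], and as close as wanted to being continuous, as seen by
    finitely many of the functions [coord r' j a]. Unlike continuous equivariant
    maps, they can be read off Rokhlin towers for any compact group, they can be
    corrected on each orbit separately, and they are still good enough to
    transport fine chains. *)
Definition approximable (h : G) (r r' : nat) :=
  forall (A : seq CG) (e : R), 0 < e -> (forall a, a \in A -> nonneg a) ->
  exists sigma : Z r -> Z r', (forall x, sigma (gact h x) = gact h (sigma x)) /\
    forall j a, a \in A -> exists u : cfun R (Z r),
      forall x, rnorm (coord r' j a (sigma x) - u x) <= e.

Lemma expg_modn (h : G) q i : (h ^+ q = 1)%g -> (h ^+ (i %% q) = h ^+ i)%g.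
Proof.
by move=> hq; rewrite {2}(divn_eq i q) mulnC expgnDr expgnA hq expg1n mul1g.
Qed.

Lemma multi_join_free_inj r g g' (x : Z r) : gact g x = gact g' x -> g = g'.
Proof.
move=> gx; apply/(@mulgI _ g'^-1%g); rewrite mulVg.
by apply: (@multi_join_free R G r _ x); rewrite gactM gx -gactM mulVg gact1.
Qed.

Lemma orbit_representatives (h : G) q r : (0 < q)%N -> (h ^+ q = 1)%g ->
  exists (rep : Z r -> Z r) (idx : Z r -> nat), forall x,
    [/\ (idx x < q)%N, x = gact (h ^+ idx x)%g (rep x) & rep (gact h x) = rep x].
Proof.
move=> q0 hq; pose orb (x : Z r) : set (Z r) := [set z | exists i, z = gact (h ^+ i)%g x].
have [||x0 _] := @multi_join_point R G r (fun j => (j == 0%N)%:R) (fun=> 1%g).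
- by move=> j; rewrite ler0n.
- by rewrite big_ord_recl big1 ?addr0.
have /choice[pick pickP] (S : set (Z r)) : exists z, forall y, S y -> S z.
  have [[y Sy]|nS] := pselect (S !=set0); first by exists y.
  by exists x0 => y Sy; case: nS; exists y.
have orbh x : orb (gact h x) = orb x.
  apply/seteqP; split=> z [i ->].
    by exists i.+1; rewrite -gactM -expgSr.
  exists (i + q.-1)%N; rewrite -gactM -expgSr -addnS prednK //.
  by rewrite expgnDr hq mulg1.
have /choice[idx idxP] x : exists i, (i < q)%N /\ x = gact (h ^+ i)%g (pick (orb x)).
  have [i ->] : orb x (pick (orb x)).
    by apply: (pickP _ x); exists 0%N; rewrite expg0 gact1.
  exists ((q - i %% q) %% q)%N; split; first by rewrite ltn_pmod.
  rewrite -gactM expg_modn // -[X in (_ * X)%g](expg_modn _ hq) -expgnDr.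
  have iq : (i %% q <= q)%N by rewrite ltnW ?ltn_pmod.
  by rewrite subnK // hq gact1.
by exists (fun x => pick (orb x)), idx => x; have [ix xE] := idxP x; split=> //; rewrite orbh.
Qed.

(** The nearby points given by the towers depend on [x] in an almost equivariant
    way. Keeping the choice at one point of each orbit, and translating it along the
    orbit, makes it equivariant without spoiling the estimates. *)
Lemma towers_approximable (h : G) q n d
    (phi : 'I_d.+1 -> {linear CG -> central_seq_alg (cfun R (Z n))}) :
  rokhlin_towers (canonical_action R (Z n)) phi -> (0 < q)%N -> (h ^+ q = 1)%g ->
  approximable h n d.
Proof.
move=> towers q0 hq A e e0 A0; have e20 : 0 < e / 2 by rewrite divr_gt0.
have [U UP] := tower_lifts_exist towers.
pose A' := [seq translate (h ^+ i)^-1%g a | a <- A, i <- iota 0 q].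
have A'0 a : a \in A' -> nonneg a.
  by move=> /allpairsP[[b i] [/= bA _ ->]] x; exact: (A0 b bA _).
have eq_act : \forall m \near \oo, forall (j : 'I_d.+1) (i : 'I_q) a, a \in A ->
    forall x, rnorm (U j (translate (h ^+ i)^-1%g a) m x -
                     translate (h ^+ i)^-1%g (U j a m) x) <= e / 2.
  apply: filter_forall => j; apply: filter_forall => i.
  elim: (A) A0 => [|a s IH] s0; first exact: nearW.
  have a0 : nonneg a by apply: s0; rewrite mem_head.
  have /cvgrPdist_le/(_ _ e20) := lift_equivariant towers UP j (h ^+ i)^-1%g a0.
  have : \forall m \near \oo, forall b, b \in s ->
    forall x, rnorm (U j (translate (h ^+ i)^-1%g b) m x -
                     translate (h ^+ i)^-1%g (U j b m) x) <= e / 2.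
    by apply: IH => b bs; apply: s0; rewrite inE bs orbT.
  apply: filterS2 => m hs ha b; rewrite inE => /orP[/eqP -> x|bs]; last exact: hs.
  move: ha; rewrite sub0r normrN ger0_norm ?rnorm_ge0 //; apply: le_trans.
  exact: (cfun_norm_ge (U j (translate (h ^+ i)^-1%g a) m -
                        translate (h ^+ i)^-1%g (U j a m)) x).
have [m0 _ m0P] := eq_act.
have [m m0m mP] := approx_points towers UP m0 e20 A'0.
have /choice[s0 s0P] := mP.
have [rep [idx rP]] := @orbit_representatives h q n q0 hq.
exists (fun x => gact (h ^+ idx x)%g (s0 (rep x))); split.
  move=> x; have [_ xE rh] := rP x; have [_ hxE _] := rP (gact h x).
  rewrite rh in hxE *; rewrite -gactM; congr (gact _ _).
  apply: (@multi_join_free_inj n _ _ (rep x)).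
  by rewrite -hxE gactM -xE.
move=> j a aA; have [jd|jd] := leqP j d; last first.
  by exists 0 => x; rewrite coord_out // [X in rnorm X]subrr rnorm0 ltW.
have jE : j = (inord j : 'I_d.+1) :> nat by rewrite inordK.
exists (U (inord j) a m) => x; have [ix xE rh] := rP x.
set i := idx x in ix xE *; set y := rep x in xE *.
have -> : coord d j a (gact (h ^+ i)%g (s0 y)) = coord d j (translate (h ^+ i)^-1%g a) (s0 y).
  by rewrite /coord coord_equivariant invgK.
rewrite -(subrKA (U (inord j) (translate (h ^+ i)^-1%g a) m y)).
apply: le_trans (rnormD _ _) _; rewrite [leRHS](splitr e) lerD //.
  rewrite rnorm_distC {2}jE; apply: s0P.
  by apply/allpairsP; exists (a, i); split=> //=; rewrite mem_iota.
have := m0P m m0m (inord j) (Ordinal ix) a aA y.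
by rewrite [translate _ _ y]/(U (inord j) a m (gact _ y)) invgK -xE.
Qed.


(** Take the join with the identity of [G]: the new coordinates are the old ones
    times [t], and [1 - t] times the last entry, which is unchanged. *)
Lemma approximable_join (h : G) r r' :
  approximable h r r' -> approximable h r.+1 r'.+1.
Proof.
move=> app A e e0 A0; have [sigma [sh sA]] := app A e e0 A0.
have /choice[dec decP] (z : Z r.+1) : exists p : Z r * G * unit_interval R,
    z = join_point p.1.1 p.1.2 p.2.
  by have [x [y [t ->]]] := join_pointP z; exists (x, y, t).
pose tau z : Z r'.+1 := join_point (sigma (dec z).1.1) (dec z).1.2 (dec z).2.
have tauE x y t : tau (join_point x y t) = join_point (sigma x) y t.
  rewrite /tau; have /join_piP/asboolP[/= e1 e2] := decP (join_point x y t).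
  apply/esym/join_piP/asboolP; split=> //=.
  case: e2 => [[<- <-]|[t0 <-]|[t1 <-]]; [exact: Or31|exact: Or32|exact: Or33].
exists tau; split=> [z|j a aA].
  have [x [y [t ->]]] := join_pointP z.
  by rewrite gact_join_point !tauE sh gact_join_point.
have [->|jr] := eqVneq j r'.+1.
  exists (coord r.+1 r.+1 a) => z; have [x [y [t ->]]] := join_pointP z.
  by rewrite tauE /coord !weighted_coordE !eqxx subrr rnorm0 ltW.
have [u uP] := sA j a aA; exists (join_left (@continuous_idfun R) erefl u) => z.
have [x [y [t ->]]] := join_pointP z.
rewrite tauE /coord weighted_coordE (negbTE jr) [X in _ - X]join_leftE -mulrBr.
rewrite [leLHS](rnormZ ((ival t)%:C : R[i]^o)) [X in X * _]rnorm_realC.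
have /andP[t0 t1] := ival01 t; rewrite ger0_norm // -[leRHS]mul1r.
by apply: ler_pM; rewrite ?rnorm_ge0 //; exact: uP.
Qed.

End approximable.

(** * Fine chains in the iterated joins *)

Section prisms.
Context {S T : eqType} {K : comNzRingType}.
Implicit Types (p : S -> T) (f g : seq T -> K) (s : seq S).

(** The value of [f] on the prism between the images of [s] by [p] and by [p']: the
    alternating sum of the [f (p x_0, .., p x_i, p' x_i, .., p' x_k)]. *)
Fixpoint prism (p p' : S -> T) f s : K :=
  if s is x :: s' then
    f (p x :: map p' (x :: s')) - prism p p' (fun t => f (p x :: t)) s'
  else 0.

Lemma prismB (p p' : S -> T) f g s :
  prism p p' (fun t => f t - g t) s = prism p p' f s - prism p p' g s.
Proof.
elim: s f g => [|x s IH] f g /=; first by rewrite subr0.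
by rewrite IH !opprD !opprK addrACA.
Qed.

Lemma prism_support (p p' : S -> T) f g s :
  (forall t, size t = (size s).+1 -> {subset t <= map p s ++ map p' s} -> f t = g t) ->
  prism p p' f s = prism p p' g s.
Proof.
elim: s f g => [//|x s IH] f g fg /=; congr (_ - _).
  apply: fg => [|y]; first by rewrite /= size_map.
  by rewrite inE mem_cat => /orP[/eqP->|->]; rewrite ?mem_head ?orbT.
apply: IH => t ts tsub; apply: fg; first by rewrite /= ts.
move=> y; rewrite inE => /orP[/eqP ->|/tsub]; first by rewrite mem_cat mem_head.
by rewrite !mem_cat !inE => /orP[]->; rewrite ?orbT.
Qed.

Lemma prism_homotopy (p p' : S -> T) f s :
  prism p p' (cobound f) s + cobound (prism p p' f) s = f (map p' s) - f (map p s).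
Proof.
elim: s f => [|x s IH] f; first by rewrite /= addr0 subrr.
rewrite /= prismB coboundB.
have := IH (fun t => f (p x :: t)).
have <- : cobound (fun t => f [:: p x, p' x & map p' t]) s =
    cobound (fun t => f [:: p x, p' x & t]) (map p' s) by exact: cobound_map.
set a := prism _ _ (cobound _) s; set b := cobound (prism _ _ _) s.
set c := cobound _ s; set P := prism p p' f s => ab.
by transitivity (f (p' x :: map p' s) - f (p x :: map p' s) + (a + b));
  [|rewrite ab]; ring.
Qed.

(** The value of [f] on a cone over the image of [s] by [p L], with apex [b]: when
    [p 0] is constantly [b], the prisms between consecutive maps join this image to
    the apex by small steps, in place of a subdivision of the cone. *)
Definition path_cone (b : T) (L : nat) (p : nat -> S -> T) f s : K :=
  \sum_(i < L) prism (p i) (p i.+1) f s + f (b :: map (p 0%N) s).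

Lemma path_coneB b L (p : nat -> S -> T) f g s :
  path_cone b L p (fun t => f t - g t) s = path_cone b L p f s - path_cone b L p g s.
Proof.
rewrite /path_cone; under eq_bigr do rewrite prismB.
by rewrite sumrB opprD addrACA.
Qed.

Lemma path_cone_homotopy b L (p : nat -> S -> T) f s : (forall x, p 0%N x = b) ->
  path_cone b L p (cobound f) s = f (map (p L) s) - cobound (path_cone b L p f) s.
Proof.
move=> pb; apply/eqP; rewrite eq_sym subr_eq eq_sym; apply/eqP.
have -> : cobound (path_cone b L p f) s =
    \sum_(i < L) cobound (prism (p i) (p i.+1) f) s +
    cobound (fun t => f (b :: map (p 0%N) t)) s.
  by rewrite -cobound_sum -coboundD.
rewrite /path_cone (cobound_map (p 0%N) (fun t => f (b :: t))) addrACA -big_split /=.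
under eq_bigr do rewrite prism_homotopy.
rewrite -(big_mkord xpredT (fun i => f (map (p i.+1) s) - f (map (p i) s))).
by rewrite telescope_sumr //; ring.
Qed.

Lemma path_cone_support b L (p : nat -> S -> T) f g s : (forall x, p 0%N x = b) ->
  (forall t i, (i < L)%N -> size t = (size s).+1 ->
     {subset t <= map (p i) s ++ map (p i.+1) s} -> f t = g t) ->
  f (b :: map (p 0%N) s) = g (b :: map (p 0%N) s) ->
  path_cone b L p f s = path_cone b L p g s.
Proof.
move=> pb fg fgb; rewrite /path_cone fgb; congr (_ + _); apply: eq_bigr => i _.
by apply: prism_support => t; exact: fg.
Qed.

End prisms.

Section fine_chains.
Context {R : realType} {G : compactGroupType}.
Local Notation Z := (multi_join R G).

Definition close_on (Y : compactHausdorffType) (F : seq (cfun R Y)) (e : R) (s : seq Y) :=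
  forall f x y, f \in F -> x \in s -> y \in s -> rnorm (f x - f y) <= e.

(** The join of [r.+1] copies of [G] carries arbitrarily fine cyclic chains for the
    action of [h]. Fineness is measured by finitely many continuous functions. *)
Definition fine_chains (h : G) q r k := forall (F : seq (cfun R (Z r))) (e : R),
  0 < e -> exists c : nat -> (seq (Z r) -> 'Z_q) -> 'Z_q,
    cyclic_chains q (gact h) (close_on F e) k c.

Lemma fine_chains0 h q : fine_chains h q 0 0.
Proof.
move=> F e e0; exists (fun _ f => f [:: 1%g : Z 0]); split=> //.
  by exists (1%g : Z 0).
move=> [|//] f g _ fg; apply: (fg [:: 1%g : Z 0]) => // u x y _; rewrite !inE => /eqP -> /eqP ->.
by rewrite subrr rnorm0 ltW.
Qed.

Lemma join_point_continuous k (y : G) :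
  continuous (fun p : Z k * unit_interval R => join_point p.1 y p.2).
Proof.
have c1 : continuous (fun p : Z k * unit_interval R => (p.1, y)).
  by apply: continuous_pair => p; [exact: cvg_fst|exact: cvg_cst].
have c2 : continuous (fun p : Z k * unit_interval R => (p.1, y, p.2)).
  by apply: continuous_pair => // p; exact: cvg_snd.
move=> p; apply: (continuous_comp (f := fun p => (p.1, y, p.2))
  (g := @join_pi R (Z k) (left_translation G))); first exact: c2.
exact: join_pi_continuous.
Qed.

Lemma segment_uniform k (f : cfun R (Z k.+1)) (y : G) (e : R) : 0 < e ->
  \forall L \near \oo, forall x t t', `|ival t - ival t'| <= L.+1%:R^-1 ->
    rnorm (f (join_point x y t) - f (join_point x y t')) <= e.
Proof.
move=> e0; pose Phi (p : Z k * unit_interval R) := f (join_point p.1 y p.2).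
have cPhi : continuous Phi.
  move=> p; apply: (continuous_comp (g := f)
    (f := fun p : Z k * unit_interval R => join_point p.1 y p.2)).
    exact: join_point_continuous.
  exact: cfun_continuous.
have cXI : compact [set: Z k * unit_interval R].
  rewrite -setXTT; apply: compact_setX; [exact: compactT|exact: unit_interval_compact].
have /compact_near_coveringP := cXI.
move=> /(_ nat \oo (fun L p => forall t', `|ival p.2 - ival t'| <= L.+1%:R^-1 ->
  rnorm (Phi p - Phi (p.1, t')) <= e)) cov.
have [p _|L0 _ LP] := cov _; last first.
  by exists L0 => // L LL x t t'; exact: (LP L LL (x, t) I).
have e20 : 0 < e / 2 by rewrite divr_gt0.
have /(@cvg_rnormP _ _ _ _ (nbhs_filter p))/(_ _ e20) := cPhi p.
case: p => x t /= [[A B] [/= Ax Bt] AB].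
have [b b0 Bb] : exists2 b, 0 < b & forall t', `|ival t - ival t'| < b -> B t'.
  have [_ [[O oO <-] Ot OB]] := Bt.
  have /nbhs_ballP[b /= b0 bO] := open_nbhs_nbhs (conj oO Ot).
  by exists b => // t' tt'; apply: OB; apply: bO; rewrite -ball_normE.
have b20 : 0 < b / 2 by rewrite divr_gt0.
have nearL : \forall L \near \oo, L.+1%:R^-1 < b / 2.
  by have /cvgrPdist_lt/(_ _ b20) := @cvg_harmonic R; apply: filterS => L;
    rewrite /harmonic sub0r normrN ger0_norm // invr_ge0.
exists ([set p | A p.1 /\ `|ival t - ival p.2| < b / 2], [set L | L.+1%:R^-1 < b / 2]).
  split=> //=; exists (A, [set t' | `|ival t - ival t'| < b / 2]) => /=.
    by split=> //; have /cvgrPdist_lt/(_ _ b20) := @ival_continuous R t.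
  by move=> [x' t'] [].
move=> [[x' t1] L] [/= [Ax' tt1] Lb] t' t1t'.
have B1 : B t1 by apply: Bb; rewrite (lt_le_trans tt1) // ler_pdivrMr // ler_pMr // ler1n.
have B2 : B t'.
  apply: Bb; rewrite -(subrKA (ival t1)) (le_lt_trans (ler_normD _ _)) //.
  by rewrite [ltRHS](splitr b) ltrD // (le_lt_trans t1t').
have h1 := AB (x', t1) (conj Ax' B1); have h2 := AB (x', t') (conj Ax' B2).
rewrite -(subrKA (Phi (x, t))) (le_trans (rnormD _ _)) // [leRHS](splitr e).
by rewrite lerD // rnorm_distC.
Qed.

Lemma iter_gact (X : gspace G) (h : G) j (x : X) :
  iter j (gact h) x = gact (h ^+ j)%g x.
Proof. by elim: j => [|j IH]; rewrite ?expg0 ?gact1 //= IH -gactM -expgS. Qed.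

(** The cycle which the chain of degree [k.+1] has to bound lies in the join of [k.+1]
    copies of [G]. In the next join this cycle bounds its cone, with apex the unit of
    the last copy. *)
Lemma fine_chains_join h q k : (1 < q)%N -> (h ^+ q = 1)%g ->
  fine_chains h q k k -> fine_chains h q k.+1 k.+1.
Proof.
move=> q1 hq IH F e e0; have e20 : 0 < e / 2 by rewrite divr_gt0.
have : \forall L \near \oo, forall f, f \in F ->
    forall (x : Z k) t t', `|ival t - ival t'| <= L.+1%:R^-1 ->
    rnorm (f (join_point x 1%g t) - f (join_point x 1%g t')) <= e / 2.
  elim: (F) => [|f s IHs]; first exact: nearW.
  apply: filterS2 (segment_uniform f 1%g e20) IHs => L hf hs u.
  by rewrite inE => /orP[/eqP ->|]; [exact: hf|exact: hs].
move=> [L _ /(_ L (leqnn L)) unif]; pose N := L.+1.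
have /choice[tt ttP] (i : nat) : exists t : unit_interval R,
    (i <= N)%N -> ival t = i%:R / N%:R.
  have [iN|iN] := leqP i N; last first.
    by have [|t _] := @ival_surj R 0; [rewrite lexx ler01|exists t].
  have [|t tE] := @ival_surj R (i%:R / N%:R); last by exists t.
  by rewrite divr_ge0 //= ler_pdivrMr ?ltr0n // mul1r ler_nat.
pose p i (x : Z k) : Z k.+1 := join_point x 1%g (tt i).
have step f x i : f \in F -> (i < N)%N -> rnorm (f (p i x) - f (p i.+1 x)) <= e / 2.
  move=> fF iN; apply: unif => //; rewrite !ttP ?(ltnW iN) // -mulrBl.
  by rewrite -opprB -natrB // subSnn mulN1r normrN ger0_norm // invr_ge0.
have [||x0 _] := @multi_join_point R G k (fun j => (j == 0%N)%:R) (fun=> 1%g).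
- by move=> j; rewrite ler0n.
- by rewrite big_ord_recl big1 ?addr0.
have p0 x : p 0%N x = p 0%N x0.
  by apply/join_piP/asboolP; split=> //=; apply: Or32; rewrite ttP // mul0r.
have pN x : p N (gact h x) = gact h (p N x).
  rewrite gact_join_point; apply/join_piP/asboolP; split=> //=; apply: Or33.
  by rewrite ttP // divff // pnatr_eq0.
have /choice[pull pullP] (fij : cfun R (Z k.+1) * nat * nat) :
    exists u : cfun R (Z k), forall x, u x = fij.1.1 (p fij.1.2 (gact (h ^+ fij.2)%g x)).
  case: fij => -[f i] j /=.
  have cu : continuous (fun x => f (p i (gact (h ^+ j)%g x))).
    have c1 : continuous (fun x : Z k => (gact (h ^+ j)%g x, tt i)).
      by apply: continuous_pair; [exact: gact_continuous_r|move=> x; exact: cvg_cst].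
    have c2 : continuous (fun x : Z k => join_point (gact (h ^+ j)%g x) 1%g (tt i)).
      move=> x; apply: (continuous_comp (g := fun p => join_point p.1 1%g p.2)
        (f := fun x : Z k => (gact (h ^+ j)%g x, tt i))); first exact: c1.
      exact: join_point_continuous.
    move=> x; apply: (continuous_comp (g := f)
      (f := fun x : Z k => join_point (gact (h ^+ j)%g x) 1%g (tt i))); first exact: c2.
    exact: cfun_continuous.
  by exists (Cfun cu).
have pullE f i j x : pull (f, i, j) x = f (p i (gact (h ^+ j)%g x)) by exact: pullP (f, i, j) x.
pose fi := [seq (f, i) | f <- F, i <- iota 0 N.+1].
(* Fineness with respect to [F'] controls the images of a sequence by all the
   maps [p i], and by the powers of [h] in the operator [periodic]. *)
pose F' := [seq pull (x, j) | x <- fi, j <- iota 0 q].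
have pullF' f i j : f \in F -> (i <= N)%N -> (j < q)%N -> pull (f, i, j) \in F'.
  move=> fF iN jq; apply/allpairsP; exists ((f, i), j); split; rewrite ?mem_iota //.
  by apply/allpairsP; exists (f, i); split; rewrite ?mem_iota.
have q0 : (0 < q)%N by exact: ltnW.
have close s j i t : close_on F' (e / 2) s -> (i < N)%N ->
    {subset t <= map (p i) (map (iter j (gact h)) s) ++
                 map (p i.+1) (map (iter j (gact h)) s)} -> close_on F e t.
  move=> cs iN ts f y y' fF /ts yt /ts yt'.
  have form z : z \in map (p i) (map (iter j (gact h)) s) ++
      map (p i.+1) (map (iter j (gact h)) s) ->
      exists2 x, x \in s & let w := gact (h ^+ (j %% q))%g x in
        z = p i w \/ z = p i.+1 w.
    rewrite mem_cat -!map_comp => /orP[]/mapP[x xs ->]; exists x => //=;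
      rewrite iter_gact expg_modn //; [by left|by right].
  have [[x xs /= yE] [x' xs' /= yE']] := (form y yt, form y' yt').
  have [i2 i2N yE2] : exists2 i2, (i2 <= N)%N &
      rnorm (f y - f (p i2 (gact (h ^+ (j %% q))%g x))) <= e / 2 /\
      y' = p i2 (gact (h ^+ (j %% q))%g x').
    have le0 (z : R[i]) : rnorm (z - z) <= e / 2 by rewrite subrr rnorm0 ltW.
    case: yE' => yE'.
      exists i; [exact: ltnW|split=> //; case: yE => ->; first exact: le0].
      by rewrite rnorm_distC; exact: step.
    by exists i.+1 => //; split=> //; case: yE => ->; [exact: step|exact: le0].
  have [yE3 ->] := yE2.
  rewrite -(subrKA (f (p i2 (gact (h ^+ (j %% q))%g x)))) (le_trans (rnormD _ _)) //.
  have : rnorm (pull (f, i2, (j %% q)%N) x - pull (f, i2, (j %% q)%N) x') <= e / 2.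
    by apply: cs => //; apply: pullF' => //; rewrite ltn_pmod.
  by rewrite !pullE [in X in _ -> X](splitr e); exact: lerD.
have [c cc] := IH F' (e / 2) e20.
have NL : (L < N)%N by [].
have [] := push_chains (P := close_on F' (e / 2)) (Q := close_on F e) pN _ cc.
  move=> s cs; apply: (close s 0%N L) => // y ys.
  by rewrite mem_cat (eq_map (_ : iter 0 (gact h) =1 id)) // map_id ys orbT.
move=> vN bN sN subN.
pose K := path_cone (p 0%N x0) N p : (seq (Z k.+1) -> 'Z_q) -> seq (Z k) -> 'Z_q.
exists (fun i f => if (i <= k)%N then c i (fun s => f (map (p N) s))
                   else c k (periodic q (gact h) k.+1 (K f))).
split.
- exact: vN.
- move=> i f; rewrite ltnS => ik; rewrite ik; have [ik'|] := ltnP i k.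
    by rewrite bN.
  move=> ki; have {ki ik} -> : i = k by apply/eqP; rewrite eqn_leq ik.
  rewrite (chain_support cc (g := fun s =>
    periodic q (gact h) k.+1 (fun t => f (map (p N) t)) s -
    periodic q (gact h) k.+1 (cobound (K f)) s)) // => [|s _ _]; last first.
    rewrite -periodicB; apply: eq_periodic => j; exact: path_cone_homotopy.
  rewrite (chain_sub cc) // [X in _ - X](_ : _ = 0) ?subr0.
    apply: (chain_support cc) => // s _ _; exact: periodic_map.
  have hq' x : iter q (gact h) x = x :> Z k by rewrite iter_gact hq gact1.
  rewrite -[RHS](chain_cycle (K f) hq' cc).
  by apply: (chain_support cc) => // s _ _; rewrite cobound_periodic.
- move=> i f g ik fg; have [ik'|ki] := leqP i k; first exact: sN.
  have {ki ik} ik : i = k.+1 by apply/eqP; rewrite eqn_leq ik.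
  apply: (chain_support cc) => // s sk cs; apply: eq_periodic => j.
  apply: path_cone_support => // [t i' i'N ts tsub|].
    by apply: fg; [rewrite ts size_map sk ik|exact: close tsub].
  apply: fg; first by rewrite /= !size_map sk ik.
  have const y : y \in p 0%N x0 :: map (p 0%N) (map (iter j (gact h)) s) -> y = p 0%N x0.
    by rewrite inE => /orP[/eqP //|/mapP[x _ ->]]; exact: p0.
  by move=> u y y' _ /const -> /const ->; rewrite subrr rnorm0 ltW.
- move=> i f g ik; have [ik'|_] := leqP i k; first exact: subN.
  rewrite -(chain_sub cc) //; apply: (chain_support cc) => // s _ _.
  rewrite -periodicB; apply: eq_periodic => j; exact: path_coneB.
Qed.

End fine_chains.

(** * The lower bound *)

Section lower_bound.
Context {R : realType} {G : compactGroupType}.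
Local Notation Z := (multi_join R G).
Local Notation CG := (cfun R (left_translation G)).

Lemma coord_control_seq k (F : seq (cfun R (Z k))) (e : R) : 0 < e ->
  exists (A : seq CG) (b : R), [/\ 0 < b, forall a, a \in A -> nonneg a &
    forall z z', (forall j a, a \in A ->
      rnorm (coord k j a z - coord k j a z') <= b) ->
    forall f, f \in F -> rnorm (f z - f z') <= e].
Proof.
move=> e0; elim: F => [|f F [A [b [b0 A0 HA]]]]; first by exists [::], 1.
have [B [c [c0 B0 HB]]] := coord_control f e0.
exists (A ++ B), (Num.min b c); split=> [|a|z z' close u].
- by rewrite lt_min b0.
- by rewrite mem_cat => /orP[/A0//|aB x]; exact: B0.
rewrite inE => /orP[/eqP ->|uF].
  apply: HB => j a aB; apply: (le_trans (close j a _)).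
    by rewrite mem_cat aB orbT.
  by rewrite ge_min lexx orbT.
apply: HA uF => j a aA; apply: (le_trans (close j a _)); first by rewrite mem_cat aA.
by rewrite ge_min lexx.
Qed.

(** Chains which are fine for the functions close to the coordinates of [sigma]
    have images by [sigma] which are fine for the coordinates, and these control all
    the continuous functions. *)
Lemma fine_chains_transport (h : G) q r r' k :
  @approximable R G h r r' -> @fine_chains R G h q r k -> @fine_chains R G h q r' k.
Proof.
move=> app chains F e e0.
have [A [b [b0 A0 HA]]] := coord_control_seq F e0.
have b30 : 0 < b / 3 by rewrite divr_gt0.
have [sigma [sh sA]] := app A (b / 3) b30 A0.
have /choice[u uP] (ja : nat * CG) : exists u : cfun R (Z r), ja.2 \in A ->
    forall x, rnorm (coord r' ja.1 ja.2 (sigma x) - u x) <= b / 3.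
  have [aA|aA] := boolP (ja.2 \in A); last by exists 0.
  by have [u uP] := sA ja.1 ja.2 aA; exists u.
have [c cc] := chains [seq u (j, a) | j <- iota 0 r'.+1, a <- A] (b / 3) b30.
exists (fun i f => c i (fun s => f (map sigma s))); apply: push_chains sh _ cc.
move=> s cs f _ _ fF /mapP[x xs ->] /mapP[y ys ->].
apply: HA fF => j a aA; have [jr|jr] := leqP j r'; last first.
  by rewrite !coord_out // subrr rnorm0 ltW.
have xy : rnorm (u (j, a) x - u (j, a) y) <= b / 3.
  by apply: cs => //; apply/allpairsP; exists (j, a); split; rewrite ?mem_iota.
have hx := uP (j, a) aA x; have := uP (j, a) aA y; rewrite /= rnorm_distC => hy.
rewrite (_ : _ - _ = (coord r' j a (sigma x) - u (j, a) x) + (u (j, a) x - u (j, a) y)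
  + (u (j, a) y - coord r' j a (sigma y))); last by rewrite !addrA !subrK.
rewrite (le_trans (rnormD _ _)) // (_ : b = b / 3 + b / 3 + b / 3); last by field.
by rewrite lerD // (le_trans (rnormD _ _)) // lerD.
Qed.

(** By freeness and compactness, finitely many functions, each of them small at
    some point and large on the rest of its orbit, cut the iterated join into pieces on
    which the orbits of [h] are labelled by the cyclic group. *)
Lemma free_labelling (h : G) q d : (1 < q)%N -> (h ^+ q = 1)%g ->
  (forall j, (0 < j < q)%N -> (h ^+ j <> 1)%g) ->
  exists m (label : Z d -> nat * 'Z_q) (F : seq (cfun R (Z d))) (e : R),
    [/\ 0 < e, forall x, label (gact h x) = label_shift (label x) &
      forall s, close_on F e s -> coherent m (map label s)].
Proof.
move=> q1 hq hfree; have q0 := ltnW q1.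
pose P (f : cfun R (Z d)) z := rnorm (f z) < 1 / 4 /\
  forall j : 'I_q, j != 0%N :> nat -> 3 / 4 < rnorm (f (gact (h ^+ j)%g z)).
have [||s sP] := @compact_finite_cover (Z d) (cfun R (Z d)) P.
- exact: compactT.
- move=> y; pose B : set (Z d) := \bigcup_(j in [set j : 'I_q | j != 0%N :> nat])
    [set gact (h ^+ j)%g y].
  have cB : closed B.
    apply: closed_bigcup => [|j _]; first exact: finite_finset.
    by apply: accessible_closed_set1; apply: hausdorff_accessible; exact: hausdorffT.
  have By : ~ B y.
    move=> [j /= j0 /esym /multi_join_free hj]; apply: (hfree j) => //.
    by rewrite lt0n j0 ltn_ord.
  have [f [_ fy fB]] := @separate_closed R _ y B cB By; exists f.
  have cn (g : G) : continuous (fun z => rnorm (f (gact g z))).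
    move=> z; apply: (continuous_comp (f := fun z => f (gact g z)));
      last exact: rnorm_continuous.
    apply: (continuous_comp (f := gact g)); first exact: gact_continuous_r.
    exact: cfun_continuous.
  have n1 : \forall z \near y, rnorm (f z) < 1 / 4.
    have : \forall z \near y, rnorm (f (gact 1%g z)) < 1 / 4.
      by apply: (cvgr_lt _ (cn 1%g y)); rewrite /= gact1 fy rnorm0 divr_gt0.
    by apply: filterS => z; rewrite gact1.
  have n2 : \forall z \near y, forall j : 'I_q, j != 0%N :> nat ->
      3 / 4 < rnorm (f (gact (h ^+ j)%g z)).
    apply: filter_forall => j; have [->|j0] := eqVneq (j : nat) 0%N.
      by apply: nearW => z; rewrite ?eqxx.
    have : \forall z \near y, 3 / 4 < rnorm (f (gact (h ^+ j)%g z)).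
      apply: (cvgr_gt _ (cn (h ^+ j)%g y)); rewrite /= fB; last by exists j.
      by rewrite [ltRHS](rnorm_realC 1) normr1; lra.
    by apply: filterS.
  exact: filterI n1 n2.
have P_unique f z z' j j' : (j < q)%N -> (j' < q)%N ->
    P f (gact (h ^+ j)%g z) -> P f (gact (h ^+ j')%g z') ->
    rnorm (f (gact (h ^+ j)%g z) - f (gact (h ^+ j)%g z')) <= 1 / 4 -> j = j'.
  move=> jq jq' [fz _] [_ Pz'] close; apply: contrapT => jj'.
  have kq : ((j + (q - j')) %% q < q)%N by rewrite ltn_pmod.
  have k0 : ((j + (q - j')) %% q != 0)%N.
    apply/negP => /dvdnP[[|[|k]]]; rewrite ?mul0n ?mul1n; try lia.
  have := Pz' (Ordinal kq) k0; rewrite /= -gactM expg_modn // -expgnDr.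
  rewrite -addnA subnK ?(ltnW jq') // expgnDr hq mulg1 => lt.
  have := rnormD (f (gact (h ^+ j)%g z') - f (gact (h ^+ j)%g z)) (f (gact (h ^+ j)%g z)).
  by rewrite subrK rnorm_distC; lra.
pose hit z f := `[< exists2 j, (j < q)%N & P f (gact (h ^+ j)%g z) >].
have hit_s z : has (hit z) s.
  have [f fs Pf] := sP z; apply/hasP; exists f => //.
  by apply/asboolP; exists 0%N => //; rewrite expg0 gact1.
have hit_h z f : hit (gact h z) f = hit z f.
  apply/asboolP/asboolP => -[j jq Pj].
    exists (j.+1 %% q)%N; first by rewrite ltn_pmod.
    by rewrite expg_modn // expgSr gactM.
  exists ((j + q.-1) %% q)%N; first by rewrite ltn_pmod.
  by rewrite expg_modn // -gactM -expgSr -addnS prednK // expgnDr hq mulg1.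
pose idx z := find (hit z) s.
have idx_h z : idx (gact h z) = idx z by apply: eq_find => f; exact: hit_h.
have /choice[ph phP] z : exists j, (j < q)%N /\ P (nth 0 s (idx z)) (gact (h ^+ j)%g z).
  by have /asboolP[j jq Pj] := nth_find 0 (hit_s z); exists j.
have phh z : ((ph (gact h z)).+1 %% q)%N = ph z.
  have [jq Pj] := phP z; have [jq' Pj'] := phP (gact h z).
  apply: (P_unique (nth 0 s (idx z)) z z) => //; first by rewrite ltn_pmod.
    by rewrite expg_modn // expgSr gactM -idx_h.
  by rewrite subrr rnorm0 divr_ge0.
exists (size s), (fun z => (idx z, - (ph z)%:R)).
exists [seq translate (h ^+ j)^-1%g f | f <- s, j <- iota 0 q], (1 / 4); split.
- by rewrite divr_gt0.
- move=> z; rewrite /label_shift /= idx_h -[in RHS]phh; congr (_, _).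
  by rewrite Zp_nat_mod // -natr1 opprD subrK.
move=> t close; split=> [_ /mapP[z _ ->]|_ _ /mapP[z zt ->] /mapP[z' zt' ->] /= ii].
  by rewrite /= -has_find.
have [jq Pj] := phP z; have [jq' Pj'] := phP z'; rewrite ii; congr (_, - _%:R).
rewrite ii in Pj; apply: (P_unique _ _ _ _ _ jq jq' Pj Pj').
set f := nth 0 s _; have fs : f \in s by rewrite mem_nth // -has_find.
have tE x : translate (h ^+ ph z)^-1%g f x = f (gact (h ^+ ph z)%g x).
  by rewrite -{2}(invgK (h ^+ ph z)%g).
have : rnorm (translate (h ^+ ph z)^-1%g f z - translate (h ^+ ph z)^-1%g f z') <= 1 / 4.
  apply: close => //; apply/allpairsP; exists (f, ph z); split.
  - exact: fs.
  - by rewrite mem_iota.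
  - by [].
by rewrite !tE.
Qed.

(** Joining with the identity of [G] gives maps from the join of [n.+1 + i] copies
    to that of [d.+1 + i] copies for all [i], so that composing them carries chains
    of arbitrarily high degree to the join of [d.+1] copies, where the labelling
    bounds their degree. *)
Theorem no_approximable (h : G) q n d : (1 < q)%N -> (h ^+ q = 1)%g ->
  (forall j, (0 < j < q)%N -> (h ^+ j <> 1)%g) -> (d < n)%N ->
  ~ @approximable R G h n d.
Proof.
move=> q1 hq hfree dn app.
have app' i : @approximable R G h (n + i) (d + i).
  by elim: i => [|i IH]; rewrite ?addn0 // !addnS; exact: approximable_join.
have chains k : @fine_chains R G h q k k.
  by elim: k => [|k IH]; [exact: fine_chains0|exact: fine_chains_join].
have down l k : @fine_chains R G h q (d + l * (n - d)) k -> @fine_chains R G h q d k.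
  elim: l => [|l IH]; first by rewrite addn0.
  move=> H; apply: IH; apply: fine_chains_transport H.
  have := app' (l * (n - d))%N; rewrite mulSn addnA.
  by rewrite (subnKC (ltnW dn)).
have [m [label [F [e [e0 label_h coh]]]]] := @free_labelling h q d q1 hq hfree.
have [k mk fk] : exists2 k, (m <= k)%N & @fine_chains R G h q d k.
  exists (d + m * (n - d))%N; last exact: (down m).
  by rewrite (leq_trans _ (leq_addl _ _)) // leq_pmulr // subn_gt0.
have [c cc] := fk F e e0.
have ck := push_chains label_h coh cc.
exact: (no_coherent_chains q1 (cyclic_chains_le mk ck)).
Qed.

End lower_bound.

Local Open Scope ring_scope.

(* The hypothesis [G1] excludes the trivial group, for which the dimension is 0. *)
Theorem corollary5p3 (R : realType) (G : compactGroupType)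
    (lieG : is_lie_group R G) (G1 : exists g : G, g <> 1%g)
    (n : nat) (n_ge1 : (1 <= n)%N) :
  dim_Rok_c (canonical_action R (join_power R G n.+1)) = n%:R%:E.
Proof.
apply/eqP; rewrite eq_le; apply/andP; split; first exact: dim_Rok_c_le.
rewrite leNgt; apply/negP => /ereal_inf_lt[_ [d [phi towers] <-]].
rewrite lte_fin ltr_nat => dn; have [t [k [k0 t1 tk]]] := lie_torsion lieG G1.
have exq : exists q, (0 < q)%N && (t ^+ q == 1)%g by exists k; rewrite k0 tk eqxx.
case: (ex_minnP exq) => q /andP[q0 /eqP tq] qmin.
have q1 : (1 < q)%N.
  rewrite ltn_neqAle q0 andbT; apply/eqP => q1.
  by apply: t1; rewrite -[t]expg1 q1 tq.
apply: (no_approximable q1 tq _ dn (towers_approximable towers q0 tq)).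
move=> j /andP[j0 jq] tj; move: jq; rewrite ltnNge => /negP; apply.
by apply: qmin; rewrite j0 tj eqxx.
Qed.
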